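(* Let $2\le p<\infty$ and let $f\in L^p$ be a first-order Haar chaos, $f=\sum_{k\ge0}c_kh_{2^k}$. The following conditions are equivalent: (i) the system of dilations and translations $\{f_n\}_{n\ge1}$ of $f$ is a basis of $L^p_0$ equivalent to the Haar system $\{h_n\}_{n\ge1}$; (ii) for every $d=1,2,\dots$ the subsystem $\{f_n\}_{n\in N_d}$ is a basis of the subspace $\mathcal H^d_{ch}\cap L^p$ equivalent to the Haar subsystem $\{h_n\}_{n\in N_d}$; (iii) the subsystem $\{f_{2^k}\}_{k\ge0}$ is a basis of the subspace $\mathcal H^1_{ch}\cap L^p$ equivalent to the Haar subsystem $\{h_{2^k}\}_{k\ge0}$; (iv) the functions $\hat f(z)$ and $1/\hat f(z)$ both belong to $M_p^+(\mathbb D_{2^{-1/p}})$.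
   Context: All functions are complex-valued on $I=(0,1]$ with Lebesgue measure; $L^p_0$ denotes the closed subspace of mean-zero functions in $L^p(0,1)$. Let $h=\chi_{(0,1/2]}-\chi_{(1/2,1]}$. For $n=2^k+j$ with $k\ge0$, $0\le j\le 2^k-1$, the Haar function $h_n$ equals $h(2^kt-j)$ for $t\in(j2^{-k},(j+1)2^{-k}]$ and $0$ otherwise. For a mean-zero $f\in L^1$, its system of dilations and translations $\{f_n\}_{n\ge1}$ is defined by $f_n(t)=f(2^kt-j)$ for $t\in(j2^{-k},(j+1)2^{-k}]$ and $f_n(t)=0$ otherwise, with the same $n=2^k+j$. A first-order Haar chaos is a function $f=\sum_{k\ge0}c_kh_{2^k}$, $c_k\in\mathbb C$ (the sum is finite at each point of $I$); its symbol is the power series $\hat f(z)=\sum_{k\ge0}c_kz^k$. For $d\ge1$, $N_d$ is the set of positive integers with exactly $d$ ones in their binary expansion; $\mathcal H^d_{ch}$ is the set of functions $\sum_{n\in N_d}\xi_nh_n$ (Haar chaoses of order $d$), and for $1<p<\infty$, $\mathcal H^d_{ch}\cap L^p$ equals the closed linear span of $\{h_n\}_{n\in N_d}$ in $L^p$. For $1\le p\le\infty$, $R>0$, $A_p^+(\mathbb D_R)$ is the Banach space of analytic $u(z)=\sum_k a_kz^k$ in $\mathbb D_R=\{|z|<R\}$ with $\|u\|=\|(a_kR^k)_k\|_{\ell^p}<\infty$; $M_p^+(\mathbb D_R)$ is the Banach algebra of those $u\in A_p^+(\mathbb D_R)$ with $uv\in A_p^+(\mathbb D_R)$ for all $v\in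 A_p^+(\mathbb D_R)$, normed by the multiplication operator norm. A sequence $\{f_n\}_{n\in N}$ is a basis of a closed subspace $Y$ equivalent to $\{h_n\}_{n\in N}$ if there is a linear isomorphism (bounded with bounded inverse) of the closed span $[h_n:n\in N]$ onto $Y$ mapping $h_n$ to $f_n$ for all $n\in N$. *)

(* Defs.v *)
From HB Require Import structures.
From mathcomp Require Import all_boot all_order all_algebra.
From mathcomp Require Import all_classical all_reals all_analysis.
From mathcomp Require Import complex.

Set Implicit Arguments.
Unset Strict Implicit.
Unset Printing Implicit Defensive.

Import Order.TTheory GRing.Theory Num.Theory.
Local Open Scope classical_set_scope.
Local Open Scope ring_scope.

Section Defs.
Variable R : realType.

Definition cabs (z : R[i]) : R := ComplexField.Normc.normc z.

Definition I01 : set R := `]0, 1]%classic.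
Lemma measurable_I01 : measurable (I01 : set (measurableTypeR R)).
Proof. exact: measurable_itv. Qed.
Definition muI : {measure set (measurableTypeR R) -> \bar R} :=
  @mrestr _ (measurableTypeR R) R I01 lebesgue_measure measurable_I01.

Definition cmeasurable (g : R -> R[i]) : Prop :=
  measurable_fun I01 (fun x => complex.Re (g x)) /\
  measurable_fun I01 (fun x => complex.Im (g x)).

Definition pnorm (p : R) (g : R -> R[i]) : \bar R :=
  Lnorm muI p%:E (fun x => (cabs (g x))%:E).

Definition Lp (p : R) (g : R -> R[i]) : Prop :=
  cmeasurable g /\ (pnorm p g < +oo)%E.

Definition Lp0 (p : R) : set (R -> R[i]) :=
  [set g | Lp p g /\
           (\int[muI]_x (complex.Re (g x))%:E = 0)%E /\
           (\int[muI]_x (complex.Im (g x))%:E = 0)%E].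

Definition haar (t : R) : R[i] :=
  if (0 < t) && (t <= 2^-1) then 1
  else if (2^-1 < t) && (t <= 1) then -1 else 0.

Definition dil (F : R -> R[i]) (n : nat) (t : R) : R[i] :=
  let k := trunc_log 2 n in
  let j := (n - 2 ^ k)%N in
  if (j%:R / 2 ^+ k < t) && (t <= j.+1%:R / 2 ^+ k)
  then F (2 ^+ k * t - j%:R) else 0.

Definition haarn (n : nat) : R -> R[i] := dil haar n.

Definition ones (n : nat) : nat := (\sum_(i < n.+1) odd (n %/ 2 ^ i))%N.

Definition comb (F : nat -> R -> R[i]) (P : pred nat) (M : nat)
    (a : nat -> R[i]) (t : R) : R[i] :=
  \sum_(n < M | P n) a n * F n t.

Definition cspan (p : R) (F : nat -> R -> R[i]) (P : pred nat) :
    set (R -> R[i]) :=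
  [set g | Lp p g /\ forall e : R, 0 < e -> exists M a,
      (pnorm p (fun t => (g t - comb F P M a t)%R) < e%:E)%E].

(** {F_n}_{P n} is a basis of Y equivalent to {G_n}_{P n}: the map
    G_n |-> F_n extends to an isomorphism of [G_n : P n] onto Y, i.e.
    the norms of finite combinations are equivalent and the closed span
    of {F_n} is Y. *)
Definition equiv_basis (p : R) (Y : set (R -> R[i]))
    (F G : nat -> R -> R[i]) (P : pred nat) : Prop :=
  cspan p F P = Y /\
  exists A B : R, 0 < A /\ 0 < B /\
    forall (M : nat) (a : nat -> R[i]),
      (A%:E * pnorm p (comb G P M a) <= pnorm p (comb F P M a))%E /\
      (pnorm p (comb F P M a) <= B%:E * pnorm p (comb G P M a))%E.

Definition Hch (p : R) (d : nat) : set (R -> R[i]) :=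
  cspan p haarn (fun n => ones n == d).

(** A_p^+(D_r) for coefficient sequences, 1 <= p < oo *)
Definition Ap (p r : R) (a : nat -> R[i]) : Prop :=
  (\sum_(0 <= k <oo) ((cabs (a k) * r ^+ k) `^ p)%:E < +oo)%E.

Definition cprod (a b : nat -> R[i]) (n : nat) : R[i] :=
  \sum_(i < n.+1) a i * b (n - i)%N.

Definition Mp (p r : R) (a : nat -> R[i]) : Prop :=
  Ap p r a /\ forall v, Ap p r v -> Ap p r (cprod a v).

End Defs.

(* Main.v *)
(** On Haar sums the map [h_n |-> f_n] is [\sum_k c_k S^k] with [S h_n = h_(2n)],
    so it acts on every chain of coefficients [xi_m, xi_(2m), xi_(4m), ...]
    ([m] odd) as Cauchy multiplication by [c].  A Burkholder-Rosenthal inequality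
    for the filtration that stops only at the right turns of the dyadic tree
    bounds the [L^p] norm of a Haar sum by an expression that depends only, and
    monotonically, on the chainwise weighted [l^2] and [l^p] norms.  The weighted
    [l^p] norm of a chain is the norm of [A_p^+] on the disc of radius
    [2^(-1/p)], and a multiplier for it is one for the weighted [l^2] norm too,
    because its coefficients decay geometrically in the latter scale.
    Conversely, on the chain [m = 1] the [L^p] norm is equivalent to the
    weighted [l^p] norm, so a norm equivalence there, together with the
    approximability of [h_1], makes [c] and its inverse multipliers. *)
Require Import Defs.
From HB Require Import structures.
From mathcomp Require Import all_boot all_order all_algebra.
From mathcomp Require Import all_classical all_reals all_analysis.
From mathcomp Require Import measurable_realfun.
From mathcomp Require Import complex.
From mathcomp Require Import zify ring lra.
Set Implicit Arguments.
Unset Strict Implicit.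
Unset Printing Implicit Defensive.
Import Order.TTheory GRing.Theory Num.Theory.
Import numFieldNormedType.Exports.
Local Open Scope classical_set_scope.
Local Open Scope ring_scope.

(** * Powers of the complex modulus *)

(** The ordinary dyadic square function mixes, at one point, entries of many chains and is not
    visibly a function of chain sums. Between two right turns a path follows a single chain; in the
    coarser filtration a whole chain is therefore one martingale difference, whose conditional
    variance is the weighted [l^2] sum of that chain. Two obstacles shape the way from the norm
    equivalence to the symbol. A pointwise finite expansion does not determine the mean: the
    constant 1 on [(0,1]] is the sum of the functions [- 2^k h_(2^k)]. So the mean of [f] is first
    shown to vanish, because [f_1] lies in the closed span of Haar functions; only then are the
    partial sums conditional expectations of [f], which puts [c] in [A_p^+] and makes remainders
    controllable. Moreover two-sided norm estimates on the chain [m = 1] cannot by themselves give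
    an inverse multiplier, since the symbol [z] satisfies them; approximating [h_1] excludes
    this. *)

Section ComplexModulus.
Variable R : realType.
Implicit Types (x y z : R[i]) (p : R).

Lemma cabsE z : (cabs z)%:C%C = `|z|.
Proof. by []. Qed.

Lemma cabs_ge0 z : 0 <= cabs z.
Proof. by case: z => a b; rewrite /cabs /= sqrtr_ge0. Qed.

Lemma cabsD x y : cabs (x + y) <= cabs x + cabs y.
Proof. by rewrite -lecR rmorphD /= !cabsE ler_normD. Qed.

Lemma cabsM x y : cabs (x * y) = cabs x * cabs y.
Proof. exact: ComplexField.Normc.normcM. Qed.

Lemma cabs0 : cabs (0 : R[i]) = 0.
Proof. exact: ComplexField.Normc.normc0. Qed.

Lemma cabs1 : cabs (1 : R[i]) = 1.
Proof. exact: ComplexField.Normc.normc1. Qed.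

Lemma cabsN x : cabs (- x) = cabs x.
Proof. by case: x => a b; rewrite /cabs /= !sqrrN. Qed.

Lemma cabsB x y : cabs (x - y) <= cabs x + cabs y.
Proof. by rewrite -(cabsN y) cabsD. Qed.

Lemma cabs_eq0 x : cabs x = 0 -> x = 0.
Proof. exact: ComplexField.Normc.eq0_normc. Qed.

Lemma cabs_sum (I : Type) (r : seq I) (P : pred I) (F : I -> R[i]) :
  cabs (\sum_(i <- r | P i) F i) <= \sum_(i <- r | P i) cabs (F i).
Proof.
elim/big_rec2: _ => [|i u v _ h]; first by rewrite cabs0.
by apply: (le_trans (cabsD _ _)); rewrite lerD2l.
Qed.

Lemma sqr_cabs x : cabs x ^+ 2 = complex.Re x ^+ 2 + complex.Im x ^+ 2.
Proof. by case: x => a b; rewrite /cabs /= sqr_sqrtr // addr_ge0 // sqr_ge0. Qed.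

Definition cip x y : R :=
  complex.Re x * complex.Re y + complex.Im x * complex.Im y.

Lemma cipD x y z : cip x (y + z) = cip x y + cip x z.
Proof. by case: x y z => a b [c d] [e f]; rewrite /cip /=; ring. Qed.

Lemma cipN x y : cip x (- y) = - cip x y.
Proof. by case: x y => a b [c d]; rewrite /cip /=; ring. Qed.

Lemma sqr_cabsD x y : cabs (x + y) ^+ 2 = cabs x ^+ 2 + cip x y *+ 2 + cabs y ^+ 2.
Proof. by rewrite !sqr_cabs; case: x y => a b [c d]; rewrite /cip /=; ring. Qed.

Lemma sqr_cabsB x y : cabs (x - y) ^+ 2 = cabs x ^+ 2 - cip x y *+ 2 + cabs y ^+ 2.
Proof. by rewrite sqr_cabsD cipN cabsN mulNrn. Qed.

Lemma cip_le x y : `|cip x y| <= cabs x * cabs y.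
Proof.
rewrite -(@ler_pXn2r _ 2) ?nnegrE ?mulr_ge0 ?cabs_ge0 // exprMn !sqr_cabs real_normK ?num_real//.
case: x y => a b [c d]; rewrite /cip /= -subr_ge0.
have -> : (a ^+ 2 + b ^+ 2) * (c ^+ 2 + d ^+ 2) - (a * c + b * d) ^+ 2 = (a * d - b * c) ^+ 2 by ring.
exact: sqr_ge0.
Qed.

Lemma cabs_Re x : `|complex.Re x| <= cabs x.
Proof.
rewrite -(@ler_pXn2r _ 2) ?nnegrE ?cabs_ge0 // real_normK ?num_real// sqr_cabs.
by rewrite lerDl sqr_ge0.
Qed.

Lemma cabs_Im x : `|complex.Im x| <= cabs x.
Proof.
rewrite -(@ler_pXn2r _ 2) ?nnegrE ?cabs_ge0 // real_normK ?num_real// sqr_cabs.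
by rewrite lerDr sqr_ge0.
Qed.

Lemma cabs_le_ReIm x : cabs x <= `|complex.Re x| + `|complex.Im x|.
Proof.
rewrite -(@ler_pXn2r _ 2) ?nnegrE ?cabs_ge0 ?addr_ge0 // sqr_cabs sqrrD.
rewrite !real_normK ?num_real//.
by rewrite -addrA [X in _ <= _ + X]addrC addrA lerDl mulrn_wge0 // mulr_ge0.
Qed.

End ComplexModulus.

Section RealPowers.
Variable R : realType.
Implicit Types (a b s t u x y p q r : R).

Lemma powR_mono r a b : 0 <= r -> 0 <= a -> a <= b -> a `^ r <= b `^ r.
Proof.
by move=> r0 a0 ab; apply: ge0_ler_powR => //; rewrite nnegrE // (le_trans a0).
Qed.

Lemma powRS r a : 0 <= r -> 0 <= a -> a `^ (r + 1) = a `^ r * a.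
Proof.
move=> r0 a0; by rewrite powRD ?powRr1 // gt_eqF // ltr_wpDl.
Qed.

Lemma powRDp r s a : 0 <= r -> 0 < s -> a `^ (r + s) = a `^ r * a `^ s.
Proof.
move=> r0 s0; by rewrite powRD // gt_eqF // ltr_wpDl.
Qed.

Lemma powR_sqr q a : 0 <= a -> (a ^+ 2) `^ q = a `^ (2 * q).
Proof. by move=> a0; rewrite -powR_mulrn // -powRrM. Qed.

Lemma powR_convex p a b : 1 <= p -> 0 <= a -> 0 <= b ->
  ((a + b) / 2) `^ p <= (a `^ p + b `^ p) / 2.
Proof.
move=> p1 a0 b0.
have h2 : (0 : R) <= (2^-1 : R) by rewrite invr_ge0.
have h3 : (2^-1 : R) <= 1 by rewrite invf_le1 ?ler1n.
have := @convex_powR R p p1 (Itv01 h2 h3) a b.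
rewrite !inE /= !in_itv /= a0 b0 /= => /(_ isT isT).
rewrite [X in X `^ _ <= _ -> _]convRE [X in _ <= X -> _]convRE /=.
rewrite (_ : mathcomp.classical.unstable.onem 2^-1 = 2^-1 :> R); last by rewrite /mathcomp.classical.unstable.onem; lra.
by rewrite -!mulrDr ![2^-1 * _]mulrC.
Qed.

Lemma powR_superadd q a b : 1 <= q -> 0 <= a -> 0 <= b ->
  a `^ q + b `^ q <= (a + b) `^ q.
Proof.
move=> q1 a0 b0.
have q10 : 0 <= q - 1 by lra.
have -> : q = (q - 1) + 1 by ring.
have ab0 : 0 <= a + b by rewrite addr_ge0.
rewrite !powRS // mulrDr lerD // ler_wpM2r //.
  by apply: powR_mono => //; rewrite lerDl.
by apply: powR_mono => //; rewrite lerDr.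
Qed.

(** Convexity of [t^q] at [b] without derivatives: Young's inequality for [a b^(q-1)] with the
    conjugate exponents [q] and [q/(q-1)]. *)
Lemma powR_tangent q a b : 1 <= q -> 0 <= a -> 0 <= b ->
  b `^ q - a `^ q <= q * b `^ (q - 1) * (b - a).
Proof.
move=> q1 a0 b0.
have q0 : 0 < q by lra.
have [->|qn1] := eqVneq q 1; first by rewrite subrr powRr0 !powRr1 // !mul1r.
have q10 : 0 < q - 1 by rewrite lt_neqAle eq_sym subr_eq0 qn1 subr_ge0.
pose s := q / (q - 1).
have s0 : 0 < s by rewrite divr_gt0.
have hs : q^-1 + s^-1 = 1 by rewrite /s; field; rewrite !lt0r_neq0.
have := conjugate_powR a0 (powR_ge0 b (q - 1)) q0 s0 hs.
have -> : (b `^ (q - 1)) `^ s = b `^ q.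
  by rewrite -powRrM; congr (_ `^ _); rewrite /s; field; rewrite lt0r_neq0.
have -> : b `^ q / s = b `^ q - b `^ q / q.
  by rewrite /s; field; rewrite !lt0r_neq0.
have hb : b * b `^ (q - 1) = b `^ q by rewrite mulr_powRB1.
move=> h.
have h' : q * (a * b `^ (q - 1)) <= a `^ q + q * b `^ q - b `^ q.
  have -> : a `^ q + q * b `^ q - b `^ q = q * (a `^ q / q + (b `^ q - b `^ q / q)).
    by field; rewrite lt0r_neq0.
  by rewrite ler_pM2l.
by rewrite mulrBr -!mulrA [_ * b]mulrC hb [b `^ (q - 1) * a]mulrC; lra.
Qed.

(** On either side of 1, an integer power [s^m] with [m >= r] is farther from 1 than [s^r], and
    integer powers are Lipschitz on [[0,4]]. The interval leaves room for the ratio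
    [|x+y|^2 / |x|^2] when [|y| < |x|/2]. *)
Lemma powR_near1 r : 0 <= r -> exists2 C : R, 0 <= C &
  forall s, 0 <= s <= 4 -> `|s `^ r - 1| <= C * `|s - 1|.
Proof.
move=> r0.
pose m := (Num.truncn r).+1.
have rm : r <= m%:R by apply/ltW; rewrite truncnS_gt.
have lip k : exists2 C : R, 0 <= C & forall s, 0 <= s <= 4 -> `|s ^+ k - 1| <= C * `|s - 1|.
  elim: k => [|k [C C0 IH]].
    by exists 0 => // s _; rewrite expr0 subrr normr0 mul0r.
  exists (4 * C + 1) => [|s /andP[s0 s4]]; first by lra.
  have -> : s ^+ k.+1 - 1 = s * (s ^+ k - 1) + (s - 1) by rewrite exprS; ring.
  apply: (le_trans (ler_normD _ _)); rewrite normrM (ger0_norm s0) mulrDl mul1r lerD2r.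
  rewrite -mulrA; apply: ler_pM => //; apply: IH; by rewrite s0.
have [C C0 hC] := lip m.
have e1 : (1 : R) `^ r = 1 by rewrite powR1.
exists C => // s /andP[s0 s4]; apply: le_trans (hC s _); last by rewrite s0.
have [s1|s1] := leP 1 s.
  rewrite !ger0_norm ?subr_ge0 ?exprn_ege1 //; last first.
    by rewrite -{1}e1; apply: powR_mono.
  by rewrite lerD2r -powR_mulrn // ler_powR.
rewrite !ler0_norm ?subr_le0 ?exprn_ile1 ?(ltW s1) //; last first.
  by rewrite -e1; apply: powR_mono => //; exact: ltW.
rewrite !opprB lerD2l lerN2.
have [->|sn0] := eqVneq s 0; first by rewrite expr0n /= powR_ge0.
by rewrite -powR_mulrn // ger_powR // lt_neqAle eq_sym sn0 s0 ltW.
Qed.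

Lemma powR_exch p a b : 1 <= p -> 0 <= a -> 0 <= b ->
  (a + b) `^ p <= 2 `^ p * (a `^ p + b `^ p).
Proof.
move=> p1 a0 b0; have p0 : 0 <= p by lra.
have -> : a + b = 2 * ((a + b) / 2) by field.
rewrite powRM ?divr_ge0 ?addr_ge0 //.
rewrite ler_wpM2l ?powR_ge0 // (le_trans (powR_convex _ _ _)) //.
have := powR_ge0 a p; have := powR_ge0 b p; lra.
Qed.

End RealPowers.

Section PowerInequalities.
Variable R : realType.
Implicit Types (a b s t A V : R) (x y z : R[i]).

Variable p : R.
Hypothesis p2 : 2 <= p.

Local Ltac plra := have := p2; lra.

Lemma powR_sub2 a : 0 <= a -> a `^ (p - 2) * a ^+ 2 = a `^ p.
Proof.
move=> a0; rewrite -powR_mulrn // -powRDp ?subr_ge0 //.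
by congr (_ `^ _); ring.
Qed.

Lemma powR_half_sqr a : 0 <= a -> (a ^+ 2) `^ (p / 2) = a `^ p.
Proof. by move=> a0; rewrite powR_sqr //; congr (_ `^ _); field. Qed.

(** The parallelogram law, with superadditivity of [t^(p/2)] on one side of it and convexity on the
    other. *)
Lemma cabs_powR_parallelogram x y :
  cabs x `^ p + cabs y `^ p <= (cabs (x + y) `^ p + cabs (x - y) `^ p) / 2.
Proof.
have q1 : 1 <= p / 2 by plra.
rewrite -!powR_half_sqr ?cabs_ge0 //.
apply: le_trans (powR_convex q1 (sqr_ge0 _) (sqr_ge0 _)).
apply: (le_trans (powR_superadd q1 (sqr_ge0 _) (sqr_ge0 _))).
rewrite (_ : (_ + _) / 2 = cabs x ^+ 2 + cabs y ^+ 2) //.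
by rewrite sqr_cabsD sqr_cabsB; field.
Qed.

Lemma cabs_powR_mid (r : R) x y : 1 <= r ->
  cabs x `^ r <= (cabs (x + y) `^ r + cabs (x - y) `^ r) / 2.
Proof.
move=> r1; apply: le_trans (powR_convex r1 (cabs_ge0 _) (cabs_ge0 _)).
apply: powR_mono; rewrite ?cabs_ge0 //; first by lra.
have e2 : cabs (2 : R[i]) = 2.
  by apply: complexI; rewrite cabsE normr_nat rmorph_nat.
have := cabsD (x + y) (x - y).
have -> : x + y + (x - y) = 2 * x by ring.
by rewrite cabsM e2; lra.
Qed.

(** The linear term is kept exact so that it cancels when averaged over a martingale step; the
    second-order part only has to be bounded. *)
Lemma cabs_powR_taylor : exists2 C : R, 0 <= C & forall x y,
  cabs (x + y) `^ p <= cabs x `^ p + p * cabs x `^ (p - 2) * cip x y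
     + C * (cabs x `^ (p - 2) * cabs y ^+ 2 + cabs y `^ p).
Proof.
have q10 : 0 <= p / 2 - 1 by plra.
have [C C0 hC] := powR_near1 q10.
pose C1 := 3 `^ p + p * 2 `^ (p - 2) * 2.
pose C2 := p / 2 + p / 2 * C * (25 / 4).
have C10 : 0 <= C1.
  by rewrite /C1 addr_ge0 ?powR_ge0 // !mulr_ge0 ?powR_ge0 //; plra.
have C20 : 0 <= C2 by rewrite /C2 addr_ge0 ?mulr_ge0 //; plra.
exists (C1 + C2) => [|x y]; first by rewrite addr_ge0.
set a := cabs x; set b := cabs y; set c := cabs (x + y).
have a0 : 0 <= a by exact: cabs_ge0.
have b0 : 0 <= b by exact: cabs_ge0.
have c0 : 0 <= c by exact: cabs_ge0.
have cab : c <= a + b by exact: cabsD.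
have := cip_le x y; rewrite -/a -/b; set d := cip x y => hd.
have hc2 : c ^+ 2 = a ^+ 2 + d *+ 2 + b ^+ 2 by exact: sqr_cabsD.
have pa0 := powR_ge0 a (p - 2); have pb0 := powR_ge0 b p.
have pab0 : 0 <= a `^ (p - 2) * b ^+ 2 by rewrite mulr_ge0 // sqr_ge0.
(* If [|x| <= 2|y|], all terms are at most constant multiples of [|y|^p]. Otherwise
   [|x+y|^2 = s |x|^2] with [s] in [[0,4]], and [s^(p/2)] is expanded at 1. *)
have [ab|ba] := leP a (2 * b).
  have h1 : c `^ p <= 3 `^ p * b `^ p.
    by rewrite -powRM //; apply: powR_mono; plra.
  have h2 : - (p * a `^ (p - 2) * d) <= p * 2 `^ (p - 2) * 2 * b `^ p.
    have h3 : - d <= 2 * b ^+ 2.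
      have := ler_norm (- d); rewrite normrN => /le_trans; apply.
      by apply: (le_trans hd); rewrite expr2 mulrA ler_wpM2r.
    have h4 : a `^ (p - 2) <= 2 `^ (p - 2) * b `^ (p - 2).
      by rewrite -powRM //; apply: powR_mono => //; plra.
    rewrite -mulrN -[b `^ p]powR_sub2 // -!mulrA ler_pM2l; last plra.
    rewrite (_ : 2 `^ (p - 2) * _ = (2 `^ (p - 2) * b `^ (p - 2)) * (2 * b ^+ 2)); last by ring.
    have [d0|d0] := leP 0 (- d); first by rewrite ler_pM.
    apply: (@le_trans _ _ 0); first by rewrite mulr_ge0_le0 // ltW.
    by rewrite !mulr_ge0 ?powR_ge0 ?sqr_ge0.
  rewrite [(C1 + C2) * _]mulrDl.
  have : 0 <= C2 * (a `^ (p - 2) * b ^+ 2 + b `^ p) by rewrite mulr_ge0 // addr_ge0 //.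
  have : 0 <= C1 * (a `^ (p - 2) * b ^+ 2) by rewrite mulr_ge0.
  have := powR_ge0 a p; rewrite mulrDr {2}/C1 mulrDl; plra.
have agt0 : 0 < a by plra.
have a2gt0 : 0 < a ^+ 2 by rewrite exprn_gt0.
pose s := c ^+ 2 / a ^+ 2.
have cs : c ^+ 2 = a ^+ 2 * s by rewrite /s; field; rewrite lt0r_neq0.
have s0 : 0 <= s by rewrite divr_ge0 ?sqr_ge0.
have s4 : s <= 4.
  rewrite ler_pdivrMr // -[4](_ : 2 ^+ 2 = 4); last by ring.
  by rewrite -exprMn ler_pXn2r ?nnegrE //; plra.
have s04 : 0 <= s <= 4 by rewrite s0.
have hs := hC _ s04.
have as1 : a ^+ 2 * (s - 1) = d *+ 2 + b ^+ 2 by rewrite mulrBr -cs hc2; ring.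
have has1 : `|a ^+ 2 * (s - 1)| <= 5 / 2 * (a * b).
  rewrite as1 (le_trans (ler_normD _ _)) // normrMn [`|b ^+ 2|]ger0_norm ?sqr_ge0 //.
  have : b ^+ 2 <= a * b / 2 by rewrite expr2 mulrAC ler_wpM2r //; plra.
  by move: hd; rewrite -[_ *+ 2]mulr_natr; plra.
have has2 : (a ^+ 2) * (s - 1) ^+ 2 <= 25 / 4 * b ^+ 2.
  rewrite -(ler_pM2l a2gt0).
  have -> : a ^+ 2 * (a ^+ 2 * (s - 1) ^+ 2) = (a ^+ 2 * (s - 1)) ^+ 2 by ring.
  have -> : a ^+ 2 * (25 / 4 * b ^+ 2) = (5 / 2 * (a * b)) ^+ 2 by field.
  rewrite -[leLHS]real_normK ?num_real // ler_pXn2r ?nnegrE //.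
  by rewrite !mulr_ge0 //; plra.
have hq : c `^ p = a `^ p * s `^ (p / 2).
  by rewrite -powR_half_sqr // cs powRM ?sqr_ge0 // powR_half_sqr.
have q1 : 1 <= p / 2 by plra.
have ht := powR_tangent q1 (ler01) s0.
have e1 : (1 : R) `^ (p / 2) = 1 by rewrite powR1.
rewrite e1 in ht.
(* The tangent slope [s^(p/2-1)] is replaced by 1; the error is quadratic in [s - 1], hence of order
   [|y|^2 / |x|^2]. *)
have hss : p / 2 * s `^ (p / 2 - 1) * (s - 1) <= p / 2 * (s - 1) + p / 2 * C * (s - 1) ^+ 2.
  rewrite -!(mulrA (p / 2)) -mulrDr ler_pM2l; last plra.
  have -> : s `^ (p / 2 - 1) * (s - 1) = (s - 1) + (s `^ (p / 2 - 1) - 1) * (s - 1) by ring.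
  rewrite lerD2l (le_trans (ler_norm _)) // normrM -[(s - 1) ^+ 2]real_normK ?num_real //.
  by rewrite expr2 mulrA ler_wpM2r.
have hs' : s `^ (p / 2) <= 1 + p / 2 * (s - 1) + p / 2 * C * (s - 1) ^+ 2 by plra.
have hfin : c `^ p <= a `^ p + p * a `^ (p - 2) * d + C2 * (a `^ (p - 2) * b ^+ 2).
  rewrite hq.
  apply: (@le_trans _ _ (a `^ p * (1 + p / 2 * (s - 1) + p / 2 * C * (s - 1) ^+ 2))).
    by rewrite ler_wpM2l ?powR_ge0.
  rewrite -[a `^ p]powR_sub2 //.
  have -> : a `^ (p - 2) * a ^+ 2 * (1 + p / 2 * (s - 1) + p / 2 * C * (s - 1) ^+ 2) =
    a `^ (p - 2) * a ^+ 2 + p / 2 * a `^ (p - 2) * (a ^+ 2 * (s - 1))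
    + p / 2 * C * a `^ (p - 2) * (a ^+ 2 * (s - 1) ^+ 2) by ring.
  rewrite as1 /C2.
  have : p / 2 * C * a `^ (p - 2) * (a ^+ 2 * (s - 1) ^+ 2) <= p / 2 * C * a `^ (p - 2) * (25 / 4 * b ^+ 2).
    by rewrite ler_wpM2l // !mulr_ge0 //; plra.
  rewrite -[d *+ 2]mulr_natr.
  set P := a `^ (p - 2); move=> h.
  have -> : P * a ^+ 2 + p * P * d + (p / 2 + p / 2 * C * (25 / 4)) * (P * b ^+ 2) =
    P * a ^+ 2 + p / 2 * P * (d * 2 + b ^+ 2) + p / 2 * C * P * (25 / 4 * b ^+ 2) by field.
  by rewrite lerD2l.
move: C10 C20 hfin; clearbody C1 C2 => C10 C20 hfin.
have : 0 <= C1 * (a `^ (p - 2) * b ^+ 2 + b `^ p) by rewrite mulr_ge0 // addr_ge0 //.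
have : 0 <= C2 * b `^ p by rewrite mulr_ge0.
rewrite [(C1 + C2) * _]mulrDl [C2 * (_ + _)]mulrDr; plra.
Qed.

(** The factor 3/2 is the one that closes the induction in [tree_avg_upper]: there the left child
    contributes [3C |y+z|^p] and the right child [C |y-z|^p], and half of [(3 + 1) 3/2] is again
    3. *)
Lemma cabs_powR_perturb : exists2 K : R, 0 <= K & forall x y,
  cabs (x + y) `^ p <= 3 / 2 * cabs x `^ p + K * cabs y `^ p.
Proof.
have p0 : 0 <= p by plra.
have [C C0 hC] := powR_near1 p0.
(* Small enough for [(1 + dl)^p <= 1 + C dl <= 3/2]. *)
pose dl : R := (2 * (C + 1))^-1.
have C1 : 0 < 2 * (C + 1) by plra.
have dl0 : 0 < dl by rewrite invr_gt0.
have dl1 : dl <= 1 by rewrite invf_le1 //; plra.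
have Cdl : C * dl <= 1 / 2.
  by rewrite /dl ler_pdivrMr //; plra.
exists ((dl^-1 + 1) `^ p) => [|x y]; first exact: powR_ge0.
have a0 := cabs_ge0 x; have b0 := cabs_ge0 y.
have cab := cabsD x y.
have i0 : 0 <= dl^-1 by rewrite invr_ge0 ltW.
have [h|h] := leP (cabs y) (dl * cabs x).
  apply: (@le_trans _ _ (3 / 2 * cabs x `^ p)); last first.
    by rewrite lerDl mulr_ge0 ?powR_ge0.
  apply: (@le_trans _ _ (((1 + dl) * cabs x) `^ p)).
    by apply: powR_mono => //; [exact: cabs_ge0|plra].
  rewrite powRM //; last by plra.
  rewrite ler_wpM2r ?powR_ge0 //.
  have hd : 0 <= 1 + dl <= 4 by apply/andP; split; plra.
  have := hC _ hd; rewrite (_ : 1 + dl - 1 = dl); last by ring.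
  rewrite (ger0_norm (ltW dl0)) => h1.
  by have := le_trans (ler_norm _) h1; plra.
apply: (@le_trans _ _ ((dl^-1 + 1) `^ p * cabs y `^ p)); last first.
  by rewrite lerDr mulr_ge0 ?powR_ge0 //; plra.
rewrite -powRM //; last by plra.
apply: powR_mono => //; first exact: cabs_ge0.
apply: (le_trans cab); rewrite mulrDl mul1r lerD2r.
by rewrite mulrC ler_pdivlMr // mulrC ltW.
Qed.

(** The price of opening a chain of variance [V] at a running sum of modulus [a], paid by the
    increments of two potentials as the accumulated variance grows from [A] to [A + V]. If
    [a^2 <= A + V] the second potential pays. Otherwise [V = (u + v)(u - v)] for the two square
    roots, with [u + v <= 2a], and the first one pays. *)
Lemma powR_chain_start a A V : 0 <= a -> 0 <= A -> 0 <= V ->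
  a `^ (p - 2) * V <=
  2 * a `^ (p - 1) * (Num.sqrt (A + V) - Num.sqrt A) + ((A + V) `^ (p / 2) - A `^ (p / 2)).
Proof.
move=> a0 A0 V0.
have AV0 : 0 <= A + V by rewrite addr_ge0.
have q10 : 0 <= p / 2 - 1 by plra.
have p20 : 0 <= p - 2 by plra.
have sA : Num.sqrt A <= Num.sqrt (A + V) by rewrite ler_wsqrtr // lerDl.
have s0 := sqrtr_ge0 A.
have h1 : (A + V) `^ (p / 2 - 1) * V <= (A + V) `^ (p / 2) - A `^ (p / 2).
  have e : p / 2 = (p / 2 - 1) + 1 by ring.
  rewrite {2 3}e !powRS // mulrDr lerBrDr [_ * A + _]addrC lerD2l.
  by rewrite ler_wpM2r //; apply: powR_mono => //; rewrite lerDl.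
have [h|h] := leP (a ^+ 2) (A + V).
  apply: (@le_trans _ _ ((A + V) `^ (p / 2 - 1) * V)).
    rewrite ler_wpM2r //.
    have -> : a `^ (p - 2) = (a ^+ 2) `^ (p / 2 - 1).
      by rewrite powR_sqr //; congr (_ `^ _); field.
    by apply: powR_mono; rewrite ?sqr_ge0.
  apply: (le_trans h1); rewrite lerDr !mulr_ge0 ?powR_ge0 ?subr_ge0 //.
apply: (@le_trans _ _ (2 * a `^ (p - 1) * (Num.sqrt (A + V) - Num.sqrt A))); last first.
  by rewrite lerDl subr_ge0; apply: powR_mono => //; [plra|rewrite lerDl].
have sa : Num.sqrt (A + V) <= a.
  rewrite -(ger0_norm a0) -sqrtr_sqr ler_wsqrtr //; exact: ltW.
have -> : p - 1 = (p - 2) + 1 by ring.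
rewrite powRS // -!mulrA [leRHS]mulrCA ler_wpM2l ?powR_ge0 //.
have := sqr_sqrtr A0; have := sqr_sqrtr AV0; move: s0 sA sa.
set u := Num.sqrt (A + V); set v := Num.sqrt A => s0 sA sa hu hv.
rewrite [leLHS](_ : V = (u + v) * (u - v)); last first.
  have -> : (u + v) * (u - v) = u ^+ 2 - v ^+ 2 by ring.
  by rewrite hu hv addrAC subrr add0r.
by rewrite mulrA ler_wpM2r ?subr_ge0 //; plra.
Qed.

(** Young's inequality by comparing [a] with [2 lam sqrt A]; the coefficient 1/2 allows absorption
    into a full [a^p]. [powR_absorb_bot] is its counterpart, absorbing into [A^(p/2)]. *)
Lemma powR_absorb_top (lam : R) : 0 <= lam -> exists2 K : R, 0 <= K &
  forall a A, 0 <= a -> 0 <= A ->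
  lam * a `^ (p - 1) * Num.sqrt A <= 2^-1 * a `^ p + K * A `^ (p / 2).
Proof.
move=> l0; exists (lam * (2 * lam) `^ (p - 1)) => [|a A a0 A0].
  by rewrite mulr_ge0 ?powR_ge0.
have s0 := sqrtr_ge0 A.
have p1 : 0 <= p - 1 by plra.
have ep : a `^ p = a `^ (p - 1) * a by rewrite -powRS //; congr (_ `^ _); ring.
have eA : A `^ (p / 2) = Num.sqrt A `^ (p - 1) * Num.sqrt A.
  rewrite -powRS // -{1}(sqr_sqrtr A0) powR_sqr //.
  by congr (_ `^ _); field.
have [h|h] := leP (2 * lam * Num.sqrt A) a.
  apply: (@le_trans _ _ (2^-1 * a `^ p)).
    rewrite ep mulrCA [lam * _]mulrC -mulrA ler_wpM2l ?powR_ge0 //.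
    by move: h; plra.
  by rewrite lerDl !mulr_ge0 ?powR_ge0.
apply: (@le_trans _ _ (lam * (2 * lam) `^ (p - 1) * A `^ (p / 2))); last first.
  by rewrite lerDr mulr_ge0 ?powR_ge0.
rewrite eA -!mulrA ler_wpM2l // !mulrA ler_wpM2r //.
rewrite -powRM ?mulr_ge0 //; apply: powR_mono => //; exact: ltW.
Qed.

Lemma powR_absorb_bot : exists2 K : R, 0 <= K &
  forall a A, 0 <= a -> 0 <= A ->
  p / 2 * A `^ (p / 2 - 1) * a ^+ 2 <= 2^-1 * A `^ (p / 2) + K * a `^ p.
Proof.
exists (p / 2 * p `^ (p / 2 - 1)) => [|a A a0 A0].
  by rewrite mulr_ge0 ?powR_ge0 //; plra.
have q10 : 0 <= p / 2 - 1 by plra.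
have p0 : 0 <= p by plra.
have eA : A `^ (p / 2) = A `^ (p / 2 - 1) * A.
  by rewrite -powRS //; congr (_ `^ _); ring.
have [h|h] := leP (p * a ^+ 2) A.
  apply: (@le_trans _ _ (2^-1 * A `^ (p / 2))).
    have -> : p / 2 * A `^ (p / 2 - 1) * a ^+ 2 = A `^ (p / 2 - 1) * (2^-1 * (p * a ^+ 2)) by field.
    by rewrite eA mulrCA ler_wpM2l ?invr_ge0 // ler_wpM2l ?powR_ge0.
  by rewrite lerDl !mulr_ge0 ?powR_ge0 //; plra.
apply: (@le_trans _ _ (p / 2 * p `^ (p / 2 - 1) * a `^ p)); last first.
  by rewrite lerDr mulr_ge0 ?powR_ge0.
rewrite -!(mulrA (p / 2)) ler_wpM2l ?divr_ge0 //.
rewrite -[a `^ p]powR_sub2 // mulrA ler_wpM2r ?sqr_ge0 //.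
have -> : a `^ (p - 2) = (a ^+ 2) `^ (p / 2 - 1).
  by rewrite powR_sqr //; congr (_ `^ _); field.
by rewrite -powRM ?sqr_ge0 //; apply: powR_mono => //; exact: ltW.
Qed.

End PowerInequalities.

(** * Averages over the dyadic tree *)

Section WeightedSums.
Variable R : realType.
Implicit Types (v w : nat -> R[i]).

(* For [s = p], the [p]-th power of the norm in [A_p^+] of the disc of radius
   [2^(-1/p)] of the first [K] coefficients. *)
Definition wsum (s : R) (K : nat) v : R := \sum_(k < K) cabs (v k) `^ s / 2 ^+ k.

Definition chain v (n k : nat) : R[i] := v (n * 2 ^ k)%N.

Lemma wsum_ge0 s K v : 0 <= wsum s K v.
Proof. by apply: sumr_ge0 => k _; rewrite divr_ge0 ?powR_ge0 ?exprn_ge0. Qed.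

Lemma wsumS s K v n : wsum s K.+1 (chain v n) =
  cabs (v n) `^ s + wsum s K (chain v n.*2) / 2.
Proof.
rewrite /wsum big_ord_recl /= /chain expn0 muln1 expr0 divr1; congr (_ + _).
rewrite mulr_suml; apply: eq_bigr => k _ /=.
by rewrite /bump /= add1n expnS mulnA muln2 exprS invfM mulrA mulrAC.
Qed.

End WeightedSums.

Section TreeAverage.
Variables (R : realType) (p : R).
Hypothesis p2 : 2 <= p.
Implicit Types (xi eta : nat -> R[i]) (phi psi : R[i] -> R -> R).

Local Ltac plra := have := p2; lra.
Local Ltac gen_powR :=
  repeat match goal with |- context [powR ?a ?b] =>
    generalize (powR a b); let x := fresh "x" in move=> x end.

(* The node [n] of the dyadic tree has children [n.*2], where the running sum [x]
   increases by [xi n], and [n.*2.+1], where it decreases by [xi n].  The second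
   accumulator [A] is the conditional square function of the filtration that only
   stops at right turns: it is constant along the chains [n * 2 ^ k]. *)
Fixpoint tree_avg phi xi (r n : nat) (x : R[i]) (A : R) : R :=
  if r is r'.+1 then
    (tree_avg phi xi r' n.*2 (x + xi n) A +
     tree_avg phi xi r' n.*2.+1 (x - xi n) (A + wsum 2 r' (chain xi n.*2.+1))) / 2
  else phi x A.

(** The average, over the paths below [n], of the sum of [|xi|^p] along the path: the [l^p] part of
    Rosenthal's expression. *)
Fixpoint tree_sum xi (r n : nat) : R :=
  if r is r'.+1 then
    cabs (xi n) `^ p + (tree_sum xi r' n.*2 + tree_sum xi r' n.*2.+1) / 2
  else 0.

Lemma tree_avg_le phi psi xi r n x A :
  (forall (y : R[i]) (B : R), 0 <= B -> phi y B <= psi y B) -> 0 <= A ->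
  tree_avg phi xi r n x A <= tree_avg psi xi r n x A.
Proof.
move=> h; elim: r n x A => [|r IH] n x A A0 /=; first exact: h.
by rewrite ler_pM2r ?invr_gt0 // lerD ?IH // addr_ge0 // wsum_ge0.
Qed.

Lemma tree_avg_lin (a b : R) phi psi xi r n x A :
  tree_avg (fun y B => a * phi y B + b * psi y B) xi r n x A =
  a * tree_avg phi xi r n x A + b * tree_avg psi xi r n x A.
Proof. by elim: r n x A => [|r IH] n x A //=; rewrite !IH; field. Qed.

Lemma tree_avgA phi xi r n x A B : (forall y C C', phi y C = phi y C') ->
  tree_avg phi xi r n x A = tree_avg phi xi r n x B.
Proof.
move=> h; elim: r n x A B => [|r IH] n x A B /=; first exact: h.
by rewrite (IH _ _ A B) (IH _ _ (A + _) (B + wsum 2 r (chain xi n.*2.+1))).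
Qed.

Let ppow (y : R[i]) (_ : R) := cabs y `^ p.
Let qpow (_ : R[i]) (B : R) := B `^ (p / 2).

Lemma tree_sum_ge0 xi r n : 0 <= tree_sum xi r n.
Proof.
elim: r n => [|r IH] n //=.
by rewrite addr_ge0 ?powR_ge0 // divr_ge0 // addr_ge0.
Qed.

(** The constant 1 in [cabs_powR_parallelogram] is what keeps the bound independent of the depth. *)
Lemma tree_sum_le_avg xi r n x A :
  cabs x `^ p + tree_sum xi r n <= tree_avg ppow xi r n x A.
Proof.
elim: r n x A => [|r IH] n x A /=; first by rewrite addr0.
have := cabs_powR_parallelogram p2 x (xi n).
have := IH n.*2 (x + xi n) A.
have := IH n.*2.+1 (x - xi n) (A + wsum 2 r (chain xi n.*2.+1)).
plra.
Qed.

(* With [q = p / 2], the process [q A^(q-1) |x|^2 - A^q] is a submartingale up to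
   the contribution of the pending chain, by the tangent inequality for [t^q]. *)
Let lower (y : R[i]) (B : R) :=
  1 * (p / 2 * B `^ (p / 2 - 1) * cabs y ^+ 2) + (-1) * B `^ (p / 2).

Lemma tree_avg_lower xi r n x A : 0 <= A ->
  p / 2 * A `^ (p / 2 - 1) * (cabs x ^+ 2 + wsum 2 r (chain xi n)) - A `^ (p / 2)
  <= tree_avg lower xi r n x A.
Proof.
have q10 : 0 <= p / 2 - 1 by plra.
have q1 : 1 <= p / 2 by plra.
elim: r n x A => [|r IH] n x A A0 /=.
  by rewrite /lower mul1r mulN1r /wsum big_ord0 addr0.
set V := wsum 2 r (chain xi n.*2.+1).
have V0 : 0 <= V by exact: wsum_ge0.
have AV0 : 0 <= A + V by rewrite addr_ge0.
have h1 := IH n.*2 (x + xi n) A A0.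
have h2 := IH n.*2.+1 (x - xi n) (A + V) AV0.
have ht := powR_tangent q1 A0 AV0.
have h3 : A `^ (p / 2 - 1) <= (A + V) `^ (p / 2 - 1).
  by apply: powR_mono => //; rewrite lerDl.
rewrite -/V in h2.
rewrite wsumS powR_mulrn ?cabs_ge0 //.
have h4 : p / 2 * A `^ (p / 2 - 1) * cabs (x - xi n) ^+ 2 <=
   p / 2 * (A + V) `^ (p / 2 - 1) * cabs (x - xi n) ^+ 2.
  by rewrite ler_wpM2r ?sqr_ge0 // ler_wpM2l //; plra.
move: h1 h2 h4; rewrite sqr_cabsD sqr_cabsB.
set T1 := tree_avg _ _ _ _ _ _; set T2 := tree_avg _ _ _ _ _ _.
move: ht; rewrite (_ : A + V - A = V); last by ring.
set X := (A + V) `^ (p / 2 - 1); set Y := A `^ (p / 2 - 1); set Z := (A + V) `^ _.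
set Q := A `^ (p / 2); set c2 := cabs x ^+ 2; set d2 := cabs (xi n) ^+ 2; set e := cip _ _ *+ 2.
set Rn := wsum _ _ _.
plra.
Qed.

(** With the accumulator started at the variance [A] of the first chain, the lower bound of
    [tree_avg_lower] is [(p/2 - 1) A^(p/2) >= 0]. Then [powR_absorb_bot] moves half of the average
    of [B^(p/2)] to the other side. *)
Lemma tree_avg_square_le : exists2 K : R, 0 <= K & forall xi N,
  let A := wsum 2 N (chain xi 1) in
  tree_avg qpow xi N 1 0 A <= K * tree_avg ppow xi N 1 0 A.
Proof.
have [K K0 hK] := powR_absorb_bot p2.
have q10 : 0 <= p / 2 - 1 by plra.
have q1 : 1 <= p / 2 by plra.
exists (2 * K) => [|xi N]; first by rewrite mulr_ge0.
set A := wsum _ _ _ => /=.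
have A0 : 0 <= A by exact: wsum_ge0.
have h1 := tree_avg_lower xi N 1 0 A0.
have h2 : 0 <= p / 2 * A `^ (p / 2 - 1) * (cabs (0 : R[i]) ^+ 2 + A) - A `^ (p / 2).
  have e : A `^ (p / 2) = A `^ (p / 2 - 1) * A.
    by rewrite -powRS //; congr (_ `^ _); ring.
  rewrite cabs0 expr0n /= add0r e -mulrA -[X in _ - X]mul1r -mulrBl.
  by apply: mulr_ge0 => //; apply: mulr_ge0 => //; exact: powR_ge0.
have h3 : tree_avg lower xi N 1 0 A <=
    tree_avg (fun y B => K * ppow y B + - 2^-1 * qpow y B) xi N 1 0 A.
  apply: tree_avg_le => // y B B0; rewrite /lower /ppow /qpow.
  move: (hK _ _ (cabs_ge0 y) B0) => /=; gen_powR; lra.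
rewrite (tree_avg_lin K (- 2^-1) ppow qpow) in h3.
have := le_trans (le_trans h2 h1) h3; lra.
Qed.

(** The function [up] subtracts from [|y|^p] the potentials of [powR_chain_start]. In [key], [x] is
    the running sum at the last right turn and [y] is what the current chain has added since;
    expanding around [x] treats the whole chain as one martingale step. The left child replaces [y]
    by [y + xi n]; the right child restarts from [x + y - xi n] and 0. *)
Lemma tree_avg_upper : exists2 K : R, 0 <= K & forall xi N,
  let A := wsum 2 N (chain xi 1) in
  tree_avg ppow xi N 1 0 A <= K * (tree_avg qpow xi N 1 0 A + tree_sum xi N 1).
Proof.
have [C C0 hC] := cabs_powR_taylor p2.
have [K1 K10 hK1] := cabs_powR_perturb p2.
pose up (y : R[i]) (B : R) :=
  cabs y `^ p - (2 * C) * cabs y `^ (p - 1) * Num.sqrt B - C * B `^ (p / 2).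
pose K2 := 2 * C * (1 + K1).
have p1 : 1 <= p - 1 by plra.
have l0 : 0 <= 2 * C by rewrite mulr_ge0.
have K20 : 0 <= K2 by rewrite /K2 !mulr_ge0 // addr_ge0.
have key xi r n (x y : R[i]) (A : R) : 0 <= A -> tree_avg up xi r n (x + y) A <=
    cabs x `^ p + p * cabs x `^ (p - 2) * cip x y
    + C * cabs x `^ (p - 2) * (cabs y ^+ 2 + wsum 2 r (chain xi n))
    + 3 * C * cabs y `^ p + K2 * tree_sum xi r n
    - 2 * C * cabs (x + y) `^ (p - 1) * Num.sqrt A - C * A `^ (p / 2).
  elim: r n x y A => [|r IH] n x y A A0.
    rewrite /= /up /wsum big_ord0.
    have := hC x y; have : 0 <= C * cabs y `^ p by rewrite mulr_ge0 ?powR_ge0.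
    gen_powR; lra.
  rewrite wsumS powR_mulrn ?cabs_ge0 // [tree_avg _ _ _ _ _ _]/= [tree_sum _ _ _]/=.
  set V := wsum 2 r (chain xi n.*2.+1); set z := xi n.
  have V0 : 0 <= V by exact: wsum_ge0.
  have AV0 : 0 <= A + V by rewrite addr_ge0.
  have h1 := IH n.*2 x (y + z) A A0.
  have h2 := IH n.*2.+1 (x + y - z) 0 (A + V) AV0.
  (* The right turn opens a new chain, of variance [V]. *)
  have h3 := powR_chain_start p2 (cabs_ge0 (x + y - z)) A0 V0.
  have h4 := hC x (y - z).
  (* The modulus to the power [p - 1] does not decrease on average, so the subtracted term with
     [sqrt A] is carried through the step. *)
  have h5 := cabs_powR_mid (x + y) z p1.
  have h6 := hK1 y z.
  have h7 := hK1 y (- z).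
  move: h1 h2; rewrite -/V !addr0 cabs0 powR0 ?expr0n /=; last first.
    by rewrite gt_eqF //; plra.
  rewrite !mulr0 add0r !addr0 (_ : cip (x + y - z) 0 = 0); last first.
    by rewrite /cip /= !mulr0 addr0.
  rewrite mulr0 addr0 !addrA.
  set T1 := tree_avg _ _ _ _ _ _; set T2 := tree_avg _ _ _ _ _ _.
  move: h3 h4 h5 h6 h7; rewrite !addrA !cipD cipN cabsN.
  have e1 : cabs (y + z) ^+ 2 = cabs y ^+ 2 + cip y z *+ 2 + cabs z ^+ 2 by exact: sqr_cabsD.
  have e2 : cabs (y - z) ^+ 2 = cabs y ^+ 2 - cip y z *+ 2 + cabs z ^+ 2 by exact: sqr_cabsB.
  rewrite e1 e2.
  set P0 := cabs x `^ p; set P2 := cabs x `^ (p - 2).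
  set u := cabs (x + y - z); set w := cabs (x + y + z).
  set b1 := cabs (y + z) `^ p; set b2 := cabs (y - z) `^ p.
  set By := cabs y `^ p; set Bz := cabs z `^ p.
  set Up := u `^ p; set Um := u `^ (p - 1); set Um2 := u `^ (p - 2).
  set Wm := w `^ (p - 1); set X := cabs (x + y) `^ (p - 1).
  set sA := Num.sqrt A; set sAV := Num.sqrt (A + V).
  set Q := A `^ (p / 2); set QV := (A + V) `^ (p / 2).
  set R1 := wsum _ _ _.
  set t1 := tree_sum _ _ _; set t2 := tree_sum _ _ _.
  set c1 := cip x y; set c2 := cip x z; set c3 := cip y z *+ 2.
  set yy := cabs y ^+ 2; set zz := cabs z ^+ 2.
  move=> h3 h4 h5 h6 h7 h1 h2.
  have h3' : C * (Um2 * V) <= C * (2 * Um * (sAV - sA) + (QV - Q)).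
    by apply: ler_wpM2l => //; rewrite addrA.
  have h5' : 2 * C * sA * X <= 2 * C * sA * ((Wm + Um) / 2).
    by apply: ler_wpM2l => //; apply: mulr_ge0; rewrite ?sqrtr_ge0.
  have h6' : 3 * C * b1 <= 3 * C * (3 / 2 * By + K1 * Bz).
    by apply: ler_wpM2l => //; apply: mulr_ge0.
  have h7' : C * b2 <= C * (3 / 2 * By + K1 * Bz) by exact: ler_wpM2l.
  have C0' : 0 <= C * Bz by apply: mulr_ge0; rewrite ?powR_ge0.
  rewrite /K2 in h1 h2 *.
  clear - h1 h2 h3' h4 h5' h6' h7' C0'.
  lra.
have [K3 K30 hK3] := powR_absorb_top p2 l0.
exists (2 * (K2 + K3 + C)) => [|xi N]; first by rewrite mulr_ge0 // !addr_ge0.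
set A := wsum _ _ _ => /=.
have A0 : 0 <= A by exact: wsum_ge0.
have h1 := key xi N 1%N 0 0 A A0.
have h2 : tree_avg (fun y B => 2^-1 * ppow y B + (- (K3 + C)) * qpow y B) xi N 1 0 A <=
     tree_avg up xi N 1 0 A.
  apply: tree_avg_le => // y B B0; rewrite /up /ppow /qpow.
  by have := hK3 _ _ (cabs_ge0 y) B0; gen_powR; lra.
rewrite (tree_avg_lin 2^-1 (- (K3 + C)) ppow qpow) in h2; move: h2.
(* For [p = 2] the factor [0^(p-2)] equals 1, so the first chain has to be charged to [A^(p/2)] like
   any other. *)
have h3 := powR_chain_start p2 (lexx 0) (lexx 0) A0.
have e0 : (0 : R) `^ p = 0 by rewrite powR0 // gt_eqF //; plra.
have e1 : (0 : R) `^ (p - 1) = 0 by rewrite powR0 // gt_eqF //; plra.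
have e2 : (0 : R) `^ (p / 2) = 0 by rewrite powR0 // gt_eqF //; plra.
move: h1 h3; rewrite -/A addr0 add0r cabs0 e0 e1 e2 (expr0n _ 2) /=.
rewrite /cip /= !mul0r !mulr0 !(addr0, add0r, subr0, mul0r, mulr0).
have s0 := tree_sum_ge0 xi N 1.
have q0 : 0 <= tree_avg qpow xi N 1 0 A.
  have -> : 0 = tree_avg (fun _ _ => 0) xi N 1 0 A.
    by elim: N (1%N) (0 : R[i]) A {A0 s0} => //= N IH n x A; rewrite -!IH addr0 mul0r.
  by apply: tree_avg_le => // y B _; exact: powR_ge0.
set T0 := tree_avg up _ _ _ _ _; set T1 := tree_avg ppow _ _ _ _ _.
set T2 := tree_avg qpow _ _ _ _ _ in q0 *; set S := tree_sum _ _ _ in s0 *.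
move=> h1 h3 h4.
have h3' : C * (0 `^ (p - 2) * A) <= C * A `^ (p / 2) by rewrite ler_wpM2l.
have c1 : 0 <= K2 * T2 by rewrite mulr_ge0.
have c2 : 0 <= K3 * S by rewrite mulr_ge0.
have c3 : 0 <= C * S by rewrite mulr_ge0.
move: h1; rewrite -mulrA => h1; clear -h1 h3' h4 c1 c2 c3; lra.
Qed.

End TreeAverage.

(** * Monotonicity of the norm in the chain sums *)

Section Comparison.
Variables (R : realType) (p : R).
Hypothesis p2 : 2 <= p.
Implicit Types (xi eta : nat -> R[i]).

Local Ltac plra := have := p2; lra.

Let ppow (y : R[i]) (_ : R) := cabs y `^ p.
Let qpow (_ : R[i]) (B : R) := B `^ (p / 2).

Definition tree_norm (N : nat) xi : R :=
  tree_avg (fun y _ => cabs y `^ p) xi N 1 0 0.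

Lemma tree_normE N xi A : tree_avg ppow xi N 1 0 A = tree_norm N xi.
Proof. exact: tree_avgA. Qed.

(** The single parameter [d] scales like a squared norm, hence [d^(p/2)] for the sums of [p]-th
    powers. Odd [m] are the starting points of the chains. *)
Definition chain_dominated (d : R) eta xi := forall m r, odd m ->
  wsum 2 r (chain eta m) <= d * wsum 2 r (chain xi m) /\
  wsum p r (chain eta m) <= d `^ (p / 2) * wsum p r (chain xi m).

Lemma tree_avg_square_dominated d eta xi r n x y A B : 0 <= d ->
  chain_dominated d eta xi -> 0 <= A -> 0 <= B -> A <= d * B ->
  tree_avg qpow eta r n x A <= d `^ (p / 2) * tree_avg qpow xi r n y B.
Proof.
move=> d0 hd; elim: r n x y A B => [|r IH] n x y A B A0 B0 AB /=.
  by rewrite /qpow -powRM //; apply: powR_mono => //; plra.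
rewrite mulrA ler_pM2r ?invr_gt0 // mulrDr lerD //; first exact: IH.
apply: IH; rewrite ?addr_ge0 ?wsum_ge0 // mulrDr lerD //.
by case: (hd n.*2.+1 r) => //=; rewrite odd_double.
Qed.

(** The part of [tree_sum] outside the chain of [n]: at each possible right turn the subtree of an
    odd index takes over. *)
Fixpoint tree_off xi (r n : nat) : R :=
  if r is r'.+1 then (tree_off xi r' n.*2 + tree_sum p xi r' n.*2.+1) / 2 else 0.

Lemma tree_sum_off xi r n : tree_sum p xi r n = wsum p r (chain xi n) + tree_off xi r n.
Proof.
elim: r n => [|r IH] n /=; first by rewrite /wsum big_ord0 addr0.
by rewrite wsumS (IH n.*2); field.
Qed.

Lemma tree_sum_dominated d eta xi r n : odd n -> chain_dominated d eta xi ->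
  tree_sum p eta r n <= d `^ (p / 2) * tree_sum p xi r n.
Proof.
move=> on hd.
have off : forall m, tree_off eta r m <= d `^ (p / 2) * tree_off xi r m.
  elim: r => [|r IH] m /=; first by rewrite mulr0.
  rewrite mulrA ler_pM2r ?invr_gt0 // mulrDr lerD // !tree_sum_off mulrDr lerD //.
  by case: (hd m.*2.+1 r) => //=; rewrite odd_double.
by rewrite !tree_sum_off mulrDr lerD //; case: (hd n r on).
Qed.

(** The two tree norms are never compared directly. [tree_avg_upper] passes from [eta] to its
    accumulator and [tree_sum], both are monotone in the chain sums, and the reverse bounds hold for
    [xi]. *)
Lemma tree_norm_dominated : exists2 C : R, 0 <= C & forall d eta xi N, 0 <= d ->
  chain_dominated d eta xi -> tree_norm N eta <= C * d `^ (p / 2) * tree_norm N xi.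
Proof.
have [K1 K10 h1] := tree_avg_square_le p2.
have [K2 K20 h2] := tree_avg_upper p2.
exists (K2 * (K1 + 1)) => [|d eta xi N d0 hd]; first by rewrite mulr_ge0 // addr_ge0.
have := h2 eta N; rewrite /= tree_normE => /le_trans; apply.
rewrite -!mulrA ler_wpM2l //.
have hA := wsum_ge0 2 N (chain eta 1); have hB := wsum_ge0 2 N (chain xi 1).
have e1 := tree_avg_square_dominated N 1 0 0 d0 hd hA hB (proj1 (hd 1%N N isT)).
have e2 := tree_sum_dominated N (isT : odd 1) hd.
have e3 := h1 xi N; rewrite /= tree_normE in e3.
have e4 := tree_sum_le_avg p2 xi N 1 0 (wsum 2 N (chain xi 1)).
rewrite -/ppow tree_normE cabs0 powR0 ?add0r in e4; last by rewrite gt_eqF //; plra.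
apply: (le_trans (lerD e1 e2)); rewrite -mulrDr mulrCA ler_wpM2l ?powR_ge0 //.
rewrite mulrDl mul1r lerD //.
Qed.

Lemma tree_sum_le_norm N xi : tree_sum p xi N 1 <= tree_norm N xi.
Proof.
have := tree_sum_le_avg p2 xi N 1 0 0.
by rewrite -/ppow tree_normE cabs0 powR0 ?add0r // gt_eqF //; plra.
Qed.

Lemma wsum_le_tree_sum N xi n : wsum p N (chain xi n) <= tree_sum p xi N n.
Proof.
rewrite tree_sum_off lerDl; elim: N n => [|N IH] n //=.
apply: divr_ge0 => //; apply: addr_ge0; [exact: IH|exact: tree_sum_ge0].
Qed.

Lemma wsum_chain1_le_norm N xi : wsum p N (chain xi 1) <= tree_norm N xi.
Proof. exact: le_trans (wsum_le_tree_sum _ _ _) (tree_sum_le_norm _ _). Qed.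

(** Jensen's inequality for the weights [2^(-k)], of total mass below 2. Peeling off the first term
    leaves a tail of weight 1/2; doubling the head makes the sum a midpoint. *)
Lemma wsum_square_le K v : wsum 2 K v `^ (p / 2) <= 2 `^ (p / 2) * wsum p K v.
Proof.
have p0 : p / 2 != 0 by rewrite gt_eqF //; plra.
have q1 : 1 <= p / 2 by plra.
elim: K v => [|K IH] v.
  by rewrite /wsum !big_ord0 powR0 // mulr0.
have shift s : wsum s K.+1 v = cabs (v 0%N) `^ s + wsum s K (fun k => v k.+1) / 2.
  rewrite /wsum big_ord_recl /= expr0 divr1; congr (_ + _).
  rewrite mulr_suml; apply: eq_bigr => k _.
  by rewrite /bump /= add1n exprS invfM mulrA mulrAC.
rewrite !shift powR_mulrn ?cabs_ge0 //.
set S2 := wsum 2 K _; set Sp := wsum p K _.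
have S20 : 0 <= S2 by exact: wsum_ge0.
have -> : cabs (v 0%N) ^+ 2 + S2 / 2 = (2 * cabs (v 0%N) ^+ 2 + S2) / 2 by field.
apply: (le_trans (powR_convex q1 _ S20)); first by rewrite mulr_ge0 // sqr_ge0.
rewrite powRM ?sqr_ge0 // powR_half_sqr ?cabs_ge0 //.
have h := IH (fun k => v k.+1); rewrite -/S2 -/Sp in h.
have a0 : 0 <= 2 `^ (p / 2) * cabs (v 0%N) `^ p by rewrite mulr_ge0 ?powR_ge0.
rewrite mulrDr; lra.
Qed.

End Comparison.

(** * Multipliers of power series *)

Section CauchyProduct.
Variable R : realType.
Implicit Types (a b c u v w : nat -> R[i]) (n k m N K M : nat).

Definition delta0 : nat -> R[i] := fun k => (k == 0%N)%:R.

(** A coefficient of a product sees only finite sections, so the ring laws of polynomials transfer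
    to formal power series. *)
Lemma cprod_polyE a b n N : (n < N)%N ->
  cprod a b n = ((\poly_(i < N) a i) * (\poly_(i < N) b i))`_n.
Proof.
move=> nN; rewrite coefM /cprod; apply: eq_bigr => i _.
have iN : (i < N)%N by rewrite (leq_trans _ nN) // ltn_ord.
by rewrite !coef_poly iN (leq_ltn_trans (leq_subr _ _) nN).
Qed.

Lemma cprodC a b : cprod a b = cprod b a.
Proof. by apply/funext => n; rewrite !(cprod_polyE _ _ (ltnSn n)) mulrC. Qed.

Lemma cprodA a b c : cprod a (cprod b c) = cprod (cprod a b) c.
Proof.
apply/funext => n.
have h (x y z : nat -> R[i]) : cprod x (cprod y z) n =
    ((\poly_(i < n.+1) x i) * ((\poly_(i < n.+1) y i) * (\poly_(i < n.+1) z i)))`_n.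
  rewrite [RHS]coefM {1}/cprod; apply: eq_bigr => i _.
  have hi : (n - i < n.+1)%N by rewrite ltnS leq_subr.
  by rewrite coef_poly ltn_ord (cprod_polyE y z hi).
by rewrite h (cprodC (cprod a b)) h mulrA [in RHS]mulrC.
Qed.

Lemma cprod_delta0 a : cprod delta0 a = a.
Proof.
apply/funext => n; rewrite /cprod big_ord_recl /= subn0 /delta0 /= mul1r big1 ?addr0 //.
by move=> i _; rewrite mul0r.
Qed.

Lemma cprodDr a b c : cprod a (fun k => b k + c k) = fun k => cprod a b k + cprod a c k.
Proof.
by apply/funext => n; rewrite /cprod -big_split; apply: eq_bigr => i _; rewrite mulrDr.
Qed.

Lemma cprodDl a b c : cprod (fun k => b k + c k) a = fun k => cprod b a k + cprod c a k.
Proof. by rewrite cprodC cprodDr !(cprodC a). Qed.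

Lemma cprodZr (l : R[i]) a b : cprod a (fun k => l * b k) = fun k => l * cprod a b k.
Proof.
by apply/funext => n; rewrite /cprod mulr_sumr; apply: eq_bigr => i _; rewrite mulrCA.
Qed.

Lemma eq_cprod a b b' n : (forall k, (k <= n)%N -> b k = b' k) -> cprod a b n = cprod a b' n.
Proof. by move=> h; apply: eq_bigr => i _; rewrite h // leq_subr. Qed.

Definition shiftn n v k : R[i] := if (n <= k)%N then v (k - n)%N else 0.

Lemma cprod_shiftn n a v : cprod a (shiftn n v) = shiftn n (cprod a v).
Proof.
apply/funext => k; rewrite /shiftn /cprod; case: leqP => nk; last first.
  by rewrite big1 // => i _; rewrite leqNgt (leq_ltn_trans (leq_subr _ _) nk) mulr0.
have e : k.+1 = ((k - n).+1 + n)%N by rewrite addSn subnK.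
rewrite -(big_mkord xpredT (fun i => a i * (if (n <= k - i)%N then v (k - i - n)%N else 0))).
rewrite (big_cat_nat (n := (k - n).+1)) //=; last by rewrite ltnS leq_subr.
rewrite [X in _ + X]big_nat_cond [X in _ + X]big1 ?addr0; last first.
  move=> i /andP[/andP[h1 h2] _]; rewrite leqNgt (_ : (k - i < n)%N = true) /= ?mulr0 //.
  by lia.
rewrite big_mkord; apply: eq_bigr => i _.
have hi := ltn_ord i; rewrite (_ : (n <= k - i)%N = true); last by lia.
by congr (_ * v _); lia.
Qed.

Definition cutk K v k : R[i] := if (K <= k)%N then v k else 0.
Definition trunc K v k : R[i] := if (k < K)%N then v k else 0.

Lemma trunc_supp K v k : (K <= k)%N -> trunc K v k = 0.
Proof. by rewrite /trunc ltnNge => ->. Qed.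

Lemma cprod_trunc K a v k : (k < K)%N -> cprod a (trunc K v) k = cprod a v k.
Proof.
move=> kK; apply: eq_cprod => i ik; rewrite /trunc (_ : (i < K)%N) //.
exact: leq_ltn_trans kK.
Qed.

End CauchyProduct.

Section WeightedSumsTheory.
Variable R : realType.
Implicit Types (a b c u v w : nat -> R[i]) (s t : R) (n k m N K M : nat).

Lemma eq_wsum s K v w : (forall k, (k < K)%N -> v k = w k) -> wsum s K v = wsum s K w.
Proof. by move=> h; apply: eq_bigr => i _; rewrite h. Qed.

Lemma wsum_trunc s K v : wsum s K (trunc K v) = wsum s K v.
Proof. by apply: eq_wsum => k; rewrite /trunc => ->. Qed.

Lemma wsum_recr s K v : wsum s K.+1 v = wsum s K v + cabs (v K) `^ s / 2 ^+ K.
Proof. by rewrite /wsum big_ord_recr. Qed.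

Lemma wsum_term_ge0 s v k : 0 <= cabs (v k) `^ s / 2 ^+ k.
Proof. by rewrite divr_ge0 ?powR_ge0 ?exprn_ge0. Qed.

Lemma wsum_mono s K M v : (K <= M)%N -> wsum s K v <= wsum s M v.
Proof.
move=> /subnKC <-; elim: (M - K)%N => [|d IH]; first by rewrite addn0.
by rewrite addnS wsum_recr (le_trans IH) // lerDl wsum_term_ge0.
Qed.

Lemma wsum_supp s K M v : s != 0 -> (forall k, (M <= k)%N -> v k = 0) -> wsum s K v <= wsum s M v.
Proof.
move=> s0 h; have [KM|MK] := leqP K M; first exact: wsum_mono.
rewrite -(subnKC (ltnW MK)); elim: (K - M)%N => [|d IH]; first by rewrite addn0.
by rewrite addnS wsum_recr h ?leq_addr // cabs0 powR0 // mul0r addr0.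
Qed.

Lemma wsum_le s K v w : 0 <= s -> (forall k, (k < K)%N -> cabs (v k) <= cabs (w k)) ->
  wsum s K v <= wsum s K w.
Proof.
move=> s0 h; apply: ler_sum => k _; rewrite ler_pM2r ?invr_gt0 ?exprn_gt0 //.
by apply: powR_mono => //; [exact: cabs_ge0 | exact: h].
Qed.

Lemma wsumD s K v w : 1 <= s ->
  wsum s K (fun k => v k + w k) <= 2 `^ s * (wsum s K v + wsum s K w).
Proof.
move=> s1; rewrite /wsum -big_split mulr_sumr; apply: ler_sum => k _ /=.
rewrite -mulrDl mulrA ler_pM2r ?invr_gt0 ?exprn_gt0 //.
apply: le_trans (powR_exch s1 (cabs_ge0 _) (cabs_ge0 _)).
by apply: powR_mono; [lra | exact: cabs_ge0 | exact: cabsD].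
Qed.

Lemma wsumZ s K (l : R) v : 0 <= l -> wsum s K (fun k => l%:C%C * v k) = l `^ s * wsum s K v.
Proof.
move=> l0; rewrite /wsum mulr_sumr; apply: eq_bigr => k _.
rewrite cabsM powRM ?cabs_ge0 // mulrA; congr (_ `^ _ * _ * _).
by rewrite /cabs /= expr0n addr0 sqrtr_sqr ger0_norm.
Qed.

Lemma wsum_shiftn s K n v : s != 0 -> wsum s (n + K) (shiftn n v) = wsum s K v / 2 ^+ n.
Proof.
move=> s0; rewrite /wsum big_split_ord /= big1 ?add0r; last first.
  move=> i _; rewrite /shiftn /=.
  by have -> : (n <= i)%N = false; rewrite ?cabs0 ?powR0 ?mul0r // leqNgt ltn_ord.
rewrite mulr_suml; apply: eq_bigr => i _.
by rewrite /shiftn leq_addr addKn exprD invfM mulrA mulrAC.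
Qed.

Lemma wsum_eq0 s K v k : wsum s K v <= 0 -> (k < K)%N -> v k = 0.
Proof.
move=> h kK.
have e : wsum s K v = 0 by apply/eqP; rewrite eq_le h wsum_ge0.
have := psumr_eq0P (fun (i : 'I_K) _ => wsum_term_ge0 s v i) e => /(_ (Ordinal kK) isT) /=.
move/eqP; rewrite mulf_eq0 invr_eq0 expf_eq0 pnatr_eq0 andbF orbF => /eqP.
by move/powR_eq0_eq0/cabs_eq0.
Qed.

Lemma sum_conv_le K (x y : nat -> R) : (forall i, 0 <= x i) -> (forall i, 0 <= y i) ->
  \sum_(k < K) \sum_(i < k.+1) x i * y (k - i)%N <= (\sum_(i < K) x i) * (\sum_(j < K) y j).
Proof.
move=> x0 y0.
have e k : (k < K)%N -> \sum_(i < k.+1) x i * y (k - i)%N =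
    \sum_(i < K) (if (i <= k)%N then x i * y (k - i)%N else 0).
  move=> kK; rewrite -big_mkcond /=.
  by rewrite (big_ord_widen_cond K xpredT (fun i => x i * y (k - i)%N)).
rewrite (eq_bigr (fun k : 'I_K => \sum_(i < K) (if (i <= k)%N then x i * y (k - i)%N else 0))); last first.
  by move=> k _; rewrite e.
rewrite exchange_big /= mulr_suml; apply: ler_sum => i _.
rewrite -big_mkcond /= -mulr_sumr ler_wpM2l //.
rewrite -(big_mkord (fun k => i <= k)%N (fun k => y (k - i)%N)) /=.
rewrite -(big_mkord xpredT y) /=.
have hi := ltnW (ltn_ord i).
rewrite (big_cat_nat (n := i)) //= big_nat_cond big1 ?add0r; last first.
  by move=> k /andP[/andP[_ h1] h2]; move: h2; rewrite leqNgt h1.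
rewrite -[X in \sum_(X <= _ < _ | _) _]add0n big_addn.
have -> : \sum_(0 <= k < K - i | (i <= k + i)%N) y (k + i - i)%N = \sum_(0 <= k < K - i) y k.
  by apply: eq_big => k; [rewrite leq_addl | rewrite addnK].
rewrite [leRHS](big_cat_nat (n := K - i)) ?leq_subr //= lerDl.
by apply: sumr_ge0.
Qed.

(** Only terms of index below [M] cost a factor [2^s], which makes the bound uniform in [n]; the
    exponent [minn n M] counts them during the induction. *)
Lemma cabs_sum_powR s M n (y : nat -> R[i]) : 1 <= s -> (forall i, (M <= i)%N -> y i = 0) ->
  cabs (\sum_(i < n) y i) `^ s <= (2 `^ s) ^+ M * \sum_(i < n) cabs (y i) `^ s.
Proof.
move=> s1 hy; have s0 : s != 0 by rewrite gt_eqF //; lra.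
have c1 : 1 <= 2 `^ s by rewrite -[leLHS](powRr0 (2 : R)) ler_powR //; lra.
have c0 : 0 <= 2 `^ s := powR_ge0 _ _.
have S0 k : 0 <= \sum_(i < k) cabs (y i) `^ s by apply: sumr_ge0 => i _; exact: powR_ge0.
suff h : cabs (\sum_(i < n) y i) `^ s <= (2 `^ s) ^+ (minn n M) * \sum_(i < n) cabs (y i) `^ s.
  by apply: (le_trans h); rewrite ler_wpM2r // ler_weXn2l // geq_minr.
elim: n => [|n IH]; first by rewrite !big_ord0 cabs0 powR0 // mulr0.
rewrite !big_ord_recr /=; have [nM|Mn] := ltnP n M; last first.
  rewrite (minn_idPr _) ?(leq_trans Mn) // hy // cabs0 powR0 // !addr0.
  by rewrite (minn_idPr Mn) in IH.
rewrite (minn_idPl nM); rewrite (minn_idPl (ltnW nM)) in IH.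
apply: (@le_trans _ _ ((cabs (\sum_(i < n) y i) + cabs (y n)) `^ s)).
  by apply: powR_mono; [lra | exact: cabs_ge0 | exact: cabsD].
apply: (le_trans (powR_exch s1 (cabs_ge0 _) (cabs_ge0 _))).
rewrite exprS -mulrA ler_wpM2l // mulrDr lerD //.
by rewrite ler_peMl ?powR_ge0 // exprn_ege1.
Qed.

(* Each coefficient of [cprod v u] has at most [M] nonzero terms. *)
Lemma wsum_cprod_supp s M K L v u : 1 <= s -> (forall k, (M <= k)%N -> v k = 0) ->
  wsum s K (cutk L (cprod v u)) <= (2 `^ s) ^+ M * wsum s K v * wsum s K (cutk (L - M) u).
Proof.
move=> s1 hv; have s0 : s != 0 by rewrite gt_eqF //; lra.
rewrite -mulrA.
apply: le_trans; last first.
  apply: ler_wpM2l; first by rewrite exprn_ge0 // powR_ge0.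
  apply: (sum_conv_le _ (wsum_term_ge0 s v) (wsum_term_ge0 s (cutk (L - M) u))).
rewrite mulr_sumr; apply: ler_sum => k _.
rewrite /cutk; case: leqP => Lk; last first.
  rewrite cabs0 powR0 // mul0r mulr_ge0 ?exprn_ge0 ?powR_ge0 //.
  by apply: sumr_ge0 => i _; rewrite mulr_ge0 ?divr_ge0 ?powR_ge0 ?exprn_ge0.
rewrite ler_pdivrMr ?exprn_gt0 //.
have h := @cabs_sum_powR s M k.+1 (fun i => v i * u (k - i)%N) s1.
apply: (le_trans (h _)); first by move=> i /hv ->; rewrite mul0r.
rewrite -mulrA ler_wpM2l ?exprn_ge0 ?powR_ge0 // mulr_suml; apply: ler_sum => i _.
have [iM|/hv ->] := ltnP i M; last by rewrite mul0r cabs0 powR0 // !mul0r.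
have ik : (i <= k)%N by rewrite -ltnS ltn_ord.
have -> : (L - M <= k - i)%N by lia.
have -> : 2 ^+ k = 2 ^+ i * 2 ^+ (k - i) :> R by rewrite -exprD subnKC.
rewrite cabsM powRM ?cabs_ge0 //.
set x := cabs _ `^ s; set y := cabs _ `^ s.
rewrite le_eqVlt; apply/orP; left; apply/eqP; field.
by rewrite !expf_neq0.
Qed.

Lemma sum_sqr_weighted K (x y : nat -> R) : (forall i, 0 <= x i) ->
  (\sum_(i < K) x i * y i) ^+ 2 <= (\sum_(i < K) x i) * (\sum_(i < K) x i * y i ^+ 2).
Proof.
move=> x0; elim: K => [|K IH]; first by rewrite !big_ord0 expr0n mul0r.
rewrite !big_ord_recr /=.
have A0 : 0 <= \sum_(i < K) x i by apply: sumr_ge0.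
have C0 : 0 <= \sum_(i < K) x i * y i ^+ 2.
  by apply: sumr_ge0 => i _; rewrite mulr_ge0 // sqr_ge0.
move: IH A0 C0; set A := \sum_(i < K) x i; set B := \sum_(i < K) _; set C := \sum_(i < K) _.
move=> IH A0 C0; have := x0 K; set a := x K; set b := y K => a0.
have h : 2 * B * b <= A * b ^+ 2 + C.
  have [A00|An0] := eqVneq A 0.
    have B0 : B = 0 by apply/eqP; rewrite -sqrf_eq0 eq_le sqr_ge0 andbT (le_trans IH) // A00 mul0r.
    by rewrite A00 B0 mulr0 !mul0r add0r.
  have Ap : 0 < A by rewrite lt_neqAle eq_sym An0.
  rewrite -(ler_pM2l Ap) mulrDr.
  have : 0 <= (A * b - B) ^+ 2 by exact: sqr_ge0.
  have -> : (A * b - B) ^+ 2 = A * (A * b ^+ 2) - A * (2 * B * b) + B ^+ 2 by ring.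
  by lra.
have h' : a * (2 * B * b) <= a * (A * b ^+ 2 + C) by rewrite ler_wpM2l.
have -> : (B + a * b) ^+ 2 = B ^+ 2 + a * (2 * B * b) + a ^+ 2 * b ^+ 2 by ring.
have -> : (A + a) * (C + a * b ^+ 2) = A * C + a * (A * b ^+ 2 + C) + a ^+ 2 * b ^+ 2 by ring.
by rewrite lerD2r lerD.
Qed.

(** Young's convolution inequality from [l^1] and [l^2] to [l^2] for sequences scaled by [2^(-k/2)],
    by Cauchy-Schwarz with the [l^1] factor as weight. *)
Lemma wsum2_cprod_le K u v :
  wsum 2 K (cprod u v) <=
  (\sum_(k < K) cabs (u k) * (Num.sqrt 2^-1) ^+ k) ^+ 2 * wsum 2 K v.
Proof.
set r := Num.sqrt 2^-1.
have r0 : 0 <= r by exact: sqrtr_ge0.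
have r2 k : (r ^+ k) ^+ 2 = (2 ^+ k)^-1.
  by rewrite -exprM mulnC exprM sqr_sqrtr ?invr_ge0 // exprVn.
pose a k := cabs (u k) * r ^+ k; pose b k := cabs (v k) * r ^+ k.
have a0 k : 0 <= a k by rewrite mulr_ge0 ?cabs_ge0 ?exprn_ge0.
have eb w k : cabs (w k) `^ 2 / 2 ^+ k = (cabs (w k) * r ^+ k) ^+ 2.
  by rewrite powR_mulrn ?cabs_ge0 // exprMn r2.
rewrite /wsum (eq_bigr _ (fun (k : 'I_K) _ => eb v k)).
have hk (k : 'I_K) : cabs (cprod u v k) `^ 2 / 2 ^+ k <=
    (\sum_(i < K) a i) * \sum_(i < k.+1) a i * b (k - i)%N ^+ 2.
  rewrite eb.
  apply: (@le_trans _ _ ((\sum_(i < k.+1) a i * b (k - i)%N) ^+ 2)).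
    rewrite ler_pXn2r ?nnegrE ?mulr_ge0 ?cabs_ge0 ?exprn_ge0 //; last first.
      by apply: sumr_ge0 => i _; rewrite mulr_ge0 // mulr_ge0 ?cabs_ge0 ?exprn_ge0.
    rewrite -ler_pdivlMr; last first.
      by rewrite exprn_gt0 // sqrtr_gt0 invr_gt0.
    apply: (le_trans (cabs_sum _ _ _)); rewrite mulr_suml; apply: ler_sum => i _.
    have -> : r ^+ k = r ^+ i * r ^+ (k - i) by rewrite -exprD subnKC // -ltnS.
    rewrite cabsM /a /b.
    have rn : r != 0 by rewrite gt_eqF // sqrtr_gt0 invr_gt0.
    rewrite le_eqVlt; apply/orP; left; apply/eqP; field.
    by rewrite !expf_neq0.
  apply: (le_trans (sum_sqr_weighted _ (fun i => b (k - i)%N) a0)).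
  rewrite ler_wpM2r //.
    by apply: sumr_ge0 => i _; rewrite mulr_ge0 // sqr_ge0.
  rewrite (big_ord_widen K a (ltn_ord k)).
  by rewrite [leRHS](bigID (fun i : 'I_K => (i < k.+1)%N)) /= lerDl sumr_ge0.
apply: le_trans; first by apply: ler_sum => k _; exact: hk.
rewrite -mulr_sumr expr2 -mulrA ler_wpM2l ?sumr_ge0 //.
exact: (sum_conv_le K a0 (fun i => sqr_ge0 (b i))).
Qed.

End WeightedSumsTheory.

(** * Multipliers seen on finite sections *)

Section Multipliers.
Variables (R : realType) (p : R).
Hypothesis p2 : 2 <= p.
Implicit Types (a b c u v w xi eta : nat -> R[i]) (n k m N K M : nat).

Local Ltac plra := have := p2; lra.

Let p1 : 1 <= p. Proof. plra. Qed.
Let p0 : 0 <= p. Proof. plra. Qed.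
Let pn0 : p != 0. Proof. by rewrite gt_eqF //; plra. Qed.

Definition bounded_wsum u := exists B : R, forall K, wsum p K u <= B.

(** The first [K] coefficients of a product depend on the first [K] of [v] alone, so the multiplier
    bound can be stated on partial sums of arbitrary sequences, with no convergence involved. *)
Definition section_mult u := exists2 C : R, 0 <= C &
  forall v K, wsum p K (cprod u v) <= C * wsum p K v.

Lemma bounded_wsum_supp M v : (forall k, (M <= k)%N -> v k = 0) -> bounded_wsum v.
Proof. by move=> h; exists (wsum p M v) => K; exact: wsum_supp. Qed.

Lemma bounded_wsum_tail u (e : R) : bounded_wsum u -> 0 < e ->
  exists L, forall K, wsum p K (cutk L u) <= e.
Proof.
move=> [B hB] e0.
pose E := range (fun K => wsum p K u).
have hs : has_sup E.
  by split; [exists (wsum p 0 u), 0%N | exists B => _ [K _ <-]].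
have [_ [L _ <-] hL] := sup_adherent e0 hs.
exists L => K.
have hK : wsum p (maxn K L) u <= sup E.
  by apply: sup_upper_bound => //; exists (maxn K L).
have h M : (L <= M)%N -> wsum p M (cutk L u) + wsum p L u = wsum p M u.
  move=> /subnKC <-; elim: (M - L)%N => [|d IH].
    rewrite addn0 /wsum big1 ?add0r // => i _.
    have -> : cutk L u i = 0 by rewrite /cutk (leqNgt L) ltn_ord.
    by rewrite cabs0 powR0 // mul0r.
  by rewrite addnS !wsum_recr -IH /cutk leq_addr addrAC.
apply: (le_trans (wsum_mono _ _ (leq_maxl K L))).
have := h _ (leq_maxr K L); lra.
Qed.

Lemma section_mult_bounded u : section_mult u -> bounded_wsum u.
Proof.
move=> [C C0 h]; exists C => K.
have := h (@delta0 R) K; rewrite cprodC cprod_delta0 => /le_trans; apply.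
rewrite ler_piMr //; case: K => [|K]; first by rewrite /wsum big_ord0.
rewrite /wsum big_ord_recl big1 ?addr0 => [|i _]; last first.
  by rewrite [delta0 _ _](_ : _ = 0) // cabs0 powR0 // mul0r.
by rewrite [delta0 _ _](_ : _ = 1) // cabs1 powR1 expr0 divr1.
Qed.

Lemma wsum2_le_wsum K v : wsum 2 K v <= 2 * wsum p K v `^ (p / 2)^-1.
Proof.
have q0 : 0 < p / 2 by plra.
have h := wsum_square_le p2 K v.
have w0 := wsum_ge0 2 K v; have wp0 := wsum_ge0 p K v.
have := powR_mono (ltW (_ : 0 < (p / 2)^-1)) (powR_ge0 _ _) h.
rewrite invr_gt0 => /(_ q0).
rewrite -powRrM mulfV ?gt_eqF // powRr1 //.
by rewrite powRM ?powR_ge0 // -powRrM mulfV ?gt_eqF // powRr1.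
Qed.

Lemma section_mult2 u : section_mult u -> exists2 C : R, 0 <= C &
  forall v K, wsum 2 K (cprod u v) <= C * wsum 2 K v.
Proof.
(* For [p = 2] the claim is the hypothesis; the geometric ratio [t] below is less than 1 only when
   [p > 2]. *)
move=> hu; have [ep|np] := eqVneq p 2; first by rewrite -ep.
have pgt2 : 2 < p by rewrite lt_neqAle eq_sym np p2.
have [B hB] := section_mult_bounded hu.
pose r := Num.sqrt (2^-1 : R); pose D := Num.max 1 B.
have r0 : 0 < r by rewrite sqrtr_gt0 invr_gt0.
have rE : r = 2 `^ (- 2^-1).
  by rewrite /r -powR12_sqrt ?invr_ge0 // -powR_inv1 // -powRrM mulN1r.
(* |u_k| <= D 2^(k/p), so |u_k| 2^(-k/2) decays geometrically. *)
pose t := 2 `^ (p^-1 - 2^-1) : R.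
have t0 : 0 <= t by exact: powR_ge0.
have t1 : t < 1.
  rewrite /t -[ltRHS](powRr0 (2 : R)) /powR pnatr_eq0 /= ltr_expR ltr_pM2r ?ln_gt0 ?ltr1n //.
  by rewrite subr_lt0 ltf_pV2 ?posrE //; plra.
have D1 : 1 <= D by rewrite /D le_max lexx.
have hk k : cabs (u k) * r ^+ k <= D * t ^+ k.
  have h1 : cabs (u k) `^ p <= D * 2 ^+ k.
    rewrite -ler_pdivrMr ?exprn_gt0 //.
    have := hB k.+1; rewrite wsum_recr => h.
    have := wsum_ge0 p k u; have : B <= D by rewrite /D le_max lexx orbT.
    lra.
  have h2 : cabs (u k) <= D * (2 ^+ k) `^ p^-1.
    have ip : 0 <= p^-1 by rewrite invr_ge0.
    have := powR_mono ip (powR_ge0 _ _) h1.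
    rewrite -powRrM mulfV // powRr1 ?cabs_ge0 // powRM ?exprn_ge0 //; last by lra.
    move=> /le_trans; apply; rewrite ler_wpM2r ?powR_ge0 //.
    rewrite ler1_powR // invf_le1 //; plra.
  apply: (le_trans (ler_wpM2r (exprn_ge0 k (ltW r0)) h2)).
  rewrite -mulrA ler_wpM2l //; first by lra.
  rewrite -!powR_mulrn ?powR_ge0 ?(ltW r0) //.
  rewrite rE /t -!powRrM -powRD ?pnatr_eq0 ?implybT //.
  by rewrite le_eqVlt; apply/orP; left; apply/eqP; congr (_ `^ _); ring.
have hsum K : \sum_(k < K) cabs (u k) * r ^+ k <= D / (1 - t).
  apply: (@le_trans _ _ (\sum_(k < K) D * t ^+ k)); first by apply: ler_sum.
  rewrite -mulr_sumr ler_wpM2l //; first by lra.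
  rewrite -[leRHS]mul1r ler_pdivlMr ?subr_gt0 //.
  have -> : (\sum_(k < K) t ^+ k) * (1 - t) = 1 - t ^+ K.
    by rewrite -[RHS]opprB subrX1 -mulNr opprB mulrC.
  by rewrite lerBlDr lerDl exprn_ge0.
exists ((D / (1 - t)) ^+ 2) => [|v K]; first exact: sqr_ge0.
apply: (le_trans (wsum2_cprod_le _ _ _)); rewrite ler_wpM2r ?wsum_ge0 //.
rewrite ler_pXn2r ?nnegrE ?sumr_ge0 //.
  by move=> k _; rewrite mulr_ge0 ?cabs_ge0 ?exprn_ge0 // ltW.
by rewrite divr_ge0 ?subr_ge0 ?ltW // ; lra.
Qed.

(* If [f = \sum_k c_k h_(2^k)] then [\sum_n xi_n f_n = \sum_n (tmul c xi)_n h_n]. *)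
Definition tmul u xi n : R[i] :=
  \sum_(k < (logn 2 n).+1) u k * xi (n %/ 2 ^ k)%N.

Lemma logn2_odd m k : odd m -> logn 2 (m * 2 ^ k) = k.
Proof.
move=> om; have m0 : (0 < m)%N by case: m om.
rewrite lognM ?expn_gt0 // pfactorK // logn_coprime ?add0n //.
by rewrite coprime2n.
Qed.

Lemma chain_tmul u xi m : odd m -> chain (tmul u xi) m = cprod u (chain xi m).
Proof.
move=> om; apply/funext => k; rewrite /chain /tmul logn2_odd //.
apply: eq_bigr => i _; congr (_ * xi _).
have ik : (i <= k)%N by rewrite -ltnS ltn_ord.
by rewrite -{1}(subnK ik) expnD mulnA mulnK ?expn_gt0.
Qed.

Lemma section_mult_dominated u : section_mult u ->
  exists2 d : R, 0 <= d & forall xi, chain_dominated p d (tmul u xi) xi.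
Proof.
move=> hu; have [C2 C20 h2] := section_mult2 hu; have [C C0 hC] := hu.
have q0 : 0 < p / 2 by plra.
exists (C2 + C `^ (p / 2)^-1) => [|xi m r om]; first by rewrite addr_ge0 ?powR_ge0.
rewrite chain_tmul //; split.
  apply: (le_trans (h2 _ _)); rewrite ler_wpM2r ?wsum_ge0 // lerDl powR_ge0 //.
apply: (le_trans (hC _ _)); rewrite ler_wpM2r ?wsum_ge0 //.
rewrite -[leLHS](_ : (C `^ (p / 2)^-1) `^ (p / 2) = C); last first.
  by rewrite -powRrM mulVf ?gt_eqF // powRr1.
by apply: powR_mono; [exact: ltW | exact: powR_ge0 | rewrite lerDr].
Qed.

(** Smallness of remainders when [u] is merely in [A_p^+], the only information on [c] before it is
    known to be a multiplier. An index [m 2^k >= 2^N] with [m < M] has [k >= N - M]; as the chain of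
    [xi] ends before [M], only coefficients of [u] from [N - 2M] on enter. *)
Lemma cut_tmul_dominated u xi M (e : R) : bounded_wsum u ->
  (forall n, (M <= n)%N -> xi n = 0) -> 0 < e ->
  exists N0, forall N, (N0 <= N)%N -> chain_dominated p e (cutk (2 ^ N) (tmul u xi)) xi.
Proof.
move=> hu hxi e0.
have q0 : 0 < p / 2 by plra.
(* The tail of [u] must beat the factor [(2^s)^M] of [wsum_cprod_supp] for [s = p] and, after the
   passage from [p] to 2 in [wsum2_le_wsum], for [s = 2]. *)
pose w := Num.min (e `^ (p / 2) / (2 `^ p) ^+ M) ((e / (2 * (2 `^ 2) ^+ M)) `^ (p / 2)).
have cM s : 0 < (2 `^ s) ^+ M :> R by rewrite exprn_gt0 // powR_gt0.
have w0 : 0 < w.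
  rewrite /w lt_min; apply/andP; split; first by rewrite divr_gt0 ?powR_gt0.
  by rewrite powR_gt0 // divr_gt0 // mulr_gt0.
have [L hL] := bounded_wsum_tail hu w0.
exists (L + M + M)%N => N hN m r om.
have [mM|Mm] := leqP M m.
  have z k : chain (cutk (2 ^ N) (tmul u xi)) m k = 0.
    rewrite {1}/chain /cutk; case: ifP => // _.
    rewrite -[LHS]/(chain (tmul u xi) m k) chain_tmul // /cprod big1 // => i _.
    by rewrite /chain hxi ?mulr0 // (leq_trans mM) // leq_pmulr // expn_gt0.
  have zs s : s != 0 -> wsum s r (chain (cutk (2 ^ N) (tmul u xi)) m) = 0.
    by move=> s0; apply: big1 => j _; rewrite z cabs0 powR0 // mul0r.
  by rewrite !zs ?pnatr_eq0 // !mulr_ge0 ?wsum_ge0 ?powR_ge0 // ltW.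
have supp k : (M <= k)%N -> chain xi m k = 0.
  move=> Mk; rewrite /chain hxi // (leq_trans Mk) // (leq_trans (ltnW (ltn_expl k (ltnSn 1)))) //.
  by rewrite leq_pmull //; case: m om {Mm}.
have le1 s : 1 <= s -> wsum s r (chain (cutk (2 ^ N) (tmul u xi)) m) <=
    (2 `^ s) ^+ M * wsum s r (chain xi m) * wsum s r (cutk L u).
  move=> s1.
  apply: (@le_trans _ _ (wsum s r (cutk (N - M) (cprod (chain xi m) u)))).
    apply: wsum_le => [|k _]; first by lra.
    rewrite {1}/chain /cutk.
    case: ifP => h; last by rewrite cabs0 cabs_ge0.
    rewrite (_ : (N - M <= k)%N = true); last first.
      rewrite leq_subLR -(@leq_exp2l 2) // expnD (leq_trans h) // leq_mul2r.
      by rewrite (leq_trans (ltnW Mm)) ?orbT // ltnW // ltn_expl.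
    by rewrite -[X in cabs X <= _]/(chain (tmul u xi) m k) chain_tmul // cprodC.
  apply: (le_trans (wsum_cprod_supp _ _ _ s1 supp)).
  rewrite ler_wpM2l ?mulr_ge0 ?wsum_ge0 ?(ltW (cM _)) //.
  apply: wsum_le => [|k _]; first by lra.
  rewrite /cutk; case: ifP => h; last by rewrite cabs0 cabs_ge0.
  by rewrite (_ : (L <= k)%N = true) //; lia.
have hw := hL r.
split.
  have e2 : wsum 2 r (cutk L u) <= e / (2 `^ 2) ^+ M.
    apply: (le_trans (wsum2_le_wsum _ _)).
    have hw2 : wsum p r (cutk L u) <= (e / (2 * (2 `^ 2) ^+ M)) `^ (p / 2).
      by apply: (le_trans hw); rewrite /w ge_min lexx orbT.
    have iq : 0 <= (p / 2)^-1 by rewrite invr_ge0 ltW.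
    have := powR_mono iq (wsum_ge0 _ _ _) hw2.
    rewrite -powRrM mulfV ?gt_eqF // powRr1; last by rewrite divr_ge0 ?mulr_ge0 ?ltW.
    rewrite -(ler_pM2l (ltr0Sn R 1)) => /le_trans; apply.
    rewrite le_eqVlt; apply/orP; left; apply/eqP; field.
    by rewrite expf_neq0 // gt_eqF ?powR_gt0.
  apply: (le_trans (le1 2 _)); first by lra.
  rewrite mulrAC ler_wpM2r ?wsum_ge0 //.
  by rewrite mulrC -ler_pdivlMr.
apply: (le_trans (le1 p p1)).
rewrite mulrAC ler_wpM2r ?wsum_ge0 // mulrC -ler_pdivlMr //.
by apply: (le_trans hw); rewrite /w ge_min lexx.
Qed.

End Multipliers.

(** * Boundedness and inversion of multipliers *)

Section MultiplierAlgebra.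
Variables (R : realType) (p : R).
Hypothesis p2 : 2 <= p.
Implicit Types (a b c u v w : nat -> R[i]) (n k m N K M : nat).

Local Ltac plra := have := p2; lra.

Let p1 : 1 <= p. Proof. plra. Qed.
Let p0 : 0 <= p. Proof. plra. Qed.
Let pn0 : p != 0. Proof. by rewrite gt_eqF //; plra. Qed.

Lemma wsum_ereal u K : (\sum_(0 <= k < K) ((cabs (u k) * (2 `^ (- p^-1)) ^+ k) `^ p)%:E)%E
  = (wsum p K u)%:E.
Proof.
rewrite sumEFin big_mkord; congr (_%:E); apply: eq_bigr => k _.
rewrite powRM ?cabs_ge0 ?exprn_ge0 ?powR_ge0 //; congr (_ * _).
rewrite -powR_mulrn ?powR_ge0 // -!powRrM -powR_invn //.
congr (_ `^ _); field; exact: pn0.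
Qed.

Lemma ApP u : Ap p (2 `^ (- p^-1)) u <-> bounded_wsum p u.
Proof.
pose F k := ((cabs (u k) * (2 `^ (- p^-1)) ^+ k) `^ p)%:E.
rewrite /Ap.
rewrite -[X in (X < _)%E]/(\sum_(0 <= k <oo) F k)%E.
have F0 k : (0 <= F k)%E by rewrite lee_fin powR_ge0.
split=> [h|[B hB]].
  have hf : (\sum_(0 <= k <oo) F k)%E \is a fin_num.
    by rewrite ge0_fin_numE // nneseries_ge0.
  exists (fine (\sum_(0 <= k <oo) F k)%E) => K.
  by rewrite -lee_fin fineK // -wsum_ereal; exact: (nneseries_lim_ge _ (fun n _ _ => F0 n)).
apply: (@le_lt_trans _ _ B%:E); last exact: ltry.
apply: lime_le; first exact: is_cvg_nneseries.
by apply: nearW => K; rewrite wsum_ereal lee_fin.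
Qed.

(* Gliding hump: finite blocks violating larger and larger bounds are glued into
   one bounded sequence whose product with [c] is unbounded. *)
Lemma section_mult_of_stable c :
  (forall v, bounded_wsum p v -> bounded_wsum p (cprod c v)) -> section_mult p c.
Proof.
move=> hc; apply: contrapT => hn.
have fails (C : R) : 0 <= C -> exists w K, C * wsum p K w < wsum p K (cprod c w).
  move=> C0; apply: contrapT => h; apply: hn; exists C => // v K.
  by rewrite leNgt; apply/negP => hlt; apply: h; exists v, K.
have step (j : nat) (u : nat -> R[i]) n : (forall k, (n <= k)%N -> u k = 0) ->
    exists u' n', [/\ (n < n')%N, (forall k, (k < n)%N -> u' k = u k),
      (forall k, (n' <= k)%N -> u' k = 0),
      wsum p n' u' <= wsum p n u + 2^-1 ^+ j & j%:R <= wsum p n' (cprod c u')].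
  move=> hu.
  have [B hB] := hc u (bounded_wsum_supp p2 hu).
  have B0 : 0 <= B by apply: le_trans (hB 0%N); exact: wsum_ge0.
  (* Once the new block is rescaled to mass [2^(-j)], its image has mass at least [2^p (B + j)]; the
     factor [2^p] and the summand [B] pay for separating off the image of the old part [u]. *)
  pose C := 2 `^ p * 2 ^+ j * (B + j%:R).
  have C0 : 0 <= C by rewrite !mulr_ge0 ?powR_ge0 ?exprn_ge0 ?addr_ge0.
  have [w [K hw]] := fails C C0.
  have Wc0 : 0 < wsum p K (cprod c w).
    by apply: le_lt_trans hw; rewrite mulr_ge0 ?wsum_ge0.
  have Kpos : (0 < K)%N.
    by rewrite lt0n; apply/eqP => K0; move: Wc0; rewrite K0 /wsum big_ord0 ltxx.
  have W0 : 0 < wsum p K w.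
    rewrite lt_neqAle wsum_ge0 andbT eq_sym; apply/eqP => h0.
    have hz : forall k, (k < K)%N -> w k = 0.
      by move=> k; apply: (@wsum_eq0 _ p); rewrite h0.
    move: Wc0; rewrite (_ : wsum p K _ = 0) ?ltxx //.
    rewrite /wsum big1 // => k _; rewrite /cprod big1 ?cabs0 ?powR0 ?mul0r // => i _.
    by rewrite hz ?mulr0 // (leq_ltn_trans (leq_subr _ _)) ?ltn_ord.
  (* Shifting by [n] divides masses by [2^n]; this scaling gives the shifted block mass [2^(-j)]. *)
  pose q := 2 ^+ n / 2 ^+ j / wsum p K w : R.
  have q0 : 0 < q by rewrite !divr_gt0 ?exprn_gt0.
  pose l := q `^ p^-1.
  have l0 : 0 <= l by exact: powR_ge0.
  have lp : l `^ p = q by rewrite /l -powRrM mulVf // powRr1 // ltW.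
  pose w' k := l%:C%C * w k.
  pose s := shiftn n (trunc K w').
  exists (fun k => u k + s k), (n + K)%N.
  have s_lt k : (k < n)%N -> s k = 0 by move=> kn; rewrite /s /shiftn leqNgt kn.
  have Ws : wsum p (n + K) s = 2^-1 ^+ j.
    rewrite wsum_shiftn // wsum_trunc wsumZ // lp /q exprVn; field.
    by rewrite !expf_neq0 // gt_eqF.
  have split_wsum (v v' : nat -> R[i]) : (forall k, (k < n)%N -> v k = v' k) ->
      wsum p (n + K) v = wsum p n v' + \sum_(k < K) cabs (v (n + k)%N) `^ p / 2 ^+ (n + k).
    move=> hv; rewrite /wsum big_split_ord /=; congr (_ + _).
    by apply: eq_bigr => i _; rewrite hv.
  split.
  - by rewrite -[X in (X < _)%N]addn0 ltn_add2l.
  - by move=> k kn; rewrite s_lt ?addr0.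
  - move=> k nk; rewrite hu ?add0r; last by rewrite (leq_trans _ nk) // leq_addr.
    by rewrite /s /shiftn; case: ifP => // h; rewrite trunc_supp //; lia.
  - rewrite (split_wsum _ u) => [|k kn]; last by rewrite s_lt ?addr0.
    rewrite lerD2l -Ws (split_wsum s (fun _ => 0)) //.
    rewrite (_ : wsum p n _ = 0) ?add0r; last first.
      by rewrite /wsum big1 // => i _; rewrite cabs0 powR0 // mul0r.
    by apply: ler_sum => k _; rewrite hu ?leq_addr // add0r.
  - have e1 : wsum p (n + K) (cprod c s) = wsum p K (cprod c w') / 2 ^+ n.
      rewrite /s cprod_shiftn wsum_shiftn //; congr (_ / _).
      by apply: eq_wsum => k kK; rewrite cprod_trunc.
    have e2 : wsum p K (cprod c w') = q * wsum p K (cprod c w).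
      by rewrite cprodZr wsumZ // lp.
    have e3 : 2 `^ p * (B + j%:R) <= wsum p (n + K) (cprod c s).
      rewrite e1 e2 /q -(ler_pM2r W0).
      have -> : 2 ^+ n / 2 ^+ j / wsum p K w * wsum p K (cprod c w) / 2 ^+ n * wsum p K w =
        wsum p K (cprod c w) / 2 ^+ j.
        by field; rewrite !expf_neq0 //= gt_eqF.
      rewrite ler_pdivlMr ?exprn_gt0 //.
      by apply/ltW; apply: le_lt_trans hw; rewrite /C le_eqVlt; apply/orP; left; apply/eqP; ring.
    have e4 := wsumD (n + K) (cprod c (fun k => u k + s k)) (cprod c (fun k => - u k)) p1.
    have e5 : wsum p (n + K) (fun k => cprod c (fun k => u k + s k) k + cprod c (fun k => - u k) k)
        = wsum p (n + K) (cprod c s).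
      by apply: eq_wsum => k _; rewrite -[LHS]/((fun i => _) k) -cprodDr; apply: eq_cprod => i _; ring.
    have e6 : wsum p (n + K) (cprod c (fun k => - u k)) = wsum p (n + K) (cprod c u).
      have -> : (fun k => - u k) = (fun k => (-1) * u k) by apply/funext => k; rewrite mulN1r.
      by rewrite cprodZr; apply: eq_bigr => k _; rewrite mulN1r cabsN.
    rewrite e5 e6 in e4.
    have := le_trans e3 e4; rewrite ler_pM2l ?powR_gt0 //.
    have := hB (n + K)%N; lra.
pose T := ((nat -> R[i]) * nat)%type.
pose ok (x : T) := forall k, (x.2 <= k)%N -> x.1 k = 0.
pose nxt (j : nat) (x y : T) := ok x -> [/\ ok y, (x.2 < y.2)%N, (forall k, (k < x.2)%N -> y.1 k = x.1 k),
      wsum p y.2 y.1 <= wsum p x.2 x.1 + 2^-1 ^+ j & j%:R <= wsum p y.2 (cprod c y.1)].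
have nxtP (jx : nat * T) : exists y, nxt jx.1 jx.2 y.
  case: jx => j [u n]; have [hok|hok] := pselect (ok (u, n)); last by exists (u, n).
  by have [u' [n' [h1 h2 h3 h4 h5]]] := step j u n hok; exists (u', n').
have [g hg] := choice nxtP.
pose fix st j : T := if j is j'.+1 then g (j', st j') else ((fun _ => 0), 0%N).
have hst j : ok (st j) by elim: j => [|j IH] //=; case: (hg (j, st j) IH).
have st_next j := hg (j, st j) (hst j).
have n_ge j : (j <= (st j).2)%N.
  by elim: j => [|j IH] //; case: (st_next j) => _ /(leq_ltn_trans IH).
have n_mono i j : (i <= j)%N -> ((st i).2 <= (st j).2)%N.
  move=> /subnKC <-; elim: (j - i)%N => [|d IH]; first by rewrite addn0.
  by rewrite addnS (leq_trans IH) //; case: (st_next (i + d)%N) => _ /ltnW.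
have st_stable i j k : (i <= j)%N -> (k < (st i).2)%N -> (st j).1 k = (st i).1 k.
  move=> /subnKC <- kn; elim: (j - i)%N => [|d IH]; first by rewrite addn0.
  rewrite addnS -IH; case: (st_next (i + d)%N) => _ _ h _ _; apply: h.
  by rewrite (leq_trans kn) // n_mono // leq_addr.
have Wst j : wsum p (st j).2 (st j).1 <= 2 - 2 * 2^-1 ^+ j.
  elim: j => [|j IH]; first by rewrite /wsum /= big_ord0 expr0; lra.
  case: (st_next j) => _ _ _ h _; apply: (le_trans h); rewrite exprS; lra.
(* Stage [k.+1] has length above [k], so its coefficient [k] is final. *)
pose v k := (st k.+1).1 k.
have v_st j k : (k < (st j).2)%N -> v k = (st j).1 k.
  move=> kn; rewrite /v.
  have [h|h] := leqP j k.+1; first by rewrite -(st_stable j k.+1).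
  by rewrite -(st_stable k.+1 j k) // ltnW.
have bv : bounded_wsum p v.
  exists 2 => K.
  apply: (le_trans (wsum_mono _ _ (n_ge K))).
  rewrite (eq_wsum _ (v_st K)); apply: (le_trans (Wst K)).
  by rewrite lerBlDr lerDl mulr_ge0 // exprn_ge0 // invr_ge0.
have [B hB] := hc v bv.
have B0 : 0 <= B by apply: le_trans (hB 0%N); exact: wsum_ge0.
pose j := (Num.truncn B).+1.
case: (st_next j) => _ _ _ _ /=; rewrite -/(st j.+1).
have -> : wsum p (st j.+1).2 (cprod c (st j.+1).1) = wsum p (st j.+1).2 (cprod c v).
  apply: eq_wsum => k kn; apply: eq_cprod => i ik; rewrite (v_st j.+1) //.
  exact: leq_ltn_trans kn.
move=> /le_trans /(_ (hB _)); rewrite leNgt => /negP; apply.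
by rewrite truncnS_gt.
Qed.

(** [Mp] asks only that multiplication preserve [A_p^+]; the uniform bound is a closed-graph
    statement, supplied by [section_mult_of_stable]. *)
Lemma MpP c : Mp p (2 `^ (- p^-1)) c <-> section_mult p c.
Proof.
split=> [[_ h]|h].
  by apply: section_mult_of_stable => v /ApP hv; apply/ApP; exact: h.
split; first by apply/ApP; exact: section_mult_bounded h.
move=> v /ApP [B hB]; apply/ApP; have [C C0 hC] := h; exists (C * B) => K.
by apply: (le_trans (hC _ _)); rewrite ler_wpM2l.
Qed.

Lemma cprod_inverse c : c 0%N != 0 -> exists b, cprod c b = @delta0 R.
Proof.
move=> c0.
(* Each coefficient of the inverse needs all earlier ones, so the recursion produces the list of the
   first [n]. *)
pose fix bl n : seq R[i] := if n is n'.+1 then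
  rcons (bl n') ((delta0 R n' - \sum_(i < n') c (n' - i)%N * (bl n')`_i) / c 0%N) else [::].
have sz n : size (bl n) = n by elim: n => [|n IH] //=; rewrite size_rcons IH.
pose b n := (bl n.+1)`_n.
have hb n i : (i < n)%N -> (bl n)`_i = b i.
  elim: n => // n IH; rewrite ltnS leq_eqVlt => /orP[/eqP -> //|h].
  by rewrite [bl _]/= nth_rcons sz h IH.
exists b; apply/funext => n; rewrite cprodC /cprod big_ord_recr /= subnn.
rewrite {2}/b /= nth_rcons sz ltnn eqxx mulfVK //.
rewrite addrC -addrA -[RHS]addr0; congr (_ + _).
rewrite addrC; apply/eqP; rewrite subr_eq0; apply/eqP.
by apply: eq_bigr => i _; rewrite hb // mulrC.
Qed.

(** The product [b v] has infinite support, so the lower estimate does not apply to it. It is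
    applied to [a v] instead, where [c a = delta0 + rho] with [rho] tiny: this bounds [a v], and
    since [a v] is [b v] plus the product of [b v] and [rho], the last term can be absorbed. *)
Lemma section_mult_inverse c :
  (forall e : R, 0 < e -> exists a M, (forall k, (M <= k)%N -> a k = 0) /\
     forall K, wsum p K (fun k => cprod c a k - delta0 R k) <= e) ->
  (exists2 C : R, 0 <= C & forall v M (B : R), (forall k, (M <= k)%N -> v k = 0) ->
     (forall K, wsum p K (cprod c v) <= B) -> forall K, wsum p K v <= C * B) ->
  exists2 b, cprod c b = @delta0 R & section_mult p b.
Proof.
move=> S1 [C C0 S2].
have c0 : c 0%N != 0.
  (* With [c 0 = 0] the constant term of [c a - delta0] would be -1, which no error bound 1/2
     permits. *)
  apply/eqP => c0; have [a [M [_ h]]] := S1 2^-1 ltac:(by rewrite invr_gt0).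
  have := h 1%N; rewrite /wsum big_ord1 /cprod big_ord1 /= c0 mul0r sub0r cabsN.
  rewrite [delta0 _ _](_ : _ = 1) // cabs1 powR1 expr0 divr1.
  by rewrite leNgt invf_lt1 ?ltr1n.
have [b hb] := cprod_inverse c0.
exists b => //.
pose q := 2 `^ p : R; have q0 : 0 < q by exact: powR_gt0.
exists (2 * q * C * (2 * q)) => [|v0 K]; first by rewrite !mulr_ge0 // ltW.
pose v := trunc K v0.
have -> : wsum p K (cprod b v0) = wsum p K (cprod b v).
  by apply: eq_wsum => k kK; rewrite cprod_trunc.
rewrite -(wsum_trunc p K v0) -/v.
have vs : forall k, (K <= k)%N -> v k = 0 by exact: trunc_supp.
(* The approximant is chosen after [K]: multiplying by a sequence of length [K] costs [q^K] and the
   quasi-triangle inequality costs [q], and [e] reduces the total to 1/2. *)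
pose e := (2 * q * q ^+ K)^-1.
have e0 : 0 < e by rewrite invr_gt0 !mulr_gt0 ?exprn_gt0.
have q1 : 1 <= q by rewrite -[leLHS](powRr0 (2 : R)) /q ler_powR //; plra.
have he : q * q ^+ K * e = 1 / 2.
  by rewrite /e; field; rewrite expf_neq0 // gt_eqF.
have he1 : q ^+ K * e <= 1.
  have : q ^+ K * e <= q * (q ^+ K * e) by rewrite ler_peMl // mulr_ge0 ?exprn_ge0 ?ltW.
  rewrite mulrA he; lra.
have [a [M [ha hrho]]] := S1 e e0.
pose rho k := cprod c a k - delta0 R k.
have ca : cprod c a = fun k => delta0 R k + rho k.
  by apply/funext => k; rewrite /rho addrC subrK.
have conv_rho w L : (forall k, (K <= k)%N -> w k = 0) ->
    wsum p L (cprod w rho) <= q ^+ K * wsum p K w * e.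
  move=> hw; have := wsum_cprod_supp L 0 rho p1 hw.
  have e00 x : cutk 0 x = x :> (nat -> R[i]) by [].
  rewrite !e00 => h; apply: (le_trans h).
  apply: ler_pM; rewrite ?mulr_ge0 ?exprn_ge0 ?wsum_ge0 ?(ltW q0) //.
  by rewrite ler_wpM2l ?exprn_ge0 ?(ltW q0) // wsum_supp.
have av_supp k : (M + K <= k)%N -> cprod a v k = 0.
  move=> hk; rewrite /cprod big1 // => i _.
  have [h|h] := leqP M i; first by rewrite ha ?mul0r.
  by rewrite vs ?mulr0 //; lia.
have cav : cprod c (cprod a v) = fun k => v k + cprod rho v k.
  by rewrite cprodA ca cprodDl cprod_delta0.
have b1 L : wsum p L (cprod c (cprod a v)) <= 2 * q * wsum p K v.
  rewrite cav; apply: (le_trans (wsumD _ _ _ p1)); rewrite -/q.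
  have h1 : wsum p L v <= wsum p K v by exact: wsum_supp.
  have h2 := conv_rho v L vs; rewrite cprodC in h2.
  have h3 : q ^+ K * wsum p K v * e <= wsum p K v.
    by rewrite mulrAC ler_piMl ?wsum_ge0.
  rewrite [2 * q]mulrC -mulrA ler_pM2l // mulr2n mulrDl mul1r lerD //.
  exact: le_trans h2 h3.
have b2 := S2 _ _ _ av_supp b1 K.
have bav : cprod a v = fun k => cprod b v k + cprod (cprod b v) rho k.
  have e1 : cprod b (cprod c (cprod a v)) = cprod a v.
    by rewrite cprodA (cprodC b) hb cprod_delta0.
  by rewrite -[LHS]e1 cav cprodDr (cprodC rho) cprodA.
(* Truncating [b v] inside the product leaves the first [K] coefficients unchanged and makes the
   finite-support bound applicable. *)
have e2 : wsum p K (cprod b v) = wsum p K (fun k => cprod a v k + cprod (fun k => - trunc K (cprod b v) k) rho k).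
  apply: eq_wsum => k kK; rewrite bav.
  rewrite (cprodC _ rho) (cprodC _ rho).
  rewrite (_ : (fun k => - trunc K (cprod b v) k) = (fun k => -1 * trunc K (cprod b v) k)); last first.
    by apply/funext => i; rewrite mulN1r.
  by rewrite cprodZr mulN1r cprod_trunc // addrK.
have b3 : wsum p K (cprod b v) <= q * (C * (2 * q * wsum p K v) + q ^+ K * wsum p K (cprod b v) * e).
  rewrite {1}e2; apply: (le_trans (wsumD _ _ _ p1)); rewrite -/q ler_pM2l // lerD //.
  apply: (le_trans (conv_rho _ K _)) => [k hk|].
    by rewrite trunc_supp // oppr0.
  rewrite (_ : wsum p K _ = wsum p K (cprod b v)) //.
  rewrite -(wsum_trunc p K (cprod b v)); apply: eq_bigr => k _.
  by rewrite cabsN.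
move: b3; rewrite mulrDr.
have -> : q * (q ^+ K * wsum p K (cprod b v) * e) = wsum p K (cprod b v) / 2.
  rewrite (_ : q * _ = q * q ^+ K * e * wsum p K (cprod b v)); last by ring.
  by rewrite he; field.
have -> : 2 * q * C * (2 * q) * wsum p K v = 2 * (q * (C * (2 * q * wsum p K v))) by ring.
lra.
Qed.

End MultiplierAlgebra.

(** * Haar sums in L^p *)

Section RestrictedMeasure.
Context d (T : measurableType d) (R : realType).
Variables (mu : {measure set T -> \bar R}) (D : set T) (mD : measurable D).
Import HBNNSimple.

(** [pnorm] is defined for arbitrary functions, so the two integrals are compared through the simple
    functions below [f]. *)
Lemma ge0_integral_mrestr (f : T -> \bar R) : (forall x, 0 <= f x)%E ->
  (\int[mrestr mu mD]_x f x = \int[mu]_(x in D) f x)%E.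
Proof.
move=> f0; pose nu : {measure set T -> \bar R} := mrestr mu mD.
have -> : (\int[mu]_(x in D) f x = \int[nu]_(x in D) f x)%E.
  apply: eq_measure_integral => A mA AI.
  by rewrite /nu /= /mrestr; congr (mu _); apply/esym/setIidPl.
rewrite -/nu; apply/eqP; rewrite eq_le; apply/andP; split.
  rewrite ge0_integralTE //.
  apply: ge_ereal_sup => _ [h /= hf] <-.
  have h0 x : (0 <= (h x)%:E)%E by rewrite lee_fin; exact: fun_ge0.
  have mh : measurable_fun setT (fun x => (h x)%:E) by apply/measurable_EFinP.
  rewrite -integralT_nnsfun -(setUv D).
  rewrite ge0_integral_setU //; [|exact: measurableC|by rewrite setUv|by rewrite disj_set2E setICr].
  rewrite [X in (_ + X <= _)%E](_ : _ = 0%E) ?adde0; last first.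
    apply: null_set_integral => //; [exact: measurableC|exact: measurable_funTS|].
    by rewrite /nu /= /mrestr setICl measure0.
  rewrite integral_nnsfun // mrestrict (@ge0_integralE _ _ _ _ _ f) => [|x _]; last exact: f0.
  apply: ereal_sup_ubound; exists (proj_nnsfun h mD) => // x.
  by rewrite -mrestrict /= /patch; case: ifP => _ //.
rewrite integral_mkcond !ge0_integralTE //; last first.
  by move=> x; apply: erestrict_ge0.
apply: le_ereal_sup => _ [h /= hf] <-.
exists h => // x; apply: le_trans (hf x) _.
by rewrite /patch; case: ifP.
Qed.

Lemma integral_mrestr (f : T -> \bar R) :
  (\int[mrestr mu mD]_x f x = \int[mu]_(x in D) f x)%E.
Proof.
have h := @integralE _ _ _ (mrestr mu mD) setT f; rewrite h [RHS]integralE.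
by rewrite !ge0_integral_mrestr.
Qed.

End RestrictedMeasure.

Lemma integral_muI (R : realType) (f : R -> \bar R) :
  (\int[@muI R]_x f x = \int[@lebesgue_measure R]_(x in @I01 R) f x)%E.
Proof. exact: integral_mrestr. Qed.

Section PIntegral.
Variables (R : realType) (p : R).
Local Notation leb := (@lebesgue_measure R).
Local Notation I01 := (@I01 R).
Local Notation muI := (@muI R).

(** The [p]-th power of [pnorm]: the quantity that tree averages compute exactly. *)
Definition pint (g : R -> R[i]) : \bar R :=
  (\int[leb]_(t in I01) (cabs (g t) `^ p)%:E)%E.

Lemma pint_ge0 g : (0 <= pint g)%E.
Proof. by apply: integral_ge0 => x _; rewrite lee_fin powR_ge0. Qed.

Lemma pnormE g : 0 < p -> pnorm p g = (pint g `^ p^-1)%E.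
Proof.
move=> p0; rewrite /pnorm unlock; congr (_ `^ _)%E.
rewrite integral_muI.
apply: eq_integral => x _ /=.
by rewrite ger0_norm ?cabs_ge0.
Qed.

Lemma pnorm_ltP g (e : R) : 0 < p -> 0 < e -> (pnorm p g < e%:E)%E <-> (pint g < (e `^ p)%:E)%E.
Proof.
move=> p0 e0; rewrite pnormE //; have := pint_ge0 g; case: (pint g) => [x| |] // x0.
  rewrite poweR_EFin !lte_fin; rewrite lee_fin in x0; split=> h.
    have := gt0_ltr_powR p0 _ _ h; rewrite !nnegrE powR_ge0 (ltW e0) => /(_ isT isT).
    by rewrite -powRrM mulVf ?gt_eqF // powRr1.
  have ip : 0 < p^-1 by rewrite invr_gt0.
  have := gt0_ltr_powR ip _ _ h; rewrite !nnegrE powR_ge0 x0 => /(_ isT isT).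
  by rewrite -powRrM mulfV ?gt_eqF // powRr1 // ltW.
by rewrite poweRyr ?gt_eqF ?invr_gt0 // !ltNge !leey.
Qed.

Lemma pnorm_lty g : 0 < p -> (pnorm p g < +oo)%E <-> (pint g < +oo)%E.
Proof.
move=> p0; rewrite pnormE //; have := pint_ge0 g; case: (pint g) => [x| |] // x0.
  by rewrite poweR_EFin !ltry.
by rewrite poweRyr ?gt_eqF ?invr_gt0.
Qed.

Lemma pnorm_le (K : R) g h : 0 < p -> 0 <= K ->
  (pint g <= K%:E * pint h)%E -> (pnorm p g <= (K `^ p^-1)%:E * pnorm p h)%E.
Proof.
move=> p0 K0 le; rewrite !pnormE // -poweR_EFin -poweRM ?lee_fin ?pint_ge0 //.
apply: gt0_ler_poweR => //; rewrite ?invr_ge0 ?ltW //; rewrite ?in_itv /= ?andbT ?leey ?pint_ge0 //.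
by rewrite mule_ge0 ?lee_fin ?pint_ge0.
Qed.

Lemma pint_le (K : R) g h : 0 < p -> 0 <= K ->
  (pnorm p g <= K%:E * pnorm p h)%E -> (pint g <= (K `^ p)%:E * pint h)%E.
Proof.
move=> p0 K0; rewrite !pnormE // => le.
have e x : (0 <= x)%E -> x = ((x `^ p^-1) `^ p)%E.
  by move=> x0; rewrite -poweRrM mulVf ?gt_eqF // poweRe1.
rewrite (e (pint g)) ?pint_ge0 // (e (pint h)) ?pint_ge0 //.
rewrite -poweR_EFin -poweRM ?lee_fin ?poweR_ge0 //.
apply: gt0_ler_poweR => //; rewrite ?ltW //; rewrite ?in_itv /= ?andbT ?leey ?poweR_ge0 //.
by rewrite mule_ge0 ?lee_fin ?poweR_ge0.
Qed.

End PIntegral.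

Section ComplexMeasurable.
Variables (R : realType) (D : set R).
Implicit Types (f g : R -> R[i]).

Definition cmfun f := measurable_fun (D : set (measurableTypeR R)) (fun x => complex.Re (f x) : measurableTypeR R) /\
  measurable_fun (D : set (measurableTypeR R)) (fun x => complex.Im (f x) : measurableTypeR R).

Lemma cmfun_cst (z : R[i]) : cmfun (fun _ => z).
Proof. by split; exact: measurable_cst. Qed.

Lemma cmfunD f g : cmfun f -> cmfun g -> cmfun (fun x => f x + g x).
Proof.
move=> [f1 f2] [g1 g2]; split.
  rewrite (_ : (fun x => _) = (fun x => complex.Re (f x) + complex.Re (g x))).
    exact: measurable_funD.
  by apply/funext => x; case: (f x) (g x) => a b [].
rewrite (_ : (fun x => _) = (fun x => complex.Im (f x) + complex.Im (g x))).
  exact: measurable_funD.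
by apply/funext => x; case: (f x) (g x) => a b [].
Qed.

Lemma cmfunM f g : cmfun f -> cmfun g -> cmfun (fun x => f x * g x).
Proof.
move=> [f1 f2] [g1 g2]; split.
  rewrite (_ : (fun x => _) = (fun x => complex.Re (f x) * complex.Re (g x) - complex.Im (f x) * complex.Im (g x))).
    by apply: measurable_funB; apply: measurable_funM.
  by apply/funext => x; case: (f x) (g x) => a b [].
rewrite (_ : (fun x => _) = (fun x => complex.Re (f x) * complex.Im (g x) + complex.Im (f x) * complex.Re (g x))).
  by apply: measurable_funD; apply: measurable_funM.
by apply/funext => x; case: (f x) (g x) => a b [].
Qed.

Lemma cmfunZ (z : R[i]) f : cmfun f -> cmfun (fun x => z * f x).
Proof. by move=> hf; apply: cmfunM => //; exact: cmfun_cst. Qed.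

Lemma cmfunB f g : cmfun f -> cmfun g -> cmfun (fun x => f x - g x).
Proof.
move=> hf hg; rewrite (_ : (fun x => _) = (fun x => f x + (-1) * g x)).
  by apply: cmfunD => //; exact: cmfunZ.
by apply/funext => x; rewrite mulN1r.
Qed.

Lemma cmfun_sum (I : Type) (r : seq I) (P : pred I) (F : I -> R -> R[i]) :
  (forall i, cmfun (F i)) -> cmfun (fun x => \sum_(i <- r | P i) F i x).
Proof.
move=> h; elim: r => [|i r IH].
  rewrite (_ : (fun x => _) = (fun _ => 0)); first exact: cmfun_cst.
  by apply/funext => x; rewrite big_nil.
rewrite (_ : (fun x => _) =
  (fun x => (if P i then F i x else 0) + \sum_(j <- r | P j) F j x)); last first.
  by apply/funext => x; rewrite big_cons; case: (P i); rewrite ?add0r.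
by apply: cmfunD => //; case: (P i) => //; exact: cmfun_cst.
Qed.

Lemma measurable_cabs f : cmfun f ->
  measurable_fun (D : set (measurableTypeR R)) (fun x => cabs (f x) : measurableTypeR R).
Proof.
move=> [f1 f2].
rewrite (_ : (fun x => _) = (fun x => (complex.Re (f x) ^+ 2 + complex.Im (f x) ^+ 2) `^ 2^-1)); last first.
  apply/funext => x; rewrite powR12_sqrt ?addr_ge0 ?sqr_ge0 //.
  by case: (f x).
apply: (@measurableT_comp _ _ _ _ _ _ (@powR R ^~ 2^-1) _ (fun x => complex.Re (f x) ^+ 2 + complex.Im (f x) ^+ 2)).
  exact: measurable_powR.
by apply: measurable_funD; apply: (measurable_funX 2%N).
Qed.

Lemma measurable_cabs_powR (p : R) f : cmfun f ->
  measurable_fun (D : set (measurableTypeR R)) (fun x => (cabs (f x) `^ p)%:E).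
Proof.
move=> hf; apply/measurable_EFinP.
apply: (@measurableT_comp _ _ _ _ _ _ (@powR R ^~ p) _ (fun x => cabs (f x))).
  exact: measurable_powR.
exact: measurable_cabs.
Qed.

End ComplexMeasurable.

(** * Haar functions on the tree of dyadic intervals *)

Section DyadicIntervals.
Variable R : realType.
Implicit Types (t : R) (l j k m n : nat) (xi : nat -> R[i]).
Local Notation leb := (@lebesgue_measure R).

Definition indyad l j t := (j%:R / 2 ^+ l < t) && (t <= j.+1%:R / 2 ^+ l).

Definition dyad l j : set R := `](j%:R / 2 ^+ l), (j.+1%:R / 2 ^+ l)]%classic.

Lemma dyadP l j t : dyad l j t <-> indyad l j t.
Proof. by rewrite /dyad /= in_itv. Qed.

Lemma measurable_dyad l j : measurable (dyad l j : set (measurableTypeR R)).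
Proof. exact: measurable_itv. Qed.

Lemma dyad00 : dyad 0 0 = @I01 R.
Proof. by rewrite /dyad /I01 expr0 mul0r divr1. Qed.

Lemma dyad_ltS l j : j%:R / 2 ^+ l < j.+1%:R / 2 ^+ l :> R.
Proof. by rewrite ltr_pM2r ?invr_gt0 ?exprn_gt0 // ltr_nat. Qed.

Lemma lebesgue_dyad l j : leb (dyad l j) = (2 ^- l)%:E.
Proof.
rewrite /dyad lebesgue_measure_itv /= lte_fin dyad_ltS -EFinB; congr _%:E.
by rewrite -mulrBl -natr1 addrAC subrr add0r mul1r.
Qed.

Lemma dyad_mid l j : j.*2.+1%:R / 2 ^+ l.+1 = (j%:R + 2^-1) / 2 ^+ l :> R.
Proof.
rewrite -natr1 -muln2 natrM exprS; field.
by rewrite expf_neq0.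
Qed.

Lemma dyad_left l j : j.*2%:R / 2 ^+ l.+1 = j%:R / 2 ^+ l :> R.
Proof. by rewrite -muln2 natrM exprS invfM mulrA mulfK ?pnatr_eq0. Qed.

Lemma dyad_right l j : j.*2.+2%:R / 2 ^+ l.+1 = j.+1%:R / 2 ^+ l :> R.
Proof. by rewrite -doubleS dyad_left. Qed.

Lemma indyadS l j t : indyad l j t = indyad l.+1 j.*2 t || indyad l.+1 j.*2.+1 t.
Proof.
rewrite /indyad dyad_left dyad_right dyad_mid.
have h1 : j%:R / 2 ^+ l < (j%:R + 2^-1) / 2 ^+ l :> R.
  by rewrite ltr_pM2r ?invr_gt0 ?exprn_gt0 // ltrDl invr_gt0.
have h2 : (j%:R + 2^-1) / 2 ^+ l < j.+1%:R / 2 ^+ l :> R.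
  by rewrite ltr_pM2r ?invr_gt0 ?exprn_gt0 // -[j.+1%:R]natr1 ltrD2l invf_lt1 ?ltr1n.
move: h1 h2; set a := j%:R / _; set b := (_ + _) / _; set c := _ / _ => h1 h2.
have [tb|bt] := leP t b; rewrite ?andbT ?andbF ?orbF /=.
  by rewrite (le_trans tb (ltW h2)) andbT.
by rewrite (lt_trans h1 bt).
Qed.

Lemma indyad_uniq l j k t : indyad l j t -> indyad l k t -> j = k.
Proof.
move=> /andP[j1 j2] /andP[k1 k2].
have e : 0 < (2 ^+ l)^-1 :> R by rewrite invr_gt0 exprn_gt0.
have := lt_le_trans j1 k2; rewrite ltr_pM2r // ltr_nat.
have := lt_le_trans k1 j2; rewrite ltr_pM2r // ltr_nat.
by rewrite !ltnS => h1 h2; apply/eqP; rewrite eqn_leq h2.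
Qed.

Lemma dyadS l j : dyad l j = dyad l.+1 j.*2 `|` dyad l.+1 j.*2.+1.
Proof.
apply/seteqP; split=> t /=.
  by move=> /dyadP; rewrite indyadS => /orP[] h; [left|right]; apply/dyadP.
by move=> h; apply/dyadP; rewrite indyadS; case: h => /dyadP ->; rewrite ?orbT.
Qed.

Lemma dyadS_disj l j : [disjoint dyad l.+1 j.*2 & dyad l.+1 j.*2.+1].
Proof.
rewrite disj_set2E; apply/eqP/seteqP; split=> // t [/dyadP h1 /dyadP h2].
by have := indyad_uniq h1 h2; lia.
Qed.

Lemma trunc_log_node l j : (j < 2 ^ l)%N -> trunc_log 2 (2 ^ l + j) = l.
Proof. by move=> h; apply: trunc_log_eq => //; rewrite leq_addr expnS; lia. Qed.

Lemma dilE (F : R -> R[i]) l j t : (j < 2 ^ l)%N ->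
  dil F (2 ^ l + j) t = if indyad l j t then F (2 ^+ l * t - j%:R) else 0.
Proof. by move=> h; rewrite /dil trunc_log_node // addKn. Qed.

Lemma haarnE l j t : (j < 2 ^ l)%N -> haarn (2 ^ l + j) t =
  if indyad l.+1 j.*2 t then 1 else if indyad l.+1 j.*2.+1 t then -1 else 0.
Proof.
move=> h; rewrite /haarn dilE // indyadS.
have e : 0 < 2 ^+ l :> R by rewrite exprn_gt0.
rewrite /indyad dyad_left dyad_right dyad_mid /haar.
rewrite subr_gt0 -(ltr_pdivrMl _ _ e) ltrBrDr lerBlDr lerBlDr.
rewrite -(ltr_pdivrMl _ _ e) -!(ler_pdivlMl _ _ e) ![(2 ^+ l)^-1 * _]mulrC.
rewrite [2^-1 + _]addrC [1 + _]addrC natr1.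
set a := j%:R / _; set b := (_ + _) / _; set c := _ / _.
by case: (ltP a t); case: (leP t b); case: (leP t c).
Qed.

Lemma haarn_out l j t : (j < 2 ^ l)%N -> ~~ indyad l j t -> haarn (2 ^ l + j) t = 0.
Proof. by move=> h; rewrite haarnE // indyadS negb_or => /andP[/negPf -> /negPf ->]. Qed.

Lemma mem_dyad l j t : (t \in dyad l j) = indyad l j t.
Proof. by apply/idP/idP; rewrite inE dyadP. Qed.

Lemma cmfun_haarn (D : set R) n : (0 < n)%N -> cmfun D (haarn n).
Proof.
move=> n0; have [l [j [jl ->]]] : exists l j, (j < 2 ^ l)%N /\ n = (2 ^ l + j)%N.
  exists (trunc_log 2 n), (n - 2 ^ trunc_log 2 n)%N.
  have /andP[h1 h2] := trunc_log_bounds (ltnSn 1) n0.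
  by rewrite subnKC // ltn_subLR // addnn -mul2n -expnS.
split; last first.
  rewrite (_ : (fun x => _) = (fun _ => 0)); first exact: measurable_cst.
  apply/funext => t; rewrite haarnE //.
  by case: ifP => // _; case: ifP => //= _; rewrite oppr0.
rewrite (_ : (fun x => _) = (fun t => \1_(dyad l.+1 j.*2) t - \1_(dyad l.+1 j.*2.+1) t)).
  by apply: measurable_funB; apply: measurable_indic; exact: measurable_dyad.
apply/funext => t; rewrite haarnE // !indicE !mem_dyad.
case: (boolP (indyad l.+1 j.*2 t)) => [h|_].
  case: (boolP (indyad l.+1 j.*2.+1 t)) => [h'|_]; last by rewrite subr0.
  by have := indyad_uniq h h'; lia.
by case: (indyad l.+1 j.*2.+1 t) => /=; rewrite ?subr0 ?sub0r.
Qed.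

Definition haar_level xi l t : R[i] := \sum_(m < 2 ^ l) xi (2 ^ l + m)%N * haarn (2 ^ l + m) t.

Definition haar_psum xi l r t : R[i] := \sum_(i < r) haar_level xi (l + i) t.

Lemma haar_levelE xi l j t : (j < 2 ^ l)%N -> indyad l j t ->
  haar_level xi l t = xi (2 ^ l + j)%N * haarn (2 ^ l + j) t.
Proof.
move=> jl h; rewrite /haar_level (bigD1 (Ordinal jl)) //= big1 ?addr0 // => m hm.
rewrite haarn_out ?mulr0 //; apply/negP => hm'; move: hm.
by rewrite -val_eqE /= (indyad_uniq hm' h) eqxx.
Qed.

Lemma haar_psumS xi l r t : haar_psum xi l r.+1 t = haar_level xi l t + haar_psum xi l.+1 r t.
Proof.
rewrite /haar_psum big_ord_recl /= addn0; congr (_ + _).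
by apply: eq_bigr => i _; rewrite /bump /= add1n addSnnS.
Qed.

Lemma cmfun_haar_psum (D : set R) xi l r : cmfun D (haar_psum xi l r).
Proof.
apply: cmfun_sum => i; apply: cmfun_sum => m; apply: cmfunZ; apply: cmfun_haarn.
by rewrite addn_gt0 expn_gt0.
Qed.

(** The node [n = 2^l + j] is the interval [(j 2^(-l), (j+1) 2^(-l)]]. Its halves are the nodes [2n]
    and [2n+1], on which [h_n] is 1 and -1, so halving the interval is one step of [tree_avg]. *)
Lemma integral_haar_psum (p : R) xi l j r (x : R[i]) (A : R) : (j < 2 ^ l)%N ->
  (\int[leb]_(t in dyad l j) (cabs (x + haar_psum xi l r t) `^ p)%:E)%E =
  (2 ^- l * tree_avg (fun y _ => cabs y `^ p) xi r (2 ^ l + j) x A)%:E.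
Proof.
elim: r l j x A => [|r IH] l j x A jl.
  under eq_integral do rewrite /haar_psum big_ord0 addr0.
  rewrite integral_cst; last exact: measurable_dyad.
  by rewrite [X in (_ * X)%E](lebesgue_dyad l j) -EFinM /= mulrC.
have jl2 : (j.*2.+1 < 2 ^ l.+1)%N by rewrite expnS; lia.
have jl1 : (j.*2 < 2 ^ l.+1)%N by rewrite ltnW.
rewrite dyadS ge0_integral_setU.
- have -> : (\int[leb]_(t in dyad l.+1 j.*2) (cabs (x + haar_psum xi l r.+1 t) `^ p)%:E)%E =
    (\int[leb]_(t in dyad l.+1 j.*2) (cabs (x + xi (2 ^ l + j)%N + haar_psum xi l.+1 r t) `^ p)%:E)%E.
    apply: eq_integral => t; rewrite mem_dyad => ht.
    have h : indyad l j t by rewrite indyadS ht.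
    by rewrite haar_psumS (haar_levelE _ jl h) haarnE // ht mulr1 addrA.
  have -> : (\int[leb]_(t in dyad l.+1 j.*2.+1) (cabs (x + haar_psum xi l r.+1 t) `^ p)%:E)%E =
    (\int[leb]_(t in dyad l.+1 j.*2.+1) (cabs (x - xi (2 ^ l + j)%N + haar_psum xi l.+1 r t) `^ p)%:E)%E.
    apply: eq_integral => t; rewrite mem_dyad => ht.
    have h : indyad l j t by rewrite indyadS ht orbT.
    have hl : indyad l.+1 j.*2 t = false.
      by apply/negP => h'; have := indyad_uniq ht h'; lia.
    by rewrite haar_psumS (haar_levelE _ jl h) haarnE // hl ht mulrN1 addrA.
  rewrite (IH _ _ _ A jl1) (IH _ _ _ (A + wsum 2 r (chain xi (2 ^ l + j).*2.+1)) jl2) -EFinD /=.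
  have -> : (2 ^ l.+1 + j.*2 = (2 ^ l + j).*2)%N by rewrite expnS; lia.
  have -> : (2 ^ l.+1 + j.*2.+1 = (2 ^ l + j).*2.+1)%N by rewrite expnS; lia.
  congr _%:E; rewrite exprS; field.
  by rewrite expf_neq0.
- exact: measurable_dyad.
- exact: measurable_dyad.
- apply: measurable_cabs_powR; apply: cmfunD; [exact: cmfun_cst | exact: cmfun_haar_psum].
- by move=> t _; rewrite lee_fin powR_ge0.
- exact: dyadS_disj.
Qed.

Lemma pint_haar_psum (p : R) xi N : pint p (haar_psum xi 0 N) = (tree_norm p N xi)%:E.
Proof.
have := @integral_haar_psum p xi 0 0 N 0 0 isT.
rewrite dyad00 expr0 invr1 mul1r /tree_norm => <-.
by apply: eq_integral => t _; rewrite add0r.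
Qed.

End DyadicIntervals.

(** * Pointwise Haar expansions of dilations *)

Section HaarSeries.
Variable R : realType.
Implicit Types (t : R) (l j k m n N M : nat) (xi eta c a : nat -> R[i]) (F G : R -> R[i]).
Local Notation leb := (@lebesgue_measure R).

(** Stabilisation of the partial sums at each point, with no statement about norms. In this form the
    expansion of [f] survives dilation and finite combination. *)
Definition haar_series xi F := forall t, 0 < t <= 1 ->
  exists N0, forall N, (N0 <= N)%N -> F t = haar_psum xi 0 N t.

Lemma mem_I01 t : @I01 R t <-> 0 < t <= 1.
Proof. by rewrite /I01 /= in_itv. Qed.

Lemma haar_psumD xi eta l N t :
  haar_psum (fun n => xi n + eta n) l N t = haar_psum xi l N t + haar_psum eta l N t.
Proof.
rewrite /haar_psum -big_split; apply: eq_bigr => i _ /=.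
by rewrite /haar_level -big_split; apply: eq_bigr => m _ /=; rewrite mulrDl.
Qed.

Lemma haar_psumZ (z : R[i]) xi l N t :
  haar_psum (fun n => z * xi n) l N t = z * haar_psum xi l N t.
Proof.
rewrite /haar_psum mulr_sumr; apply: eq_bigr => i _ /=.
by rewrite /haar_level mulr_sumr; apply: eq_bigr => m _ /=; rewrite mulrA.
Qed.

Lemma haar_psum0 l N t : haar_psum (fun _ => 0) l N t = 0.
Proof. by apply: big1 => i _; apply: big1 => m _; rewrite mul0r. Qed.

Lemma haar_series_psum xi N : haar_series (fun n => xi n - cutk (2 ^ N) xi n) (haar_psum xi 0 N).
Proof.
move=> t t01; exists N => M NM.
rewrite /haar_psum -(subnKC NM) big_split_ord /= [X in _ = _ + X]big1 ?addr0; last first.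
  move=> i _; apply: big1 => m _; rewrite /cutk ifT ?subrr ?mul0r //.
  by rewrite (@leq_trans (2 ^ (N + i))) ?leq_addr // leq_exp2l // leq_addr.
apply: eq_bigr => i _; apply: eq_bigr => m _; rewrite /cutk ifF ?subr0 //.
apply/negbTE; rewrite -ltnNge; have hm : (m < 2 ^ i)%N := ltn_ord m.
rewrite (@leq_trans (2 ^ i.+1)) //; last by rewrite leq_exp2l.
by rewrite expnS mul2n -addnn ltn_add2l.
Qed.

Lemma haar_seriesD xi eta F G : haar_series xi F -> haar_series eta G ->
  haar_series (fun n => xi n + eta n) (fun t => F t + G t).
Proof.
move=> hF hG t t01; have [N1 h1] := hF t t01; have [N2 h2] := hG t t01.
exists (maxn N1 N2) => N; rewrite geq_max => /andP[hN1 hN2].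
by rewrite haar_psumD (h1 N hN1) (h2 N hN2).
Qed.

Lemma haar_seriesZ (z : R[i]) xi F : haar_series xi F ->
  haar_series (fun n => z * xi n) (fun t => z * F t).
Proof.
by move=> hF t t01; have [N1 h1] := hF t t01; exists N1 => N hN; rewrite haar_psumZ (h1 N hN).
Qed.

Lemma haar_seriesB xi eta F G : haar_series xi F -> haar_series eta G ->
  haar_series (fun n => xi n - eta n) (fun t => F t - G t).
Proof.
move=> hF hG; have := haar_seriesD hF (haar_seriesZ (-1) hG).
rewrite (_ : (fun n => _) = (fun n => xi n - eta n)); last by apply/funext => n; rewrite mulN1r.
by rewrite (_ : (fun t => _ + _ * _) = (fun t => F t - G t)) //; apply/funext => t; rewrite mulN1r.
Qed.

Lemma haar_series_sum (I : Type) (r : seq I) (P : pred I) (xi : I -> nat -> R[i])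
    (F : I -> R -> R[i]) : (forall i, P i -> haar_series (xi i) (F i)) ->
  haar_series (fun n => \sum_(i <- r | P i) xi i n) (fun t => \sum_(i <- r | P i) F i t).
Proof.
move=> h; elim: r => [|i r IH].
  by move=> t t01; exists 0%N => N _; rewrite big_nil (_ : (fun n => _) = (fun=> 0)) ?haar_psum0 //; apply/funext => n; rewrite big_nil.
case Pi : (P i); last first.
  rewrite (_ : (fun n => _) = (fun n => \sum_(j <- r | P j) xi j n)); last first.
    by apply/funext => n; rewrite big_cons Pi.
  rewrite (_ : (fun t => _) = (fun t => \sum_(j <- r | P j) F j t)) //.
  by apply/funext => n; rewrite big_cons Pi.
rewrite (_ : (fun n => _) = (fun n => xi i n + \sum_(j <- r | P j) xi j n)); last first.
  by apply/funext => n; rewrite big_cons Pi.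
rewrite (_ : (fun t => \sum_(j <- _ :: _ | _) _) = (fun t => F i t + \sum_(j <- r | P j) F j t)); last first.
  by apply/funext => n; rewrite big_cons Pi.
by apply: haar_seriesD => //; exact: h.
Qed.

Lemma haar_series_cmfun xi F : haar_series xi F -> cmfun (@I01 R) F.
Proof.
move=> hF; split.
  apply: (measurable_fun_cvg (h := fun N t => complex.Re (haar_psum xi 0 N t))).
    by move=> N; case: (cmfun_haar_psum (@I01 R) xi 0 N).
  move=> t /mem_I01 /hF [N0 h].
  apply: (@cvg_near_cst nat R _ (fun N => complex.Re (haar_psum xi 0 N t)) \oo).
  by exists N0 => // N /= hN; rewrite (h N hN).
apply: (measurable_fun_cvg (h := fun N t => complex.Im (haar_psum xi 0 N t))).
  by move=> N; case: (cmfun_haar_psum (@I01 R) xi 0 N).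
move=> t /mem_I01 /hF [N0 h].
apply: (@cvg_near_cst nat R _ (fun N => complex.Im (haar_psum xi 0 N t)) \oo).
by exists N0 => // N /= hN; rewrite (h N hN).
Qed.

Lemma haar_psum_comb xi N t :
  haar_psum xi 0 N t = \sum_(n < 2 ^ N | (0 < n)%N) xi n * haarn n t.
Proof.
elim: N => [|N IH].
  by rewrite /haar_psum big_ord0 expn0 big_ord1_cond.
rewrite /haar_psum big_ord_recr /= -/(haar_psum xi 0 N t) IH add0n /haar_level.
have e : (2 ^ N.+1 = 2 ^ N + 2 ^ N)%N by rewrite expnS mul2n addnn.
rewrite -(big_mkord (fun n => 0 < n)%N (fun n => xi n * haarn n t)).
rewrite -(big_mkord (fun n => 0 < n)%N (fun n => xi n * haarn n t)) e.
rewrite [RHS](big_cat_nat (n := (2 ^ N)%N)) ?leq_addr //=; congr (_ + _).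
rewrite -[X in \sum_(X <= _ < _ | _) _]add0n big_addn addnK big_mkord.
by apply: eq_big => i; rewrite ?addn_gt0 ?expn_gt0 ?orbT // addnC.
Qed.

Definition restr (P : pred nat) M a n : R[i] := if P n && (n < M)%N then a n else 0.

Lemma comb_haar_psum (P : pred nat) M a N t : (forall n, P n -> (0 < n)%N) -> (M <= 2 ^ N)%N ->
  comb (@haarn R) P M a t = haar_psum (restr P M a) 0 N t.
Proof.
move=> hP MN; rewrite haar_psum_comb /comb.
rewrite (big_ord_widen_cond _ P (fun n => a n * haarn n t) MN).
rewrite [LHS]big_mkcond [RHS]big_mkcond; apply: eq_bigr => n _.
rewrite /restr; case: ifP => h; first by rewrite (hP _ (proj1 (andP h))).
by rewrite mul0r; case: ifP.
Qed.

Lemma haar_series_comb_haar (P : pred nat) M a : (forall n, P n -> (0 < n)%N) ->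
  haar_series (restr P M a) (comb (@haarn R) P M a).
Proof.
move=> hP t _; exists M => N MN; apply: comb_haar_psum => //.
by rewrite (leq_trans MN) // ltnW // ltn_expl.
Qed.

Lemma indyad_scale l j k m t :
  indyad (l + k) (j * 2 ^ k + m) t = indyad k m (2 ^+ l * t - j%:R).
Proof.
have e : 0 < 2 ^+ l :> R by rewrite exprn_gt0.
have e' n : (j * 2 ^ k + n)%:R / 2 ^+ (l + k) = (n%:R / 2 ^+ k + j%:R) / 2 ^+ l :> R.
  rewrite natrD natrM natrX exprD; field.
  by rewrite !expf_neq0.
rewrite /indyad -addnS !e' ltr_pdivrMr // ler_pdivlMr // [t * _]mulrC.
by rewrite ltrBrDr lerBlDr.
Qed.

Lemma indyad00 t : indyad 0 0 t = (0 < t <= 1).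
Proof. by rewrite /indyad expr0 !divr1. Qed.

Lemma haarn_scale l j k t : (j < 2 ^ l)%N ->
  haarn ((2 ^ l + j) * 2 ^ k) t = haarn (2 ^ k) (2 ^+ l * t - j%:R).
Proof.
move=> jl; rewrite mulnDl -expnD -[(2 ^ k)%N in RHS]addn0.
have h : (j * 2 ^ k < 2 ^ (l + k))%N by rewrite expnD ltn_pmul2r ?expn_gt0.
rewrite !haarnE ?expn_gt0 // -addnS.
have -> : ((j * 2 ^ k).*2 = j * 2 ^ k.+1 + 0)%N by rewrite addn0 expnS; lia.
by rewrite -addnS !indyad_scale.
Qed.

Section Dilations.
Variables (c : nat -> R[i]) (f : R -> R[i]).
Hypothesis hf : forall t, 0 < t <= 1 -> exists N, forall M, (N <= M)%N ->
  f t = \sum_(k < M) c k * haarn (2 ^ k) t.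

Lemma dil_series n t : (0 < n)%N -> exists N, forall M, (N <= M)%N ->
  dil f n t = \sum_(k < M) c k * haarn (n * 2 ^ k) t.
Proof.
move=> n0; pose l := trunc_log 2 n; pose j := (n - 2 ^ l)%N.
have /andP[h1 h2] := trunc_log_bounds (ltnSn 1) n0.
have jl : (j < 2 ^ l)%N by rewrite /j /l ltn_subLR // addnn -mul2n -expnS.
have -> : n = (2 ^ l + j)%N by rewrite /j subnKC.
have hs := indyad_scale l j 0 0 t; rewrite expn0 muln1 !addn0 in hs.
rewrite dilE // hs indyad00; case: ifP => ht.
  by have [N hN] := hf ht; exists N => M hM; rewrite (hN M hM); apply: eq_bigr => k _; rewrite haarn_scale.
exists 0%N => M _; rewrite big1 // => k _; rewrite haarn_scale //.
rewrite -[(2 ^ k)%N]addn0 haarn_out ?expn_gt0 ?mulr0 //; apply: contraFN ht.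
rewrite /indyad mul0r => /andP[-> /= h]; apply: (le_trans h).
by rewrite ler_pdivrMr ?exprn_gt0 // mul1r exprn_ege1 // ler1n.
Qed.

Lemma tmul_delta n l j : (0 < n)%N -> (j < 2 ^ l)%N ->
  tmul c (fun m => (m == n)%:R) (2 ^ l + j)%N =
  if (trunc_log 2 n <= l)%N && (2 ^ l + j == n * 2 ^ (l - trunc_log 2 n))%N
  then c (l - trunc_log 2 n)%N else 0.
Proof.
move=> n0 jl; set m := (2 ^ l + j)%N.
have m0 : (0 < m)%N by rewrite addn_gt0 expn_gt0.
have lm : trunc_log 2 m = l by exact: trunc_log_node.
have key k : (k <= logn 2 m)%N -> (m %/ 2 ^ k == n)%N ->
    (trunc_log 2 n <= l)%N /\ k = (l - trunc_log 2 n)%N.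
  move=> kl /eqP hk.
  have dv : (2 ^ k %| m)%N by rewrite pfactor_dvdn.
  have em : m = (n * 2 ^ k)%N by rewrite -hk divnK.
  have : trunc_log 2 m = (trunc_log 2 n + k)%N.
    have /andP[b1 b2] := trunc_log_bounds (ltnSn 1) n0.
    apply: trunc_log_eq => //; rewrite em expnD leq_pmul2r ?expn_gt0 // b1 /=.
    by rewrite -addSn expnD ltn_pmul2r ?expn_gt0.
  by rewrite lm => ->; rewrite leq_addr addKn.
rewrite /tmul; case: ifP => [/andP[hl /eqP em]|hn].
  set k := (l - trunc_log 2 n)%N in em *.
  have kl : (k < (logn 2 m).+1)%N.
    by rewrite ltnS -pfactor_dvdn // em dvdn_mull.
  have emk : (m %/ 2 ^ k == n)%N by rewrite em mulnK ?expn_gt0.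
  rewrite (bigD1 (Ordinal kl)) //= emk mulr1 big1 ?addr0 // => i hi.
  case: eqP => // hi'; last by rewrite mulr0.
  have il : (i <= logn 2 m)%N by rewrite -ltnS ltn_ord.
  have [_ hik] := key i il (introT eqP hi').
  by move: hi; rewrite -val_eqE /= hik eqxx.
rewrite big1 // => i _; case: eqP => hi; last by rewrite mulr0.
have il : (i <= logn 2 m)%N by rewrite -ltnS ltn_ord.
have [h1 h2] := key i il (introT eqP hi).
move: hn; rewrite h1 /= -h2 -hi divnK ?eqxx //.
by rewrite pfactor_dvdn.
Qed.

Lemma haar_series_dil n : (0 < n)%N ->
  haar_series (tmul c (fun m => (m == n)%:R)) (dil f n).
Proof.
move=> n0 t _; have [N1 h1] := dil_series t n0.
pose l := trunc_log 2 n; exists (l + N1)%N => N hN.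
have lN : (l <= N)%N by rewrite (leq_trans _ hN) // leq_addr.
rewrite (h1 (N - l)%N); last by rewrite leq_subRL.
have lev i : haar_level (tmul c (fun m => (m == n)%:R)) i t =
    if (l <= i)%N then c (i - l)%N * haarn (n * 2 ^ (i - l)) t else 0.
  rewrite /haar_level.
  case: leqP => li; last first.
    by apply: big1 => m _; rewrite tmul_delta ?ltn_ord // -/l leqNgt li /= mul0r.
  have /andP[b1 b2] := trunc_log_bounds (ltnSn 1) n0.
  have b3 : (2 ^ i <= n * 2 ^ (i - l))%N.
    by rewrite -{1}(subnKC li) expnD leq_pmul2r ?expn_gt0.
  have b4 : (n * 2 ^ (i - l) - 2 ^ i < 2 ^ i)%N.
    rewrite ltn_subLR // addnn -mul2n -expnS -{2}(subnKC li) -addSn expnD.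
    by rewrite ltn_pmul2r ?expn_gt0.
  rewrite (bigD1 (Ordinal b4)) //= tmul_delta // -/l li /= subnKC // eqxx big1 ?addr0 // => m hm.
  rewrite tmul_delta ?ltn_ord // -/l li /=; case: eqP => h; last by rewrite mul0r.
  by move: hm; rewrite -val_eqE /= -h addKn eqxx.
rewrite /haar_psum -[in RHS](subnKC lN) [RHS]big_split_ord /= [X in _ = X + _]big1 ?add0r; last first.
  by move=> i _; rewrite ?add0n lev (_ : (l <= i)%N = false) // leqNgt ltn_ord.
by apply: eq_bigr => i _; rewrite ?add0n lev leq_addr addKn.
Qed.

Lemma tmul_restr (P : pred nat) M a m :
  tmul c (restr P M a) m = \sum_(n < M | P n) a n * tmul c (fun i => (i == n)%:R) m.
Proof.
rewrite /tmul.
under [RHS]eq_bigr do rewrite mulr_sumr.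
rewrite exchange_big /=; apply: eq_bigr => k _.
rewrite -[LHS]/(c k * restr P M a (m %/ 2 ^ k)).
set i := (m %/ 2 ^ k)%N; rewrite /restr; case: ifP => [/andP[Pi iM]|h].
  rewrite (bigD1 (Ordinal iM)) //= eqxx mulr1 big1 ?addr0 1?mulrC // => n /andP[_ hn].
  rewrite (_ : (i == n) = false) ?mulr0 //; apply: contraNF hn => /eqP hin.
  by rewrite -val_eqE /= hin.
rewrite mulr0 big1 // => n Pn; rewrite (_ : (i == n) = false) ?mulr0 //.
by apply: contraFF h => /eqP ->; rewrite Pn ltn_ord.
Qed.

Lemma haar_series_comb_dil (P : pred nat) M a : (forall n, P n -> (0 < n)%N) ->
  haar_series (tmul c (restr P M a)) (comb (dil f) P M a).
Proof.
move=> hP.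
have -> : tmul c (restr P M a) = fun m => \sum_(n < M | P n) a n * tmul c (fun i => (i == n)%:R) m.
  by apply/funext => m; exact: tmul_restr.
apply: haar_series_sum => n Pn; apply: haar_seriesZ; apply: haar_series_dil.
exact: hP.
Qed.

End Dilations.

End HaarSeries.

Section HaarSeriesNorm.
Variables (R : realType) (p : R).
Hypothesis p1 : 1 <= p.
Implicit Types (t : R) (l j k m n N M : nat) (xi eta c a : nat -> R[i]) (F G : R -> R[i]).
Local Notation leb := (@lebesgue_measure R).

(** Fatou's lemma along the partial sums, whose [p]-integrals are tree norms. *)
Lemma pint_haar_series_le xi F (B : R) N1 : haar_series xi F ->
  (forall N, (N1 <= N)%N -> tree_norm p N xi <= B) -> (pint p F <= B%:E)%E.
Proof.
move=> hF hB.
pose u N t := (cabs (haar_psum xi 0 (N1 + N) t) `^ p)%:E.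
have mu N : measurable_fun (@I01 R : set (measurableTypeR R)) (u N).
  exact: (measurable_cabs_powR p (cmfun_haar_psum (@I01 R) xi 0 (N1 + N))).
have -> : pint p F = (\int[leb]_(t in @I01 R) limn_einf (u^~ t))%E.
  apply: eq_integral => t; rewrite inE => /mem_I01 /hF [N0 h].
  have hc : u^~ t @ \oo --> (cabs (F t) `^ p)%:E.
    apply: cvg_near_cst; exists N0 => // N /= hN; rewrite /u -h //.
    by rewrite (leq_trans hN) // leq_addl.
  by rewrite is_cvg_limn_einfE; [rewrite (cvg_lim _ hc) | apply/cvg_ex; eexists; exact: hc].
apply: le_trans (fatou _ (@measurable_I01 R) mu _) _.
  by move=> n t _; rewrite lee_fin powR_ge0.
rewrite limn_einf_lim; apply: lime_le; first exact: is_cvg_einfs.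
apply: nearW => N; apply: (@le_trans _ _ (pint p (haar_psum xi 0 (N1 + N)))).
  by apply: ereal_inf_lbound; exists N => //=.
by rewrite pint_haar_psum lee_fin hB // leq_addr.
Qed.

Lemma pintD F G : cmfun (@I01 R) F -> cmfun (@I01 R) G ->
  (pint p (fun t => F t + G t)%R <= (2 `^ p)%:E * (pint p F + pint p G))%E.
Proof.
move=> mF mG; have mI := @measurable_I01 R.
rewrite /pint -ge0_integralD //; last 4 first.
- by move=> x _; rewrite lee_fin powR_ge0.
- exact: measurable_cabs_powR.
- by move=> x _; rewrite lee_fin powR_ge0.
- exact: measurable_cabs_powR.
rewrite -ge0_integralZl_EFin //; last 2 first.
- by move=> x _; rewrite -EFinD lee_fin addr_ge0 ?powR_ge0.
- by apply: emeasurable_funD; exact: measurable_cabs_powR.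
apply: ge0_le_integral => //.
- by move=> x _; rewrite lee_fin powR_ge0.
- by apply: measurable_cabs_powR; exact: cmfunD.
- by apply: measurable_funeM; apply: emeasurable_funD; exact: measurable_cabs_powR.
move=> x _; rewrite -EFinD -EFinM lee_fin.
apply: le_trans (powR_exch p1 (cabs_ge0 _) (cabs_ge0 _)).
have p0 : 0 <= p by have := p1; lra.
by apply: powR_mono; [exact: p0 | exact: cabs_ge0 | exact: cabsD].
Qed.

Lemma pintN F : pint p (fun t => - F t) = pint p F.
Proof. by apply: eq_integral => t _; rewrite cabsN. Qed.

Lemma eq_pint F G : (forall t, 0 < t <= 1 -> F t = G t) -> pint p F = pint p G.
Proof. by move=> h; apply: eq_integral => t; rewrite inE => /mem_I01 ht; rewrite h. Qed.

Lemma pint_comb_haar (P : pred nat) M a N : (forall n, P n -> (0 < n)%N) -> (M <= N)%N ->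
  pint p (comb (@haarn R) P M a) = (tree_norm p N (restr P M a))%:E.
Proof.
move=> hP MN; rewrite -pint_haar_psum; apply: eq_integral => t _.
by rewrite (comb_haar_psum _ _ hP (_ : (M <= 2 ^ N)%N)) // (leq_trans MN) // ltnW // ltn_expl.
Qed.

End HaarSeriesNorm.

(** * Norm estimates for finite combinations *)

Section NormEquivalence.
Variables (R : realType) (p : R).
Hypothesis p2 : 2 <= p.
Implicit Types (t e : R) (l j k m n N M : nat) (xi eta u v a : nat -> R[i]) (F G : R -> R[i]).
Implicit Types (P : pred nat).

Local Ltac plra := have := p2; lra.
Let p1 : 1 <= p. Proof. plra. Qed.
Let p0 : 0 < p. Proof. plra. Qed.
Let q0 : 0 < p / 2. Proof. plra. Qed.

Lemma tree_norm_ge0 N xi : 0 <= tree_norm p N xi.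
Proof. by rewrite -lee_fin -pint_haar_psum pint_ge0. Qed.

Lemma tree_norm_supp N M xi : (forall n, (M <= n)%N -> xi n = 0) -> (M <= N)%N ->
  tree_norm p N xi = tree_norm p M xi.
Proof.
move=> hxi MN; apply/EFin_inj; rewrite -!pint_haar_psum; apply: eq_pint => t _.
rewrite /haar_psum -(subnKC MN) big_split_ord /= [X in _ + X]big1 ?addr0 // => i _.
apply: big1 => m _; rewrite hxi ?mul0r //.
rewrite (@leq_trans (2 ^ (M + i))) ?leq_addr // (@leq_trans (2 ^ M)) ?leq_exp2l ?leq_addr //.
by rewrite ltnW // ltn_expl.
Qed.

Lemma restr_supp P M a n : (M <= n)%N -> restr P M a n = 0.
Proof. by rewrite /restr ltnNge => ->; rewrite andbF. Qed.

Lemma tree_norm_cut_tmul u xi M e : bounded_wsum p u ->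
  (forall n, (M <= n)%N -> xi n = 0) -> 0 < e ->
  exists N0, forall N N', (N0 <= N)%N -> (M <= N')%N ->
    tree_norm p N' (cutk (2 ^ N) (tmul u xi)) <= e.
Proof.
move=> hu hxi e0; have [C C0 hC] := tree_norm_dominated p2.
pose D := C * tree_norm p M xi + 1.
have D0 : 0 < D by rewrite /D ltr_wpDl // mulr_ge0 // tree_norm_ge0.
pose d := (e / D) `^ (p / 2)^-1.
have d0 : 0 < d by rewrite powR_gt0 // divr_gt0.
have dq : d `^ (p / 2) = e / D.
  by rewrite /d -powRrM mulVf ?gt_eqF // powRr1 // ltW // divr_gt0.
have [N0 hN0] := cut_tmul_dominated p2 hu hxi d0.
exists N0 => N N' hN hN'.
apply: (le_trans (hC _ _ _ N' (ltW d0) (hN0 N hN))).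
rewrite dq (tree_norm_supp hxi hN') mulrAC mulrA ler_pdivrMr //.
rewrite [leRHS]mulrC ler_wpM2r ?(ltW e0) //.
by rewrite /D lerDl.
Qed.

Lemma haar_series_remainder u xi M e F : bounded_wsum p u ->
  (forall n, (M <= n)%N -> xi n = 0) -> haar_series (tmul u xi) F -> 0 < e ->
  exists N0, forall N, (N0 <= N)%N ->
    (pint p (fun t => F t - haar_psum (tmul u xi) 0 N t)%R <= e%:E)%E.
Proof.
move=> hu hxi hF e0; have [N0 hN0] := tree_norm_cut_tmul hu hxi e0.
exists N0 => N hN; apply: (@pint_haar_series_le _ p (cutk (2 ^ N) (tmul u xi)) _ _ M).
  have := haar_seriesB hF (haar_series_psum (tmul u xi) N).
  rewrite (_ : (fun n => _) = cutk (2 ^ N) (tmul u xi)) //.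
  by apply/funext => n; ring.
by move=> N' hN'; exact: hN0.
Qed.

(** The converse of the Fatou bound. For a general pointwise expansion the norm need not control the
    partial sums; here the remainder is small because [xi] is finite and [u] lies in [A_p^+]. *)
Lemma tree_norm_le_pint u xi M e F : bounded_wsum p u ->
  (forall n, (M <= n)%N -> xi n = 0) -> haar_series (tmul u xi) F -> 0 < e ->
  exists N0, forall N, (N0 <= N)%N ->
    ((tree_norm p N (tmul u xi))%:E <= (2 `^ p)%:E * (pint p F + e%:E))%E.
Proof.
move=> hu hxi hF e0; have [N0 hN0] := haar_series_remainder hu hxi hF e0.
exists N0 => N hN; rewrite -pint_haar_psum.
have mF := haar_series_cmfun hF.
have mG : cmfun (@I01 R) (haar_psum (tmul u xi) 0 N) by exact: cmfun_haar_psum.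
rewrite (_ : pint p (haar_psum _ 0 N) =
    pint p (fun t => F t + - (F t - haar_psum (tmul u xi) 0 N t))); last first.
  by apply: eq_pint => t _; ring.
have mN : cmfun (@I01 R) (fun t => - (F t - haar_psum (tmul u xi) 0 N t)).
  rewrite (_ : (fun t => _) = (fun t => haar_psum (tmul u xi) 0 N t - F t)).
    exact: cmfunB.
  by apply/funext => t; rewrite opprB.
apply: (le_trans (pintD p1 mF mN)).
rewrite lee_wpmul2l ?lee_fin ?powR_ge0 // leeD2l // pintN; exact: hN0.
Qed.

(** Composites of [tmul] are compared chain by chain, where they become associative Cauchy
    products. *)
Lemma chain_ext d eta eta' xi : (forall m, odd m -> chain eta m = chain eta' m) ->
  chain_dominated p d eta xi -> chain_dominated p d eta' xi.
Proof. by move=> h hd m r om; rewrite -h //; exact: hd. Qed.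

Lemma cprod0 u : cprod u (fun _ => 0) = (fun _ => 0).
Proof. by apply/funext => n; apply: big1 => i _; rewrite mulr0. Qed.

Section Equivalence.
Variables (c b : nat -> R[i]) (f : R -> R[i]).
Hypothesis hf : forall t, 0 < t <= 1 -> exists N, forall M, (N <= M)%N ->
  f t = \sum_(k < M) c k * haarn (2 ^ k) t.
Hypothesis mc : section_mult p c.
Hypothesis mb : section_mult p b.
Hypothesis cb : cprod c b = @delta0 R.

Lemma pint_comb_dil_le : exists2 K : R, 0 <= K & forall P M a, (forall n, P n -> (0 < n)%N) ->
  (pint p (comb (dil f) P M a) <= K%:E * pint p (comb (@haarn R) P M a))%E.
Proof.
have [C C0 hC] := tree_norm_dominated p2.
have [d d0 hd] := section_mult_dominated p2 mc.
exists (C * d `^ (p / 2)) => [|P M a hP]; first by rewrite mulr_ge0 // powR_ge0.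
rewrite (pint_comb_haar p a hP (leqnn M)) -EFinM.
apply: (@pint_haar_series_le _ _ _ _ _ M (haar_series_comb_dil hf M a hP)) => N hN.
rewrite -(tree_norm_supp (@restr_supp P M a) hN).
by apply: hC => //; exact: hd.
Qed.

(** Multiplication by [b] recovers [xi] chainwise from the Haar coefficients of the combination, so
    these dominate [xi]. They may have infinite support, hence the detour through
    [tree_norm_le_pint] with an arbitrary error. *)
Lemma pint_comb_dil_ge : exists2 K : R, 0 < K & forall P M a, (forall n, P n -> (0 < n)%N) ->
  (pint p (comb (@haarn R) P M a) <= K%:E * pint p (comb (dil f) P M a))%E.
Proof.
have [C C0 hC] := tree_norm_dominated p2.
have [d d0 hd] := section_mult_dominated p2 mb.
pose K := C * d `^ (p / 2) * 2 `^ p + 1.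
have K0 : 0 < K by rewrite ltr_wpDl // !mulr_ge0 // powR_ge0.
exists K => // P M a hP.
set F := comb (dil f) P M a.
have hF := haar_series_comb_dil hf M a hP.
have [->|Fny] := eqVneq (pint p F) +oo%E; first by rewrite gt0_muley ?lte_fin // leey.
have Ffin : pint p F \is a fin_num by rewrite ge0_fin_numE ?pint_ge0 // ltey.
rewrite (pint_comb_haar p a hP (leqnn M)) -(fineK Ffin) -EFinM lee_fin.
apply/ler_addgt0Pr => e e0.
have eK : 0 < e / K by rewrite divr_gt0.
have hsup := @restr_supp P M a.
have [N0 hN0] := tree_norm_le_pint (section_mult_bounded p2 mc) hsup hF eK.
have := hN0 (maxn N0 M) (leq_maxl _ _); set N := maxn N0 M => h.
rewrite -(tree_norm_supp hsup (leq_maxr N0 M)) -/N.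
have hdom : chain_dominated p d (restr P M a) (tmul c (restr P M a)).
  apply: chain_ext (hd (tmul c (restr P M a))) => m om.
  by rewrite !chain_tmul // cprodA (cprodC b) cb cprod_delta0.
have h1 := hC _ _ _ N d0 hdom.
move: h; rewrite -(fineK Ffin) -EFinD -EFinM lee_fin => h.
have F0 : 0 <= fine (pint p F) by rewrite fine_ge0 // pint_ge0.
apply: (le_trans h1).
apply: (@le_trans _ _ (C * d `^ (p / 2) * (2 `^ p * (fine (pint p F) + e / K)))).
  by rewrite ler_wpM2l // mulr_ge0 // powR_ge0.
rewrite mulrA.
apply: (@le_trans _ _ (K * (fine (pint p F) + e / K))).
  rewrite ler_wpM2r ?addr_ge0 ?(ltW eK) // /K lerDl //.
by rewrite mulrDr [K * (e / K)]mulrC divfK // gt_eqF.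
Qed.

Lemma tmul_pred u P M a n : (forall n k, P n -> P (n * 2 ^ k)%N) ->
  ~~ P n -> (0 < n)%N -> tmul u (restr P M a) n = 0.
Proof.
move=> hP nP n0; rewrite /tmul big1 // => k _; rewrite /restr.
case: ifP => [/andP[h _]|_]; last by rewrite mulr0.
have kl : (k <= logn 2 n)%N by rewrite -ltnS ltn_ord.
have dv : (2 ^ k %| n)%N by rewrite pfactor_dvdn.
have := hP _ k h; rewrite divnK // => Pn; by rewrite Pn in nP.
Qed.

Lemma comb_dil_approx P M a e : (forall n, P n -> (0 < n)%N) ->
  (forall n k, P n -> P (n * 2 ^ k)%N) -> 0 < e ->
  exists M' a', (pint p (fun t => comb (dil f) P M a t - comb (@haarn R) P M' a' t)%R <= e%:E)%E.
Proof.
move=> hP hP2 e0; have hsup := @restr_supp P M a.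
have [N hN] := haar_series_remainder (section_mult_bounded p2 mc) hsup (haar_series_comb_dil hf M a hP) e0.
exists (2 ^ N)%N, (tmul c (restr P M a)).
apply: le_trans (hN N (leqnn N)); rewrite le_eqVlt; apply/orP; left; apply/eqP.
apply: eq_pint => t _; congr (_ - _).
rewrite (comb_haar_psum _ _ hP (leqnn _)) !haar_psum_comb; apply: eq_bigr => n n0.
rewrite {1}/restr ltn_ord andbT; case: ifP => // /negbT nP.
by rewrite tmul_pred.
Qed.

(** The natural coefficients [b xi] may have infinite support. After cutting at [2^N] the error is
    [c] times the removed tail: the tail is small because [b] is in [A_p^+], and the multiplier [c]
    enlarges it by a fixed factor only. *)
Lemma comb_haar_approx P M a e : (forall n, P n -> (0 < n)%N) ->
  (forall n k, P n -> P (n * 2 ^ k)%N) -> 0 < e ->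
  exists M' a', (pint p (fun t => comb (@haarn R) P M a t - comb (dil f) P M' a' t)%R <= e%:E)%E.
Proof.
move=> hP hP2 e0; have hsup := @restr_supp P M a.
have [C C0 hC] := tree_norm_dominated p2.
have [d d0 hd] := section_mult_dominated p2 mc.
set xi := restr P M a in hsup *; pose zeta := tmul b xi.
pose D := C * d `^ (p / 2) + 1.
have D0 : 0 < D by rewrite ltr_wpDl // mulr_ge0 // powR_ge0.
have [N hN] := tree_norm_cut_tmul (section_mult_bounded p2 mb) hsup (divr_gt0 e0 D0).
exists (2 ^ N)%N, zeta.
pose zN := restr P (2 ^ N) zeta.
have hs := haar_seriesB (haar_series_comb_haar M a hP) (haar_series_comb_dil hf (2 ^ N) zeta hP).
apply: (@pint_haar_series_le _ _ _ _ _ M hs) => N' hN'.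
apply: (@le_trans _ _ (C * d `^ (p / 2) * tree_norm p N' (cutk (2 ^ N) zeta))).
  apply: hC => //; apply: chain_ext (hd (cutk (2 ^ N) zeta)) => m om.
  have e1 : chain (cutk (2 ^ N) zeta) m = fun k => chain zeta m k + (-1) * chain zN m k.
    apply/funext => k; rewrite /chain /cutk /zN /restr mulN1r.
    have mk0 : (0 < m * 2 ^ k)%N by rewrite muln_gt0 expn_gt0 andbT; case: m om.
    case: leqP => h; rewrite ?andbF ?subr0 // andbT.
    case: ifP => [|/negbT] hPm; first by rewrite subrr.
    by rewrite /zeta tmul_pred // subr0.
  rewrite chain_tmul // e1 cprodDr cprodZr /zeta chain_tmul // cprodA cb cprod_delta0.
  by apply/funext => k; rewrite -chain_tmul // mulN1r.
apply: (@le_trans _ _ (D * (e / D))); last by rewrite mulrC divfK // gt_eqF.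
apply: ler_pM; rewrite ?mulr_ge0 ?powR_ge0 ?tree_norm_ge0 //; first by rewrite /D lerDl.
by rewrite /zeta hN.
Qed.

End Equivalence.

End NormEquivalence.

(** * Closed spans of dilations and translations *)

Section BinaryOnes.
Implicit Types (n m k d K : nat).

Lemma ones_widen n K : (n < 2 ^ K)%N -> ones n = (\sum_(i < K) odd (n %/ 2 ^ i))%N.
Proof.
have h K1 d : (n < 2 ^ K1)%N ->
    (\sum_(i < K1 + d) odd (n %/ 2 ^ i) = \sum_(i < K1) odd (n %/ 2 ^ i))%N.
  move=> nK; rewrite big_split_ord /= [X in (_ + X)%N]big1 ?addn0 // => i _.
  by rewrite divn_small // (leq_trans nK) // leq_exp2l // leq_addr.
move=> nK; rewrite /ones.
have n1 : (n < 2 ^ n.+1)%N by rewrite (ltn_trans (ltnSn n)) // ltn_expl.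
by rewrite -(h n.+1 K n1) addnC (h K n.+1 nK).
Qed.

Lemma ones_half n : ones n = (odd n + ones n./2)%N.
Proof.
have h1 : (n < 2 ^ n.+2)%N by rewrite (@leq_trans n.+2) // ltnW // ltn_expl.
have h2 : (n./2 < 2 ^ n.+1)%N.
  have h3 : (n.+1 < 2 ^ n.+1)%N by exact: ltn_expl.
  by rewrite (leq_ltn_trans _ (ltn_trans (ltnSn n) h3)) //; lia.
rewrite (ones_widen h1) (ones_widen h2) big_ord_recl /= expn0 divn1; congr addn.
apply: eq_bigr => i _ /=.
by rewrite /bump /= add1n expnS divnMA divn2.
Qed.

Lemma ones0 : ones 0 = 0%N.
Proof. by rewrite /ones big_ord1 div0n. Qed.

Lemma ones_double n : ones n.*2 = ones n.
Proof. by rewrite ones_half odd_double doubleK. Qed.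

Lemma ones_mul2X n k : ones (n * 2 ^ k) = ones n.
Proof.
elim: k n => [|k IH] n; first by rewrite muln1.
by rewrite expnS mulnA muln2 IH ones_double.
Qed.

Lemma ones_eq0 n : ones n = 0%N -> n = 0%N.
Proof.
elim/ltn_ind: n => n IH; rewrite ones_half => h.
have [->//|n0] := posnP n.
have on : odd n = false by case: (odd n) h.
have h2 : n./2 = 0%N by apply: IH; [lia|rewrite on in h].
by rewrite -(odd_double_half n) on h2.
Qed.

Lemma ones_pred_gt0 d n : (0 < d)%N -> ones n == d -> (0 < n)%N.
Proof. by move=> d0 /eqP h; case: n h => // h; move: d0; rewrite -h ones0. Qed.

Lemma ones_pow2 k : ones (2 ^ k) = 1%N.
Proof. by rewrite -(mul1n (2 ^ k)%N) ones_mul2X ones_half ones0. Qed.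

Lemma ones_eq1 n : ones n = 1%N -> exists k, n = (2 ^ k)%N.
Proof.
elim/ltn_ind: n => n IH h; have n0 : (0 < n)%N by apply: (@ones_pred_gt0 1); rewrite ?h.
rewrite ones_half in h; case on : (odd n) h => /= h.
  have h2 : n./2 = 0%N by apply: ones_eq0; lia.
  by exists 0%N; rewrite -(odd_double_half n) on h2.
have [k hk] : exists k, n./2 = (2 ^ k)%N by apply: IH; [lia|].
by exists k.+1; rewrite expnS mul2n -hk -[LHS](odd_double_half n) on.
Qed.

Lemma ones_eq1_odd m k : odd m -> ones (m * 2 ^ k) == 1%N = (m == 1%N).
Proof.
move=> om; rewrite ones_mul2X; apply/eqP/eqP => [|->]; last by rewrite (ones_pow2 0).
move=> /ones_eq1 [[|j] hj] //; move: om; by rewrite hj expnS mul2n odd_double.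
Qed.

End BinaryOnes.

Section PowersOfTwo.
Variable R : realType.
Implicit Types (k m n M : nat) (a : nat -> R[i]) (F : nat -> R -> R[i]).

(** Condition (iii) numbers the powers of two by their exponent, the other estimates by their value;
    [trunc_log 2] translates. *)
Lemma comb_pow2 F M a t : comb (fun k => F (2 ^ k)%N) xpredT M a t =
  comb F (fun n => ones n == 1%N) (2 ^ M) (fun n => a (trunc_log 2 n)) t.
Proof.
rewrite /comb -[RHS](big_mkord (fun n => ones n == 1%N) (fun n => a (trunc_log 2 n) * F n t)).
elim: M => [|M IH].
  by rewrite big_ord0 expn0 big_ltn_cond // big_geq // ones0.
rewrite big_ord_recr /= IH (big_cat_nat (n := (2 ^ M)%N) (p := (2 ^ M.+1)%N)) ?leq_exp2l //=.
congr (_ + _).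
rewrite big_ltn_cond ?ltn_exp2l // ones_pow2 eqxx trunc_expnK // [X in _ = _ + X]big_nat_cond.
rewrite big1 ?addr0 // => n /andP[/andP[h1 h2] /eqP /ones_eq1 [k hk]].
move: h1 h2; rewrite hk ltn_exp2l // ltn_exp2l // ltnS; lia.
Qed.

Lemma comb_pow2_inv F M a t : comb F (fun n => ones n == 1%N) M a t =
  comb (fun k => F (2 ^ k)%N) xpredT M (fun k => restr (fun n => ones n == 1%N) M a (2 ^ k)%N) t.
Proof.
rewrite comb_pow2 /comb.
rewrite (big_ord_widen_cond (2 ^ M) (fun n => ones n == 1%N) (fun n => a n * F n t)); last first.
  by rewrite ltnW // ltn_expl.
rewrite big_mkcond [RHS]big_mkcond; apply: eq_bigr => n _.
case: (boolP (ones n == 1%N)) => //= /eqP /ones_eq1 [k hk].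
rewrite hk trunc_expnK // /restr ones_pow2 eqxx /=.
by case: ifP; rewrite ?mul0r.
Qed.

End PowersOfTwo.

Section Span.
Variables (R : realType) (p : R).
Hypothesis p1 : 1 <= p.
Implicit Types (e : R) (k m n M : nat) (a : nat -> R[i]) (F G : nat -> R -> R[i]).
Implicit Types (P : pred nat).

Let p0 : 0 < p. Proof. by have := p1; lra. Qed.

Lemma cspanP F P (g : R -> R[i]) : cspan p F P g <->
  Lp p g /\ forall e, 0 < e -> exists M a, (pint p (fun t => g t - comb F P M a t)%R <= e%:E)%E.
Proof.
split=> -[Lg h]; split=> // e e0.
  have ip : 0 < e `^ p^-1 by exact: powR_gt0.
  have [M [a ha]] := h _ ip; exists M, a.
  move/(pnorm_ltP _ p0 ip): ha; rewrite -powRrM mulVf ?gt_eqF // powRr1 ?(ltW e0) //.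
  exact: ltW.
have ip : 0 < e `^ p / 2 by rewrite divr_gt0 // powR_gt0.
have [M [a ha]] := h _ ip; exists M, a; apply/(pnorm_ltP _ p0 e0).
apply: (le_lt_trans ha); rewrite lte_fin ltr_pdivrMr //.
have := powR_gt0 p e0; lra.
Qed.

Lemma LpP (g : R -> R[i]) : Lp p g <-> cmfun (@I01 R) g /\ (pint p g < +oo)%E.
Proof. by split=> -[h1 h2]; split=> //; move/(pnorm_lty _ p0): h2. Qed.

Lemma pint_triangle (g h k : R -> R[i]) e : cmfun (@I01 R) g -> cmfun (@I01 R) h ->
  cmfun (@I01 R) k -> (pint p (fun t => g t - h t)%R <= e%:E)%E ->
  (pint p (fun t => h t - k t)%R <= e%:E)%E ->
  (pint p (fun t => g t - k t)%R <= (2 `^ p * (2 * e))%:E)%E.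
Proof.
move=> mg mh mk h1 h2.
rewrite (_ : pint p (fun t => g t - k t) = pint p (fun t => (g t - h t) + (h t - k t))); last first.
  by apply: eq_pint => t _; ring.
apply: (le_trans (pintD p1 (cmfunB mg mh) (cmfunB mh mk))).
rewrite EFinM lee_wpmul2l ?lee_fin ?powR_ge0 //.
have -> : 2 * e = e + e by ring.
rewrite EFinD; exact: leeD.
Qed.

Lemma cmfun_comb F P M a : (forall n, P n -> cmfun (@I01 R) (F n)) ->
  cmfun (@I01 R) (comb F P M a).
Proof.
move=> hF; rewrite /comb.
rewrite (_ : (fun t => _) = (fun t => \sum_(n < M) (if P n then a n * F n t else 0))).
  apply: cmfun_sum => n; case Pn : (P n); last exact: cmfun_cst.
  by apply: cmfunZ; exact: hF.
by apply/funext => t; rewrite big_mkcond.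
Qed.

Lemma cspan_sub F G P P' : (forall n, P n -> cmfun (@I01 R) (F n)) ->
  (forall n, P' n -> cmfun (@I01 R) (G n)) ->
  (forall M a e, 0 < e -> exists M' a',
     (pint p (fun t => comb F P M a t - comb G P' M' a' t)%R <= e%:E)%E) ->
  cspan p F P `<=` cspan p G P'.
Proof.
move=> mF mG h g hg0; have [Lg hg] := (cspanP F P g).1 hg0.
apply: (cspanP G P' g).2; split; first exact: Lg.
move=> e e0.
pose e' := e / (2 `^ p * 2).
have D0 : 0 < 2 `^ p * 2 :> R by rewrite mulr_gt0 ?powR_gt0.
have e'0 : 0 < e' by rewrite divr_gt0.
have [M [a ha]] := hg e' e'0; have [M' [a' ha']] := h M a e' e'0.
exists M', a'; have [mg _] := (LpP g).1 Lg.
have := pint_triangle mg (cmfun_comb M a mF) (cmfun_comb M' a' mG) ha ha'.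
by rewrite mulrA /e' [_ * (e / _)]mulrC divfK // gt_eqF.
Qed.

Lemma equiv_basis_pow2 Y F G : equiv_basis p Y F G (fun n => ones n == 1%N) <->
  equiv_basis p Y (fun k => F (2 ^ k)%N) (fun k => G (2 ^ k)%N) xpredT.
Proof.
have e1 H M a : comb (fun k => H (2 ^ k)%N) xpredT M a =
    comb H (fun n => ones n == 1%N) (2 ^ M) (fun n => a (trunc_log 2 n)).
  by apply/funext => t; exact: comb_pow2.
have e2 H M a : comb H (fun n => ones n == 1%N) M a =
    comb (fun k => H (2 ^ k)%N) xpredT M (fun k => restr (fun n => ones n == 1%N) M a (2 ^ k)%N).
  by apply/funext => t; exact: comb_pow2_inv.
have es : cspan p F (fun n => ones n == 1%N) = cspan p (fun k => F (2 ^ k)%N) xpredT.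
  apply/seteqP; split=> g [Lg hg]; split=> // e e0; have [M [a ha]] := hg e e0.
    exists M, (fun k => restr (fun n => ones n == 1%N) M a (2 ^ k)%N).
    by rewrite -e2.
  by exists (2 ^ M)%N, (fun n => a (trunc_log 2 n)); rewrite -e1.
rewrite /equiv_basis es; split=> -[h1 [A [B [A0 [B0 h]]]]]; split=> //; exists A, B; do 2 split=> //.
  by move=> M a; rewrite !e1; exact: h.
by move=> M a; rewrite !e2; exact: h.
Qed.

End Span.

(** * From the symbol to the basis property *)

Section FromSymbol.
Variables (R : realType) (p : R).
Hypothesis p2 : 2 <= p.
Variables (c b : nat -> R[i]) (f : R -> R[i]).
Hypothesis hf : forall t, 0 < t <= 1 -> exists N, forall M, (N <= M)%N ->
  f t = \sum_(k < M) c k * haarn (2 ^ k) t.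
Hypothesis mc : section_mult p c.
Hypothesis mb : section_mult p b.
Hypothesis cb : cprod c b = @delta0 R.

(** Stability of [P] under doubling lets multiplication by [c] and [b] preserve sequences supported
    on [P]; this treats all positive integers and every [N_d] at once. *)
Lemma equiv_basis_of_symbol (P : pred nat) : (forall n, P n -> (0 < n)%N) ->
  (forall n k, P n -> P (n * 2 ^ k)%N) ->
  equiv_basis p (cspan p (@haarn R) P) (dil f) (@haarn R) P.
Proof.
move=> hP hP2.
have p1 : 1 <= p by have := p2; lra.
have p0 : 0 < p by have := p2; lra.
have mh n : P n -> cmfun (@I01 R) (haarn n) by move=> /hP; exact: cmfun_haarn.
have mf n : P n -> cmfun (@I01 R) (dil f n).
  by move=> /hP n0; apply: haar_series_cmfun; exact: (haar_series_dil hf n0).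
split.
  apply/seteqP; split; apply: cspan_sub => // M a e e0.
    exact: (comb_dil_approx p2 hf mc).
  exact: (comb_haar_approx p2 hf mc mb cb).
have [K K0 hK] := pint_comb_dil_le p2 hf mc.
have [L L0 hL] := pint_comb_dil_ge p2 hf mc mb cb.
have K10 : 0 < K + 1 by rewrite ltr_wpDl.
exists (L `^ p^-1)^-1, ((K + 1) `^ p^-1).
split; first by rewrite invr_gt0 powR_gt0.
split; first by rewrite powR_gt0.
move=> M a; split.
  have := pnorm_le p0 (ltW L0) (hL P M a hP).
  move=> h; rewrite -(@lee_pmul2l _ (L `^ p^-1)%:E) ?lte_fin ?powR_gt0 //.
  by rewrite muleA -EFinM mulfV ?mul1e // gt_eqF ?powR_gt0.
apply: pnorm_le (ltW K10) _ => //; apply: (le_trans (hK P M a hP)).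
by rewrite lee_wpmul2r ?pint_ge0 // lee_fin lerDl.
Qed.

End FromSymbol.

(** * From norm equivalence on the powers of two to the symbol *)

Section SymbolOfEquivalence.
Variables (R : realType) (p : R).
Hypothesis p2 : 2 <= p.
Variables (c : nat -> R[i]) (f : R -> R[i]).
Hypothesis hf : forall t, 0 < t <= 1 -> exists N, forall M, (N <= M)%N ->
  f t = \sum_(k < M) c k * haarn (2 ^ k) t.
Implicit Types (e : R) (xi eta v a : nat -> R[i]).

Local Ltac plra := have := p2; lra.
Let p1 : 1 <= p. Proof. plra. Qed.
Let p0 : 0 < p. Proof. plra. Qed.
Let q0 : 0 < p / 2. Proof. plra. Qed.

Definition pow2 (n : nat) : bool := ones n == 1%N.

Let delta1 (n : nat) : R[i] := (n == 1%N)%:R.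

Lemma pow2_gt0 n : pow2 n -> (0 < n)%N.
Proof. exact: ones_pred_gt0. Qed.

Lemma chain_delta1 m : odd m -> chain delta1 m = if m == 1%N then @delta0 R else (fun _ => 0).
Proof.
move=> om; apply/funext => k; rewrite /chain /delta1.
have [->|m1] := eqVneq m 1%N.
  by rewrite mul1n /delta0; case: k => [|k] //; rewrite expnS; case: eqP => //; lia.
case: eqP => // h; have : (m %| 1)%N by rewrite -h dvdn_mulr.
by rewrite dvdn1 (negPf m1).
Qed.

Lemma wsum_delta0 s r : s != 0 -> wsum s r (@delta0 R) = (0 < r)%N%:R.
Proof.
move=> s0; case: r => [|r]; first by rewrite /wsum big_ord0.
rewrite /wsum big_ord_recl big1 ?addr0 => [|i _]; last first.
  by rewrite [delta0 _ _](_ : _ = 0) // cabs0 powR0 // mul0r.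
by rewrite [delta0 _ _](_ : _ = 1) // cabs1 powR1 expr0 divr1.
Qed.

(** A sequence on the chain [m = 1] is compared with that of [h_1] alone, whose nonempty weighted
    sums all equal 1: the bound [B] then turns into the domination parameter [d]. The factor 2 in
    [d] comes from [wsum2_le_wsum], and [2 <= N] from the support of [delta1]. *)
Lemma tree_norm_chain1 : exists2 C : R, 0 <= C & forall eta B,
  (forall m, odd m -> m != 1%N -> chain eta m = (fun _ => 0)) ->
  (forall r, wsum p r (chain eta 1) <= B) ->
  forall N, (2 <= N)%N -> tree_norm p N eta <= C * B.
Proof.
have [C C0 hC] := tree_norm_dominated p2.
exists (C * 2 `^ (p / 2) * tree_norm p 2 delta1) => [|eta B h0 hB N N2].
  apply: mulr_ge0; last exact: tree_norm_ge0.
  by apply: mulr_ge0 => //; exact: powR_ge0.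
have B0 : 0 <= B by apply: le_trans (hB 0%N); exact: wsum_ge0.
pose d := 2 * B `^ (p / 2)^-1.
have d0 : 0 <= d by rewrite mulr_ge0 // powR_ge0.
have dq : d `^ (p / 2) = 2 `^ (p / 2) * B.
  by rewrite powRM ?powR_ge0 // -powRrM mulVf ?gt_eqF // powRr1.
have hd : chain_dominated p d eta delta1.
  move=> m r om; rewrite chain_delta1 //.
  have [->|m1] := eqVneq m 1%N; last first.
    rewrite h0 //; have z s : s != 0 -> wsum s r (fun _ : nat => (0 : R[i])) = 0.
      by move=> s0; apply: big1 => i _; rewrite cabs0 powR0 // mul0r.
    by rewrite !z ?mulr0 ?pnatr_eq0 // gt_eqF.
  rewrite !wsum_delta0 ?pnatr_eq0 ?gt_eqF //.
  case: r => [|r]; first by rewrite /wsum !big_ord0 !mulr0.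
  rewrite !mulr1; split.
    apply: (le_trans (wsum2_le_wsum p2 _ _)); rewrite /d ler_pM2l //.
    by apply: powR_mono; rewrite ?invr_ge0 ?wsum_ge0 // ltW.
  rewrite dq; apply: (le_trans (hB _)); rewrite ler_peMl //.
  by rewrite -[leLHS](powRr0 (2 : R)) ler_powR ?ltW // ltr1n.
apply: (le_trans (hC _ _ _ N d0 hd)); rewrite dq.
rewrite (@tree_norm_supp _ _ N 2 delta1) //; last first.
  by move=> n n2; rewrite /delta1; case: eqP => // hn; rewrite hn in n2.
by rewrite mulrA mulrAC.
Qed.

Hypothesis bc : bounded_wsum p c.
Variables A B : R.
Hypotheses (A0 : 0 < A) (B0 : 0 < B).
Hypothesis hAB : forall M a,
  (A%:E * pnorm p (comb (@haarn R) pow2 M a) <= pnorm p (comb (dil f) pow2 M a))%E /\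
  (pnorm p (comb (dil f) pow2 M a) <= B%:E * pnorm p (comb (@haarn R) pow2 M a))%E.
Hypothesis happ : forall e, 0 < e -> exists M a,
  (pint p (fun t => haarn 1 t - comb (dil f) (fun n => (0 < n)%N) M a t)%R <= e%:E)%E.

Let seq_coef v (n : nat) := v (trunc_log 2 n).

Lemma chain_pow2 v K m : odd m ->
  chain (restr pow2 (2 ^ K) (seq_coef v)) m = if m == 1%N then trunc K v else (fun _ => 0).
Proof.
move=> om; apply/funext => k; rewrite /chain /restr /pow2 ones_eq1_odd //.
have [->|m1] //= := eqVneq m 1%N.
by rewrite mul1n ltn_exp2l // /seq_coef trunc_expnK.
Qed.

Lemma pint_pow2_le : exists2 C : R, 0 <= C & forall v K,
  (pint p (comb (@haarn R) pow2 (2 ^ K) (seq_coef v)) <= (C * wsum p K v)%:E)%E.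
Proof.
have [C C0 hC] := tree_norm_chain1; exists C => // v K.
have hN : (2 ^ K <= maxn (2 ^ K) 2)%N by exact: leq_maxl.
rewrite (pint_comb_haar p _ pow2_gt0 hN) lee_fin; apply: hC; last by exact: leq_maxr.
  by move=> m om m1; rewrite chain_pow2 // (negPf m1).
move=> r; rewrite chain_pow2 //= -(wsum_trunc p K v).
by apply: wsum_supp; [rewrite gt_eqF | exact: trunc_supp].
Qed.

Lemma pint_pow2_ge v K :
  ((wsum p K v)%:E <= pint p (comb (@haarn R) pow2 (2 ^ K) (seq_coef v)))%E.
Proof.
rewrite (pint_comb_haar p _ pow2_gt0 (leqnn _)) lee_fin.
apply: le_trans (wsum_chain1_le_norm p2 _ _); rewrite chain_pow2 //= -(wsum_trunc p K v).
by apply: wsum_mono; rewrite ltnW // ltn_expl.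
Qed.

Lemma symbol_section_mult : section_mult p c.
Proof.
have [C C0 hC] := pint_pow2_le.
exists (2 `^ p * (B `^ p * C)) => [|v K]; first by rewrite !mulr_ge0 ?powR_ge0.
rewrite -[wsum p K (cprod c v)](_ : wsum p K (cprod c (trunc K v)) = _); last first.
  by apply: eq_wsum => k kK; rewrite cprod_trunc.
pose F := comb (dil f) pow2 (2 ^ K) (seq_coef v).
have h1 : (pint p F <= (B `^ p * (C * wsum p K v))%:E)%E.
  apply: (le_trans (pint_le p0 (ltW B0) (proj2 (hAB _ _)))).
  by rewrite EFinM lee_wpmul2l ?lee_fin ?powR_ge0.
apply/ler_addgt0Pr => e e0.
have e'0 : 0 < e / 2 `^ p by rewrite divr_gt0 ?powR_gt0.
have [N hN] := tree_norm_le_pint p2 bc (@restr_supp _ pow2 (2 ^ K)%N (seq_coef v))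
  (haar_series_comb_dil hf _ _ pow2_gt0) e'0.
have := hN (maxn N K) (leq_maxl _ _).
set eta := tmul c _ => h2.
have h3 := le_trans (wsum_mono p (chain eta 1) (leq_maxr N K)) (wsum_chain1_le_norm p2 _ _).
rewrite /eta chain_tmul // chain_pow2 //= in h3.
have h4 : ((wsum p K (cprod c (trunc K v)))%:E <= (2 `^ p)%:E * (pint p F + (e / 2 `^ p)%:E))%E.
  by apply: le_trans h2; rewrite lee_fin.
have := le_trans h4 (lee_wpmul2l (_ : (0 <= (2 `^ p)%:E)%E) (leeD2r (e / 2 `^ p)%:E h1)).
rewrite lee_fin powR_ge0 => /(_ isT); rewrite -EFinD -EFinM lee_fin => /le_trans; apply.
by rewrite mulrDr [2 `^ p * (e / _)]mulrC divfK ?gt_eqF ?powR_gt0 // !mulrA.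
Qed.

(** The chain [m = 1] of a combination approximating [h_1] is an approximate inverse of [c], because
    the weighted [l^p] sum of that chain in the error is at most the full norm. The lower norm
    estimate, read on the same chain, is the other premise of [section_mult_inverse]. *)
Lemma symbol_section_mult_inverse : exists2 b, cprod c b = @delta0 R & section_mult p b.
Proof.
apply: (section_mult_inverse p2).
  move=> e e0; pose e' := e / (2 `^ p * 2).
  have D0 : 0 < 2 `^ p * 2 :> R by rewrite mulr_gt0 ?powR_gt0.
  have e'0 : 0 < e' by rewrite divr_gt0.
  have [M [a ha]] := happ e'0.
  set P := (fun n : nat => (0 < n)%N) in ha; set F := comb (dil f) P M a in ha.
  have hP n : P n -> (0 < n)%N by [].
  set xi := restr P M a.
  have hxi : forall n, (M <= n)%N -> xi n = 0 by exact: restr_supp.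
  exists (chain xi 1), M; split.
    move=> k Mk; rewrite /chain mul1n hxi // (leq_trans Mk) // ltnW // ltn_expl //.
  move=> K.
  have hF := haar_series_comb_dil hf M a hP; rewrite -/xi -/F in hF.
  have [N hN] := haar_series_remainder p2 bc hxi hF e'0.
  (* The successor ensures [1 < 2^N'], so that [h_1] occurs in the partial sum. *)
  pose N' := (maxn N K).+1.
  have NN' : (N <= N')%N by rewrite /N' ltnW // ltnS leq_maxl.
  have KN' : (K <= N')%N by rewrite /N' ltnW // ltnS leq_maxr.
  have h1 := hN N' NN'.
  pose eta n := delta1 n - tmul c xi n.
  have mh : cmfun (@I01 R) (haarn 1) by exact: cmfun_haarn.
  have mF := haar_series_cmfun hF.
  have mG := cmfun_haar_psum (@I01 R) (tmul c xi) 0 N'.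
  have h2 := pint_triangle p1 mh mF mG ha h1.
  have e1 : haarn 1 = haar_psum delta1 0 N' :> (R -> R[i]).
    apply/funext => t; rewrite haar_psum_comb /delta1.
    have l1 : (1 < 2 ^ N')%N by rewrite (@leq_trans (2 ^ 1)) // leq_exp2l.
    rewrite (bigD1 (Ordinal l1)) //= mul1r big1 ?addr0 // => n /andP[_ hn].
    by rewrite (_ : (n == 1 :> nat)%N = false) ?mul0r //; apply: contraNF hn => /eqP hn; rewrite -val_eqE /= hn.
  have e2 : pint p (fun t => haarn 1 t - haar_psum (tmul c xi) 0 N' t) = (tree_norm p N' eta)%:E.
    rewrite -pint_haar_psum; apply: eq_pint => t _; rewrite e1 /eta haar_psumD; congr (_ + _).
    rewrite -mulN1r -haar_psumZ; congr (haar_psum _ _ _ _).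
    by apply/funext => n; rewrite mulN1r.
  move: h2; rewrite e2 lee_fin => h2.
  have h3 := le_trans (wsum_mono p (chain eta 1) KN') (wsum_chain1_le_norm p2 N' eta).
  have e3 : wsum p K (fun k => cprod c (chain xi 1) k - delta0 R k) = wsum p K (chain eta 1).
    apply: eq_bigr => k _; rewrite -cabsN opprB.
    have -> : chain eta 1 k = chain delta1 1 k - chain (tmul c xi) 1 k by [].
    by rewrite chain_tmul // chain_delta1.
  rewrite e3; apply: (le_trans h3); apply: (le_trans h2).
  by rewrite mulrA /e' [_ * (e / _)]mulrC divfK // gt_eqF.
have [C C0 hC] := tree_norm_chain1.
have A0' : 0 <= A^-1 by rewrite invr_ge0 ltW.
exists (A^-1 `^ p * C) => [|v K E hv hE L]; first by rewrite mulr_ge0 ?powR_ge0.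
have E0 : 0 <= E by apply: le_trans (hE 0%N); exact: wsum_ge0.
apply: (le_trans (wsum_supp L (_ : p != 0) hv)); first by rewrite gt_eqF.
rewrite -lee_fin; apply: (le_trans (pint_pow2_ge v K)).
pose F := comb (dil f) pow2 (2 ^ K) (seq_coef v).
have h1 : (pint p (comb (@haarn R) pow2 (2 ^ K) (seq_coef v)) <= (A^-1 `^ p)%:E * pint p F)%E.
  apply: (pint_le p0 A0'); rewrite -(@lee_pmul2l _ A%:E) ?lte_fin //.
  by rewrite muleA -EFinM mulfV ?gt_eqF // mul1e; exact: (proj1 (hAB _ _)).
apply: (le_trans h1); rewrite -mulrA EFinM lee_wpmul2l ?lee_fin ?powR_ge0 //.
apply: (@pint_haar_series_le _ p _ _ _ 2 (haar_series_comb_dil hf _ _ pow2_gt0)) => N N2.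
apply: hC => //.
  by move=> m om m1; rewrite chain_tmul // chain_pow2 // (negPf m1) cprod0.
move=> r; rewrite chain_tmul // chain_pow2 //=.
rewrite (_ : trunc K v = v) //; apply/funext => k; rewrite /trunc.
by case: ltnP => // /hv ->.
Qed.

End SymbolOfEquivalence.

(** * Mean-zero functions and Haar approximation *)

Section RealImaginaryParts.
Variable R : realType.
Implicit Types (t : R) (l j N : nat) (xi : nat -> R[i]) (g : R -> R[i]).
Local Notation leb := (@lebesgue_measure R).
Local Notation I01 := (@I01 R).

Definition cpart (b : bool) (z : R[i]) : R := if b then complex.Re z else complex.Im z.

Lemma cpartD b (x y : R[i]) : cpart b (x + y) = cpart b x + cpart b y.
Proof. by case: b x y => -[? ?] [? ?]. Qed.

Lemma cpartN b (x : R[i]) : cpart b (- x) = - cpart b x.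
Proof. by case: b x => -[? ?]. Qed.

Lemma cpart_le b (z : R[i]) : `|cpart b z| <= cabs z.
Proof. by case: b; [exact: cabs_Re | exact: cabs_Im]. Qed.

Lemma measurable_cpart b (D : set R) g : cmfun D g ->
  measurable_fun (D : set (measurableTypeR R)) (fun t => (cpart b (g t))%:E).
Proof. by case=> h1 h2; apply/measurable_EFinP; case: b. Qed.

Lemma leb_I01 : leb I01 = 1%:E.
Proof. by rewrite -dyad00 lebesgue_dyad expr0 invr1. Qed.

Lemma integrable_cst_lebesgue (D : set R) (x : R) : measurable (D : set (measurableTypeR R)) ->
  (leb D < +oo)%E -> leb.-integrable D (fun _ => x%:E).
Proof.
move=> mD hD; apply/integrableP; split; first exact: measurable_cst.
rewrite (_ : (\int[_]_(t in _) _)%E = (`|x|%:E * leb D)%E); last by rewrite -integral_cst.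
by rewrite lte_mul_pinfty // lee_fin.
Qed.

Lemma integral_haar_psum_cpart b xi l j r (x : R[i]) : (j < 2 ^ l)%N ->
  (\int[leb]_(t in dyad l j) (cpart b (x + haar_psum xi l r t))%:E)%E =
  (2 ^- l * cpart b x)%:E.
Proof.
elim: r l j x => [|r IH] l j x jl.
  under eq_integral do rewrite /haar_psum big_ord0 addr0.
  rewrite integral_cst; last exact: measurable_dyad.
  by rewrite [X in (_ * X)%E](lebesgue_dyad R l j) -EFinM /= mulrC.
have jl2 : (j.*2.+1 < 2 ^ l.+1)%N by rewrite expnS; lia.
have jl1 : (j.*2 < 2 ^ l.+1)%N by rewrite ltnW.
rewrite dyadS integral_setU.
- have -> : (\int[leb]_(t in dyad l.+1 j.*2) (cpart b (x + haar_psum xi l r.+1 t))%:E)%E =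
    (\int[leb]_(t in dyad l.+1 j.*2) (cpart b (x + xi (2 ^ l + j)%N + haar_psum xi l.+1 r t))%:E)%E.
    apply: eq_integral => t; rewrite mem_dyad => ht.
    have h : indyad l j t by rewrite indyadS ht.
    by rewrite haar_psumS (haar_levelE _ jl h) haarnE // ht mulr1 addrA.
  have -> : (\int[leb]_(t in dyad l.+1 j.*2.+1) (cpart b (x + haar_psum xi l r.+1 t))%:E)%E =
    (\int[leb]_(t in dyad l.+1 j.*2.+1) (cpart b (x - xi (2 ^ l + j)%N + haar_psum xi l.+1 r t))%:E)%E.
    apply: eq_integral => t; rewrite mem_dyad => ht.
    have h : indyad l j t by rewrite indyadS ht orbT.
    have hl : indyad l.+1 j.*2 t = false.
      by apply/negP => h'; have := indyad_uniq ht h'; lia.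
    by rewrite haar_psumS (haar_levelE _ jl h) haarnE // hl ht mulrN1 addrA.
  rewrite (IH _ _ _ jl1) (IH _ _ _ jl2) -EFinD /=.
  congr _%:E; rewrite !cpartD cpartN exprS; field.
  by rewrite expf_neq0.
- exact: measurable_dyad.
- exact: measurable_dyad.
- by apply: measurable_cpart; apply: cmfunD; [exact: cmfun_cst | exact: cmfun_haar_psum].
- exact: dyadS_disj.
Qed.

Lemma haar_psum_mean0 b xi N :
  (\int[leb]_(t in I01) (cpart b (haar_psum xi 0 N t))%:E)%E = 0%E.
Proof.
have := @integral_haar_psum_cpart b xi 0 0 N 0 isT.
rewrite dyad00 (_ : cpart b 0 = 0) ?mulr0; last by case: b.
move=> h; rewrite -[RHS]/(0%:E) -h.
by apply: eq_integral => t _; rewrite add0r.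
Qed.

End RealImaginaryParts.

Section Means.
Variables (R : realType) (p : R).
Hypothesis p1 : 1 <= p.
Implicit Types (t e : R) (l j k m n N M : nat) (xi : nat -> R[i]) (g h : R -> R[i]).
Local Notation leb := (@lebesgue_measure R).
Local Notation I01 := (@I01 R).

Let p0 : 0 < p. Proof. by have := p1; lra. Qed.
Let mI : measurable (I01 : set (measurableTypeR R)) := @measurable_I01 R.

Lemma integrable_cpart b g : cmfun I01 g -> (pint p g < +oo)%E ->
  leb.-integrable I01 (fun t => (cpart b (g t))%:E).
Proof.
move=> mg hg.
have ig : leb.-integrable I01 (fun t => (1 + cabs (g t) `^ p)%:E).
  have i1 : leb.-integrable I01 (fun t : R => 1%:E).
    by apply: integrable_cst_lebesgue => //; rewrite leb_I01 ltry.
  have i2 : leb.-integrable I01 (fun t => (cabs (g t) `^ p)%:E).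
    apply/integrableP; split; first exact: measurable_cabs_powR.
    rewrite (_ : (\int[_]_(x in _) _)%E = pint p g) //; apply: eq_integral => t _.
    by rewrite gee0_abs // lee_fin powR_ge0.
  exact: (integrableD mI i1 i2).
apply: (le_integrable mI _ _ ig); first exact: measurable_cpart.
move=> t _ /=; rewrite !lee_fin; apply: (le_trans (cpart_le b _)).
rewrite ger0_norm ?addr_ge0 ?powR_ge0 //.
have [h|h] := leP (cabs (g t)) 1; first by rewrite (le_trans h) // lerDl powR_ge0.
by apply: (le_trans (le1r_powR (ltW h) p1)); rewrite lerDr.
Qed.

(** A substitute for Hölder's inequality by splitting at height [e]: where [|g| > e], one has
    [|g| <= e^(1-p) |g|^p]. *)
Lemma integral_cabs_le g e : cmfun I01 g -> 0 < e ->
  (\int[leb]_(t in I01) (cabs (g t))%:E <= e%:E + (e `^ (1 - p))%:E * pint p g)%E.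
Proof.
move=> mg e0.
have -> : (e%:E = \int[leb]_(t in I01) (e%:E))%E.
  by rewrite integral_cst // [X in (_ * X)%E]leb_I01 mule1.
rewrite /pint -ge0_integralZl_EFin ?powR_ge0 //; last 2 first.
- by move=> t _; rewrite lee_fin powR_ge0.
- exact: measurable_cabs_powR.
have mZ : measurable_fun (I01 : set (measurableTypeR R))
    (fun t => ((e `^ (1 - p))%:E * (cabs (g t) `^ p)%:E)%E).
  by apply: measurable_funeM; exact: measurable_cabs_powR.
rewrite -ge0_integralD //; last 2 first.
- by move=> t _; rewrite lee_fin ltW.
- by move=> t _; rewrite -EFinM lee_fin mulr_ge0 ?powR_ge0.
apply: ge0_le_integral => //.
- by move=> t _; rewrite lee_fin cabs_ge0.
- by apply/measurable_EFinP; exact: measurable_cabs.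
- by apply: emeasurable_funD.
move=> t _; rewrite -EFinM -EFinD lee_fin; have := cabs_ge0 (g t); set y := cabs _ => y0.
have [h|h] := leP y e; first by rewrite (le_trans h) // lerDl mulr_ge0 ?powR_ge0.
apply: (@le_trans _ _ (e `^ (1 - p) * y `^ p)); last by rewrite lerDr ltW.
have yp : 0 < y by exact: lt_trans h.
have -> : 1 - p = - (p - 1) by ring.
rewrite powRN mulrC ler_pdivlMr ?powR_gt0 //.
have -> : y `^ p = y * y `^ (p - 1) by rewrite mulr_powRB1.
rewrite ler_wpM2l //; apply: powR_mono; [by have := p1; lra | exact: ltW | exact: ltW].
Qed.

Lemma cpart_mean_close b g h e : cmfun I01 g -> cmfun I01 h ->
  (pint p g < +oo)%E -> (pint p h < +oo)%E -> 0 < e ->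
  (pint p (fun t => g t - h t)%R <= (e `^ p)%:E)%E ->
  (`|\int[leb]_(t in I01) (cpart b (g t))%:E - \int[leb]_(t in I01) (cpart b (h t))%:E| <= (2 * e)%:E)%E.
Proof.
move=> mg mh fg fh e0 he.
have ig := integrable_cpart b mg fg; have ih := integrable_cpart b mh fh.
have mgh := cmfunB mg mh.
have -> : (\int[leb]_(t in I01) (cpart b (g t))%:E - \int[leb]_(t in I01) (cpart b (h t))%:E =
    \int[leb]_(t in I01) (cpart b (g t - h t))%:E)%E.
  rewrite -integralB_EFin //; apply: eq_integral => t _.
  by rewrite cpartD cpartN EFinB.
apply: (le_trans (le_abse_integral _ mI (measurable_cpart b mgh))).
apply: (@le_trans _ _ (\int[leb]_(t in I01) (cabs (g t - h t)%R)%:E)%E).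
  apply: ge0_le_integral => //.
  - by apply: measurableT_comp => //; exact: measurable_cpart.
  - by apply/measurable_EFinP; exact: measurable_cabs.
  - by move=> t _; rewrite /= lee_fin cpart_le.
apply: (le_trans (integral_cabs_le mgh e0)).
have h1 : ((e `^ (1 - p))%:E * pint p (fun t => g t - h t)%R <= e%:E)%E.
  apply: (@le_trans _ _ ((e `^ (1 - p))%:E * (e `^ p)%:E)%E).
    by apply: lee_wpmul2l => //; rewrite lee_fin powR_ge0.
  rewrite -EFinM lee_fin -powRD ?subrK ?powRr1 ?(ltW e0) //.
  by rewrite gt_eqF ?implybT.
have -> : 2 * e = e + e by ring.
by rewrite EFinD leeD2l.
Qed.

Lemma cpart_mean0_of_approx b g : cmfun I01 g -> (pint p g < +oo)%E ->
  (forall e, 0 < e -> exists N xi, (pint p (fun t => g t - haar_psum xi 0 N t)%R <= e%:E)%E) ->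
  (\int[leb]_(t in I01) (cpart b (g t))%:E)%E = 0%E.
Proof.
move=> mg fg happ.
have ig := integrable_cpart b mg fg.
have hfin := integrable_fin_num mI ig.
apply/eqP; rewrite -abse_eq0 eq_le abse_ge0 andbT.
apply/lee_addgt0Pr => e e0; rewrite add0e.
have e2 : 0 < e / 2 by rewrite divr_gt0.
have [N [xi hxi]] := happ _ (powR_gt0 p e2).
have fh : (pint p (haar_psum xi 0 N) < +oo)%E by rewrite pint_haar_psum ltry.
have := cpart_mean_close b mg (cmfun_haar_psum I01 xi 0 N) fg fh e2 hxi.
by rewrite haar_psum_mean0 sube0 mulrC divfK.
Qed.

End Means.

(** * Partial sums as conditional expectations *)

Section CoefficientBound.
Variables (R : realType) (p : R).
Hypothesis p2 : 2 <= p.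
Variables (c : nat -> R[i]) (f : R -> R[i]).
Hypothesis hf : forall t, 0 < t <= 1 -> exists N, forall M, (N <= M)%N ->
  f t = \sum_(k < M) c k * haarn (2 ^ k) t.
Hypothesis Lf : Lp p f.
Local Notation leb := (@lebesgue_measure R).
Local Notation I01 := (@I01 R).
Hypothesis mean0 : forall b, (\int[leb]_(t in I01) (cpart b (f t))%:E)%E = 0%E.

Let p1 : 1 <= p. Proof. by have := p2; lra. Qed.
Let p0 : 0 < p. Proof. by have := p2; lra. Qed.
Let mI : measurable (I01 : set (measurableTypeR R)) := @measurable_I01 R.

(** The supporting plane of [|.|^p] at [s], which integrates to Jensen's inequality for complex
    values. *)
Lemma cabs_powR_tangent (s y : R[i]) :
  cabs s `^ p + p * cabs s `^ (p - 2) * (cip s y - cabs s ^+ 2) <= cabs y `^ p.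
Proof.
have a0 := cabs_ge0 s; have b0 := cabs_ge0 y.
have h := powR_tangent p1 b0 a0.
have hc := le_trans (ler_norm _) (cip_le s y).
have p20 : 0 <= p - 2 by have := p2; lra.
have e1 : cabs s `^ (p - 1) = cabs s `^ (p - 2) * cabs s.
  by rewrite -powRS //; congr (_ `^ _); ring.
rewrite e1 in h.
have h2 : p * cabs s `^ (p - 2) * (cip s y - cabs s ^+ 2) <=
    p * cabs s `^ (p - 2) * (cabs s * cabs y - cabs s ^+ 2).
  by rewrite ler_wpM2l ?mulr_ge0 ?powR_ge0 ?(ltW p0) // lerD2r.
have e2 : p * (cabs s `^ (p - 2) * cabs s) * (cabs s - cabs y) =
    - (p * cabs s `^ (p - 2) * (cabs s * cabs y - cabs s ^+ 2)) by ring.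
rewrite e2 in h; lra.
Qed.

Lemma dyad_sub_I01 N : dyad N 0 `<=` I01.
Proof.
move=> t /dyadP; rewrite /indyad mul0r => /andP[h1 h2]; apply/mem_I01.
by rewrite h1 (le_trans h2) // ler_pdivrMr ?exprn_gt0 // mul1r exprn_ege1 // ler1n.
Qed.

(** Off [J = (0, 2^(-N)]] the remaining functions vanish and the partial sum equals [f]. On [J] it
    is a constant [s]; both functions have mean zero, so [s] is the average of [f] over [J], and
    Jensen's inequality applies there. *)
Lemma pint_partial_sum_le N :
  (pint p (fun t => \sum_(k < N) c k * haarn (2 ^ k) t)%R <= pint p f)%E.
Proof.
have [mf ff] := (LpP p1 f).1 Lf.
set fN := fun t => _.
pose s : R[i] := \sum_(k < N) c k.
pose J : set R := dyad N 0; pose J' : set R := I01 `\` J.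
have mJ : measurable (J : set (measurableTypeR R)) := @measurable_dyad R N 0.
have mJ' : measurable (J' : set (measurableTypeR R)) by exact: measurableD.
have JI : J `<=` I01 := @dyad_sub_I01 N.
have eU : I01 = J' `|` J by rewrite /J' setUC setDUK.
have dJ : [disjoint J' & J] by rewrite disj_set2E /J' setDE -setIA setICl setI0.
have fN_J t : J t -> fN t = s.
  move=> /dyadP; rewrite /indyad mul0r => /andP[t0 tN]; apply: eq_bigr => k _.
  rewrite -[(2 ^ k)%N]addn0 haarnE ?expn_gt0 // ifT ?mulr1 //.
  rewrite /indyad mul0r t0 /= (le_trans tN) //.
  by rewrite !mul1r lef_pV2 ?posrE ?exprn_gt0 // ler_eXn2l ?ltr1n.
have fN_J' t : J' t -> fN t = f t.
  move=> [/mem_I01 t01 tJ]; have [M hM] := hf t01.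
  rewrite (hM (N + M)%N) ?leq_addl // big_split_ord /= [X in _ = _ + X]big1 ?addr0 // => i _.
  rewrite -[(2 ^ _)%N]addn0 haarn_out ?mulr0 ?expn_gt0 //; apply/negP => h; apply: tJ.
  apply/dyadP; move: h; rewrite /indyad !mul0r => /andP[-> /= h]; apply: (le_trans h).
  by rewrite !mul1r lef_pV2 ?posrE ?exprn_gt0 // ler_eXn2l ?ltr1n // leq_addr.
have efN : fN = haar_psum (restr pow2 (2 ^ N) (fun n => c (trunc_log 2 n))) 0 N.
  apply/funext => t; rewrite -(comb_haar_psum _ _ pow2_gt0 (leqnn _)).
  rewrite -[RHS](comb_pow2 (@haarn R) N c t) /fN /comb.
  by apply: eq_bigr.
have mfN : cmfun I01 fN by rewrite efN; exact: cmfun_haar_psum.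
have ffN : (pint p fN < +oo)%E by rewrite efN pint_haar_psum ltry.
have split_int (g : R -> \bar R) : measurable_fun (I01 : set (measurableTypeR R)) g ->
    (\int[leb]_(t in I01) g t = \int[leb]_(t in J') g t + \int[leb]_(t in J) g t)%E.
  by move=> mg; rewrite eU; apply: integral_setU => //; rewrite -eU.
have hmean b : (\int[leb]_(t in J) (cpart b (f t))%:E = (2 ^- N * cpart b s)%:E)%E.
  have h1 := split_int _ (measurable_cpart b mf); rewrite mean0 in h1.
  have h2 := split_int _ (measurable_cpart b mfN).
  rewrite [LHS](_ : _ = 0%E) in h2; last by rewrite efN haar_psum_mean0.
  have e1 : (\int[leb]_(t in J) (cpart b (fN t))%:E = (2 ^- N * cpart b s)%:E)%E.
    have -> : (\int[leb]_(t in J) (cpart b (fN t))%:E = \int[leb]_(t in J) (cpart b s)%:E)%E.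
      by apply: eq_integral => t; rewrite inE => /fN_J ->.
    by rewrite integral_cst // [X in (_ * X)%E](lebesgue_dyad R N 0) -EFinM mulrC.
  have e2 : (\int[leb]_(t in J') (cpart b (fN t))%:E = \int[leb]_(t in J') (cpart b (f t))%:E)%E.
    by apply: eq_integral => t; rewrite inE => /fN_J' ->.
  rewrite e1 e2 in h2.
  have iJ' := integrableS mI mJ' (@subDsetl _ _ _) (integrable_cpart p1 b mf ff).
  have iJ := integrableS mI mJ JI (integrable_cpart p1 b mf ff).
  have := integrable_fin_num mJ' iJ'; have := integrable_fin_num mJ iJ.
  move: h1 h2; case: (integral leb J' _) => [x| |] //; case: (integral leb J _) => [y| |] //.
  by rewrite -!EFinD => -[h1] [h2] _ _; congr _%:E; lra.
rewrite /pint (split_int _ (measurable_cabs_powR p mf)) (split_int _ (measurable_cabs_powR p mfN)).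
have -> : (\int[leb]_(t in J') (cabs (fN t) `^ p)%:E = \int[leb]_(t in J') (cabs (f t) `^ p)%:E)%E.
  by apply: eq_integral => t; rewrite inE => /fN_J' ->.
rewrite leeD2l //.
have -> : (\int[leb]_(t in J) (cabs (fN t) `^ p)%:E = (2 ^- N * cabs s `^ p)%:E)%E.
  have -> : (\int[leb]_(t in J) (cabs (fN t) `^ p)%:E = \int[leb]_(t in J) (cabs s `^ p)%:E)%E.
    by apply: eq_integral => t; rewrite inE => /fN_J ->.
  by rewrite integral_cst // [X in (_ * X)%E](lebesgue_dyad R N 0) -EFinM mulrC.
pose A := p * cabs s `^ (p - 2).
pose k0 := cabs s `^ p - A * cabs s ^+ 2.
have iJ b := integrableS mI mJ JI (integrable_cpart p1 b mf ff).
(* The supporting plane at [s], evaluated at [f t]. Its first-order part has mean zero on [J], so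
   its integral is [2^(-N) |s|^p]. *)
pose L t := (k0%:E + ((A * cpart true s)%:E * (cpart true (f t))%:E + (A * cpart false s)%:E * (cpart false (f t))%:E))%E.
have i0 : leb.-integrable J (fun _ : R => k0%:E).
  by apply: integrable_cst_lebesgue => //; rewrite lebesgue_dyad ltry.
have i1 := integrableZl mJ (A * cpart true s) (iJ true).
have i2 := integrableZl mJ (A * cpart false s) (iJ false).
have iL : leb.-integrable J L by apply: integrableD => //; exact: integrableD.
have <- : (\int[leb]_(t in J) L t = (2 ^- N * cabs s `^ p)%:E)%E.
  rewrite /L integralD //; last exact: integrableD.
  rewrite integralD // integralZl // integralZl // !hmean integral_cst //.
  rewrite [X in (_ * X + _)%E](lebesgue_dyad R N 0) -!EFinM -!EFinD; congr _%:E.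
  have := sqr_cabs s; rewrite /k0 /cpart => ->; ring.
apply: le_integral => //.
  have := integrableS mI mJ JI; apply.
  apply/integrableP; split; first exact: measurable_cabs_powR.
  rewrite (_ : (\int[_]_(x in _) _)%E = pint p f) //; apply: eq_integral => t _.
  by rewrite gee0_abs // lee_fin powR_ge0.
move=> t _; rewrite /L -!EFinM -!EFinD lee_fin.
apply: le_trans (cabs_powR_tangent s (f t)).
rewrite le_eqVlt; apply/orP; left; apply/eqP.
rewrite /k0 /A /cip /cpart; ring.
Qed.

Lemma bounded_wsum_of_Lp : bounded_wsum p c.
Proof.
have [mf ff] := (LpP p1 f).1 Lf.
have hfin : pint p f \is a fin_num by rewrite ge0_fin_numE // pint_ge0.
exists (fine (pint p f)) => K; rewrite -lee_fin fineK //.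
apply: le_trans (pint_partial_sum_le K).
apply: (le_trans (pint_pow2_ge p2 c K)).
rewrite le_eqVlt; apply/orP; left; apply/eqP; apply: eq_pint => t _.
rewrite -[LHS](comb_pow2 (@haarn R) K c t) /comb.
by apply: eq_bigr.
Qed.

End CoefficientBound.

(** * Density of Haar sums by dyadic averaging *)

Section DyadicAverages.
Variable R : realType.
Implicit Types (t x : R) (l j n N : nat).
Local Notation leb := (@lebesgue_measure R).
Local Notation I01 := (@I01 R).

Fixpoint address n x : nat := if n is n'.+1 then
  (if indyad n (address n' x).*2 x then (address n' x).*2 else (address n' x).*2.+1) else 0%N.

Lemma addressP n x : 0 < x <= 1 -> (address n x < 2 ^ n)%N /\ indyad n (address n x) x.
Proof.
move=> x01; elim: n => [|n [IH1 IH2]]; first by rewrite indyad00.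
rewrite [address _ _]/=; move: IH2; rewrite indyadS expnS.
by case: ifP => [h _|_ /= h]; split=> //; lia.
Qed.

Variable u : R -> R.
Hypothesis mu : measurable_fun setT (u : measurableTypeR R -> measurableTypeR R).
Variable M : R.
Hypothesis uM : forall x, `|u x| <= M.
Hypothesis u0 : forall x, ~ I01 x -> u x = 0.

Definition dyad_avg l j : R := 2 ^+ l * fine (\int[leb]_(y in dyad l j) (u y)%:E).

Lemma integrable_dyad l j : leb.-integrable (dyad l j) (fun y => (u y)%:E).
Proof.
have md := @measurable_dyad R l j.
have hfin : (leb (dyad l j) < +oo)%E by rewrite lebesgue_dyad ltry.
apply: (le_integrable md _ _ (integrable_cst_lebesgue M md hfin)).
  by apply/measurable_EFinP; exact: measurable_funTS.
by move=> x _; rewrite /= lee_fin (le_trans (uM x)) // ler_norm.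
Qed.

Lemma dyad_avgE l j : (\int[leb]_(y in dyad l j) (u y)%:E = (2 ^- l * dyad_avg l j)%:E)%E.
Proof.
have h2 : 2 ^+ l != 0 :> R by rewrite expf_neq0.
rewrite /dyad_avg mulrA mulVf // mul1r fineK //.
exact: (integrable_fin_num (@measurable_dyad R l j) (integrable_dyad l j)).
Qed.

Lemma dyad_avgS l j : dyad_avg l j = (dyad_avg l.+1 j.*2 + dyad_avg l.+1 j.*2.+1) / 2.
Proof.
have := dyad_avgE l j; rewrite dyadS integral_setU.
- rewrite !dyad_avgE -EFinD => -[] h.
  have h2 : 2 ^+ l != 0 :> R by rewrite expf_neq0.
  apply: (mulfI (invr_neq0 h2)); rewrite -h exprS; field.
  by rewrite h2.
- exact: measurable_dyad.
- exact: measurable_dyad.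
- by apply/measurable_EFinP; exact: measurable_funTS.
- exact: dyadS_disj.
Qed.

Lemma dyad_avg_le l j : `|dyad_avg l j| <= M.
Proof.
have md := @measurable_dyad R l j.
have mud : measurable_fun (dyad l j : set (measurableTypeR R)) (fun y => (u y)%:E).
  by apply/measurable_EFinP; exact: measurable_funTS.
have h := le_abse_integral leb md mud; rewrite dyad_avgE in h.
have h2 : (\int[leb]_(y in dyad l j) `|(u y)%:E| <= \int[leb]_(y in dyad l j) M%:E)%E.
  apply: ge0_le_integral => //.
  - by apply: measurableT_comp.
  - by move=> y _; rewrite /= lee_fin.
have := le_trans h h2.
rewrite integral_cst // [X in (_ * X)%E](lebesgue_dyad R l j) -EFinM /= lee_fin.
by rewrite normrM ger0_norm ?invr_ge0 ?exprn_ge0 // mulrC ler_pM2r //.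
Qed.

(** Lebesgue's differentiation theorem for nicely shrinking sets: the dyadic interval around [x]
    lies in the ball of radius [2^(-n)] and has half its measure. *)
Lemma dyad_avg_cvg : {ae leb, forall x, I01 x -> dyad_avg n (address n x) @[n --> \oo] --> u x}.
Proof.
(* Nice shrinking is required at every real [x], so balls are taken outside [(0,1]]. *)
pose E x n := if x \in I01 then dyad n (address n x) else ball x (2^-1 ^+ n).
have pn n : 0 < 2^-1 ^+ n :> R by rewrite exprn_gt0 // invr_gt0.
have hE x : nicely_shrinking x (E x).
  split=> [n|].
    by rewrite /E; case: ifP => _; [exact: measurable_dyad | exact: measurable_ball].
  exists (2, fun n => PosNum (pn n)); split => //=.
  - by apply: cvg_expr; rewrite ger0_norm ?invr_ge0 // invf_lt1 ?ltr1n.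
  - move=> n; rewrite /E; case: ifPn => [/set_mem /mem_I01 x01 y /dyadP hy|_ y //].
    have [_ hx] := addressP n x01.
    have e1 : (address n x).+1%:R / 2 ^+ n = (address n x)%:R / 2 ^+ n + 2^-1 ^+ n :> R.
      by rewrite -natr1 mulrDl mul1r exprVn.
    move: hx hy; rewrite /indyad e1 => /andP[h1 h2] /andP[h3 h4].
    rewrite /ball /= ltr_norml; apply/andP; split; lra.
  move=> n; rewrite lebesgue_measure_ball ?(ltW (pn n)) //.
  rewrite /E; case: ifP => _.
    rewrite [X in (_ <= _ * X)%E](lebesgue_dyad R n (address n x)) -EFinM lee_fin /=.
    by rewrite exprVn -[_ *+ 2]mulr_natl lexx.
  rewrite [X in (_ <= _ * X)%E](lebesgue_measure_ball _ (ltW (pn n))) -EFinM lee_fin.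
  by rewrite ler_peMl ?ler1n // mulrn_wge0 // ltW.
have iu : leb.-integrable setT (EFin \o u).
  rewrite (_ : EFin \o u = (EFin \o u) \_ I01); last first.
    apply/funext => x; rewrite /patch; case: ifPn => // /negP h; rewrite /= u0 //.
    by move=> h'; apply: h; rewrite inE.
  rewrite -(integrable_mkcond _ (@measurable_I01 R)) -dyad00; exact: integrable_dyad.
have li : locally_integrable setT u by apply: open_integrable_locally => //; exact: openT.
have := lebesgue_differentiation li.
apply: filterS; first exact: (ae_filter_ringOfSetsType leb).
move=> x hx Ix.
have := nice_lebesgue_differentiation hE li hx.
have -> : (fun n => (leb (E x n))^-1 * \int[leb]_(y in E x n) (u y)%:E)%E =
    (fun n => (dyad_avg n (address n x))%:E).
  apply/funext => n; rewrite /E mem_set //.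
  rewrite [X in (X^-1 * _)%E](lebesgue_dyad R n (address n x)) dyad_avgE.
  have h2 : 2 ^+ n != 0 :> R by rewrite expf_neq0.
  by rewrite inver gt_eqF ?invr_gt0 ?exprn_gt0 // invrK -EFinM mulrA mulfV // mul1r.
by move=> /fine_cvgP [_ h]; exact: h.
Qed.

End DyadicAverages.

Section HaarDensity.
Variables (R : realType) (p : R).
Hypothesis p1 : 1 <= p.
Implicit Types (t e : R) (l j n N : nat).
Local Notation leb := (@lebesgue_measure R).
Local Notation I01 := (@I01 R).

Let p0 : 0 < p. Proof. by have := p1; lra. Qed.
Let mI : measurable (I01 : set (measurableTypeR R)) := @measurable_I01 R.

Section Bounded.
Variables (G : R -> R[i]) (M : R).
Hypothesis mG : cmfun I01 G.
Hypothesis GM : forall t, cabs (G t) <= M.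

Let u b t : R := if t \in I01 then cpart b (G t) else 0.

Let mu b : measurable_fun setT (u b : measurableTypeR R -> measurableTypeR R).
Proof.
have h : measurable_fun (I01 : set (measurableTypeR R)) (fun t => cpart b (G t) : measurableTypeR R).
  by have /measurable_EFinP := measurable_cpart b mG.
exact: ((measurable_restrictT _ mI).1 h).
Qed.

Let uM b t : `|u b t| <= M.
Proof.
rewrite /u; case: ifP => _; first by rewrite (le_trans (cpart_le b _)).
by rewrite normr0 (le_trans (cabs_ge0 (G t))).
Qed.

Let u0 b t : ~ I01 t -> u b t = 0.
Proof. by move=> h; rewrite /u; case: ifPn => // /set_mem. Qed.

Definition cavg l j : R[i] := (dyad_avg (u true) l j +i* dyad_avg (u false) l j)%C.

Lemma cpart_cavg b l j : cpart b (cavg l j) = dyad_avg (u b) l j.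
Proof. by case: b. Qed.

Lemma integral_cpart_cavg b :
  (\int[leb]_(t in I01) (cpart b (G t))%:E = (cpart b (cavg 0 0))%:E)%E.
Proof.
have := dyad_avgE (mu b) (uM b) 0 0; rewrite expr0 invr1 mul1r -cpart_cavg => <-.
rewrite dyad00; apply: eq_integral => t It; by rewrite /u It.
Qed.

Lemma cavgS l j : cavg l.+1 j.*2.+1 = cavg l j *+ 2 - cavg l.+1 j.*2.
Proof.
have h b := dyad_avgS (mu b) (uM b) l j.
apply/eqP; rewrite eq_complex /= h (h false).
by apply/andP; split; apply/eqP; field.
Qed.

(** The jump of the average from an interval to its left half; with this choice the partial sums
    telescope to the dyadic average minus the mean. *)
Definition haar_coef n : R[i] :=
  let l := trunc_log 2 n in let j := (n - 2 ^ l)%N in cavg l.+1 j.*2 - cavg l j.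

Lemma haar_psum_coef N t : 0 < t <= 1 ->
  haar_psum haar_coef 0 N t = cavg N (address N t) - cavg 0 0.
Proof.
move=> t01; elim: N => [|N IH]; first by rewrite /haar_psum big_ord0 subrr.
rewrite /haar_psum big_ord_recr /= -/(haar_psum haar_coef 0 N t) IH.
have [jN hj] := addressP N t01.
rewrite (haar_levelE _ jN hj) haarnE // /haar_coef trunc_log_node // addKn.
case: ifP => h; first by rewrite mulr1; ring.
have -> : indyad N.+1 (address N t).*2.+1 t by move: hj; rewrite indyadS h.
by rewrite cavgS; ring.
Qed.

Lemma haar_dense_bounded e : 0 < e -> exists N xi,
  (pint p (fun t => G t - (cavg 0 0 + haar_psum xi 0 N t))%R <= e%:E)%E.
Proof.
move=> e0.
pose F N t := G t - (cavg 0 0 + haar_psum haar_coef 0 N t).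
have mF N : cmfun I01 (F N).
  apply: cmfunB => //; apply: cmfunD; [exact: cmfun_cst | exact: cmfun_haar_psum].
have FE N t : 0 < t <= 1 -> F N t = G t - cavg N (address N t).
  by move=> t01; rewrite /F haar_psum_coef //; ring.
have M0 : 0 <= M by apply: le_trans (GM 0); exact: cabs_ge0.
(* One [M] for [G] and one for each of the real and imaginary parts of the average. *)
have FM N t : 0 < t <= 1 -> cabs (F N t) <= 3 * M.
  move=> t01; rewrite FE //; apply: (le_trans (cabsB _ _)).
  have h1 := GM t; have h2 := cabs_le_ReIm (cavg N (address N t)).
  have h3 := dyad_avg_le (mu true) (uM true) N (address N t).
  have h4 := dyad_avg_le (mu false) (uM false) N (address N t).
  apply: (le_trans (lerD h1 (le_trans h2 (lerD h3 h4)))).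
  by rewrite (_ : 3 * M = M + (M + M)) //; ring.
pose f_ N t := (cabs (F N t) `^ p)%:E.
have cvg0 : {ae leb, forall t, I01 t -> f_ ^~ t @ \oo --> 0%E}.
  have h1 := dyad_avg_cvg (mu true) (uM true) (u0 true).
  have h2 := dyad_avg_cvg (mu false) (uM false) (u0 false).
  move: h1 h2; apply: filterS2; first exact: (ae_filter_ringOfSetsType leb).
  move=> t h1 h2 It; have t01 := (mem_I01 t).1 It.
  have c1 := h1 It; have c2 := h2 It.
  have e1 : u true t = complex.Re (G t) by rewrite /u mem_set.
  have e2 : u false t = complex.Im (G t) by rewrite /u mem_set.
  rewrite e1 in c1; rewrite e2 in c2.
  pose w n := `|complex.Re (G t) - dyad_avg (u true) n (address n t)| +
              `|complex.Im (G t) - dyad_avg (u false) n (address n t)|.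
  have cw : w n @[n --> \oo] --> (0 : R).
    rewrite -[X in _ --> X](addr0 0); apply: cvgD.
      rewrite -(normr0 R) -(subrr (complex.Re (G t))); apply: cvg_norm.
      by apply: cvgB => //; exact: cvg_cst.
    rewrite -(normr0 R) -(subrr (complex.Im (G t))); apply: cvg_norm.
    by apply: cvgB => //; exact: cvg_cst.
  apply: cvg_EFin.
    by apply: nearW => n.
  apply: (squeeze_cvgr _ (cvg_cst 0) cw).
  (* Once [w n < 1], the [p]-th power of the error is at most the error itself, which [w n]
     bounds. *)
  have : \forall n \near \oo, `|0 - w n| < 1.
    by move/cvgrPdist_lt : cw; apply.
  apply: filterS => n; rewrite sub0r normrN => wn.
  rewrite /f_ /= powR_ge0 /=.
  have le1 : cabs (F n t) <= w n.
    rewrite FE //; apply: (le_trans (cabs_le_ReIm _)).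
    by rewrite /w; case: (G t).
  have w1 := le_lt_trans (ler_norm _) wn.
  have [z|z] := eqVneq (cabs (F n t)) 0.
    by rewrite z powR0 ?gt_eqF //; exact: le_trans (cabs_ge0 _) le1.
  apply: le_trans le1; apply: ge1r_powR => //.
  rewrite lt_neqAle eq_sym z cabs_ge0 /= (le_trans _ (ltW w1)) //.
  rewrite FE //; apply: (le_trans (cabs_le_ReIm _)).
  by rewrite /w; case: (G t).
have dom : {ae leb, forall t N, I01 t -> (`|f_ N t| <= ((3 * M) `^ p)%:E)%E}.
  apply: aeW => t N /mem_I01 t01; rewrite gee0_abs ?lee_fin ?powR_ge0 //.
  by apply: powR_mono; [exact: ltW | exact: cabs_ge0 | exact: FM].
have mf_ N : measurable_fun (I01 : set (measurableTypeR R)) (f_ N) by exact: measurable_cabs_powR.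
have ic : leb.-integrable I01 (fun _ => ((3 * M) `^ p)%:E).
  by apply: integrable_cst_lebesgue => //; rewrite leb_I01 ltry.
have [_ _ hlim] := @dominated_convergence _ _ _ leb I01 mI f_ (fun=> 0%E) _ mf_
  (measurable_cst _) cvg0 ic dom.
rewrite integral0 in hlim.
have [N _ hN] : \forall N \near \oo, (\int[leb]_(t in I01) f_ N t <= e%:E)%E.
  have : \forall N \near \oo, (\int[leb]_(t in I01) f_ N t < e%:E)%E.
    have ho : open_nbhs 0%E [set y : \bar R | (y < e%:E)%E].
      by split; [exact: open_ereal_lt_ereal | rewrite /= lte_fin].
    exact: (hlim _ (open_nbhs_nbhs ho)).
  by apply: filterS => n /ltW.
by exists N, haar_coef; exact: (hN N (leqnn N)).
Qed.

End Bounded.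

Lemma cmfun_truncate g (x : R) : cmfun I01 g ->
  cmfun I01 (fun t => if cabs (g t) <= x then g t else 0).
Proof.
move=> mg; have mb : measurable_fun (I01 : set (measurableTypeR R)) (fun t => cabs (g t) <= x).
  apply: measurable_fun_ler; [exact: measurable_cabs | exact: measurable_cst].
have [m1 m2] := mg.
split.
  rewrite (_ : (fun t => _) = (fun t => if cabs (g t) <= x then complex.Re (g t) else 0)); last first.
    by apply/funext => t; case: ifP.
  apply: measurable_fun_if => //; apply: measurable_funS mI _ _ => //; exact: subIsetl.
rewrite (_ : (fun t => _) = (fun t => if cabs (g t) <= x then complex.Im (g t) else 0)); last first.
  by apply/funext => t; case: ifP.
apply: measurable_fun_if => //; apply: measurable_funS mI _ _ => //; exact: subIsetl.
Qed.

Lemma truncate_cvg g e : cmfun I01 g -> (pint p g < +oo)%E -> 0 < e ->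
  exists n, (pint p (fun t => g t - (if cabs (g t) <= n%:R then g t else 0))%R <= e%:E)%E.
Proof.
move=> mg fg e0.
pose f_ n t := (cabs (g t - (if cabs (g t) <= n%:R then g t else 0)) `^ p)%:E.
have mf_ n : measurable_fun (I01 : set (measurableTypeR R)) (f_ n).
  by apply: measurable_cabs_powR => //; apply: cmfunB => //; exact: cmfun_truncate.
have ig : leb.-integrable I01 (fun t => (cabs (g t) `^ p)%:E).
  apply/integrableP; split; first exact: measurable_cabs_powR.
  rewrite (_ : (\int[_]_(x in _) _)%E = pint p g) //; apply: eq_integral => t _.
  by rewrite gee0_abs // lee_fin powR_ge0.
have cvg0 : {ae leb, forall t, I01 t -> f_ ^~ t @ \oo --> 0%E}.
  apply: aeW => t _; apply: cvg_near_cst.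
  near=> n; rewrite /f_ ifT ?subrr ?cabs0 ?powR0 ?gt_eqF //.
  near: n; exact: nbhs_infty_ger.
have dom : {ae leb, forall t N, I01 t -> (`|f_ N t| <= (cabs (g t) `^ p)%:E)%E}.
  apply: aeW => t N _; rewrite gee0_abs ?lee_fin ?powR_ge0 //.
  case: ifP => _; last by rewrite subr0.
  by rewrite subrr cabs0 powR0 ?gt_eqF // powR_ge0.
have [_ _ hlim] := @dominated_convergence _ _ _ leb I01 mI f_ (fun=> 0%E) _ mf_
  (measurable_cst _) cvg0 ig dom.
rewrite integral0 in hlim.
have ho : open_nbhs 0%E [set y : \bar R | (y < e%:E)%E].
  by split; [exact: open_ereal_lt_ereal | rewrite /= lte_fin].
have [N _ hN] := hlim _ (open_nbhs_nbhs ho).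
by exists N; apply: ltW; exact: (hN N (leqnn N)).
Unshelve. all: by end_near.
Qed.

Lemma pint_cst (x : R[i]) : pint p (fun=> x) = (cabs x `^ p)%:E.
Proof. by rewrite /pint integral_cst // [X in (_ * X)%E]leb_I01 mule1. Qed.

Lemma haar_dense g e : cmfun I01 g -> (pint p g < +oo)%E ->
  (forall b, (\int[leb]_(t in I01) (cpart b (g t))%:E)%E = 0%E) -> 0 < e ->
  exists N xi, (pint p (fun t => g t - haar_psum xi 0 N t)%R <= e%:E)%E.
Proof.
move=> mg fg g0 e0.
(* Two quasi-triangle inequalities, each with factor [2^p] and two equal error bounds; the inner
   ones are [4^p d^p]. *)
pose C := 2 `^ p * (2 * (2 `^ p * (2 * 4 `^ p))).
have hP x : 1 <= x -> 1 <= x `^ p by move=> x1; apply: (le_trans x1); exact: le1r_powR.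
have P2 : 1 <= 2 `^ p by apply: hP; rewrite ler1n.
have P4 : 1 <= 4 `^ p by apply: hP; rewrite ler1n.
have P24 : 1 <= 2 `^ p * 4 `^ p by apply: mulr_ege1.
have C0 : 0 < C by rewrite /C !mulr_gt0 ?powR_gt0.
pose d := (e / C) `^ p^-1.
have d0 : 0 < d by rewrite powR_gt0 // divr_gt0.
have dp : d `^ p = e / C.
  by rewrite /d -powRrM mulVf ?gt_eqF // powRr1 // ltW // divr_gt0.
have dp0 : 0 < d `^ p by exact: powR_gt0.
have [n hn] := truncate_cvg mg fg dp0.
pose G t := if cabs (g t) <= n%:R then g t else 0.
have mG : cmfun I01 G by exact: cmfun_truncate.
have GM t : cabs (G t) <= n%:R by rewrite /G; case: ifP => //; rewrite cabs0.
have fG : (pint p G < +oo)%E.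
  apply: le_lt_trans fg; apply: ge0_le_integral => //; try exact: measurable_cabs_powR.
  - by move=> t _; rewrite lee_fin powR_ge0.
  move=> t _; rewrite lee_fin; apply: powR_mono => //; first exact: ltW.
    exact: cabs_ge0.
  by rewrite /G; case: ifP => // _; rewrite cabs0 cabs_ge0.
have [N [xi hxi]] := haar_dense_bounded mG GM (mulr_gt0 (powR_gt0 p (ltr0n R 4)) dp0).
have hx : cabs (cavg G 0 0) <= 4 * d.
  apply: (le_trans (cabs_le_ReIm _)).
  have hb b : `|cpart b (cavg G 0 0)| <= 2 * d.
    have := cpart_mean_close p1 b mg mG fg fG d0 hn.
    by rewrite g0 sub0e abseN (integral_cpart_cavg mG GM) lee_fin.
  apply: (le_trans (lerD (hb true) (hb false))).
  by rewrite -mulrDl; apply: ler_wpM2r; [exact: ltW | rewrite -natrD].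
exists N, xi.
have mh := cmfun_haar_psum I01 xi 0 N.
have h1 : (pint p (fun t => G t - haar_psum xi 0 N t)%R <= (2 `^ p * (2 * (4 `^ p * d `^ p)))%:E)%E.
  rewrite (_ : pint p _ = pint p (fun t => (G t - (cavg G 0 0 + haar_psum xi 0 N t)) + cavg G 0 0)); last first.
    by apply: eq_pint => t _; ring.
  apply: (le_trans (pintD p1 (cmfunB mG (cmfunD (cmfun_cst _ _) mh)) (cmfun_cst _ _))).
  rewrite EFinM lee_wpmul2l ?lee_fin ?powR_ge0 //.
  rewrite mulrDl mul1r EFinD; apply: leeD => //.
  rewrite pint_cst lee_fin -powRM ?(ltW d0) //.
  by apply: powR_mono; [exact: ltW | exact: cabs_ge0 | exact: hx].
have h0 : (pint p (fun t => g t - G t)%R <= (2 `^ p * (2 * (4 `^ p * d `^ p)))%:E)%E.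
  apply: (le_trans hn); rewrite lee_fin.
  rewrite (_ : _ * _ = (2 `^ p * 4 `^ p) * (2 * d `^ p)); last by move: (2 `^ p) (4 `^ p) (d `^ p) => x y z; ring.
  apply: (@le_trans _ _ (2 * d `^ p)); first by rewrite ler_peMl ?(ltW dp0) // ler1n.
  by rewrite ler_peMl // mulr_ge0 // ltW.
apply: (le_trans (pint_triangle p1 mg mG mh h0 h1)).
rewrite lee_fin dp -[X in _ <= X](divfK (lt0r_neq0 C0)) /C.
move: (2 `^ p) (4 `^ p) (e / _) => x y z.
by rewrite (_ : x * _ = z * (x * (2 * (x * (2 * y))))) //; ring.
Qed.

End HaarDensity.

(** * Assembling the four conditions *)

Section Equivalences.
Variables (R : realType) (p : R).
Hypothesis p2 : 2 <= p.
Local Notation leb := (@lebesgue_measure R).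
Local Notation I01 := (@I01 R).

Let p1 : 1 <= p. Proof. by have := p2; lra. Qed.
Let p0 : 0 < p. Proof. by have := p2; lra. Qed.

Lemma comb_restr (F : nat -> R -> R[i]) (P P' : pred nat) M a : (forall n, P n -> P' n) ->
  comb F P M a = comb F P' M (restr P M a).
Proof.
move=> PP'; apply/funext => t; rewrite /comb big_mkcond [RHS]big_mkcond.
apply: eq_bigr => n _; rewrite /restr ltn_ord andbT.
by case: ifP => [/PP' ->|_] //; rewrite mul0r if_same.
Qed.

Lemma pint0 : pint p (fun=> 0) = 0%E.
Proof. by rewrite pint_cst cabs0 powR0 // gt_eqF. Qed.

Lemma mem_cspan (F : nat -> R -> R[i]) (P : pred nat) n : P n -> Lp p (F n) -> cspan p F P (F n).
Proof.
move=> Pn Ln; apply: (cspanP p1 F P (F n)).2; split=> // e e0.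
exists n.+1, (fun m => (m == n)%:R).
rewrite (_ : pint p _ = 0%E) ?lee_fin ?ltW // -pint0; apply: eq_pint => t _.
rewrite /comb big_mkcond big_ord_recr /= Pn eqxx mul1r big1 ?add0r ?subrr //.
by move=> m _; case: ifP => // _; rewrite ltn_eqF ?mul0r.
Qed.

Lemma Lp_haarn n : (0 < n)%N -> Lp p (@haarn R n).
Proof.
move=> n0; apply: (LpP p1 (@haarn R n)).2; split; first exact: cmfun_haarn.
rewrite (_ : pint p _ = pint p (comb (@haarn R) (fun m => m == n) n.+1 (fun=> 1))).
  by rewrite (pint_comb_haar p _ (N := n.+1)) ?ltry // => m /eqP ->.
apply: eq_pint => t _; rewrite /comb big_mkcond big_ord_recr /= eqxx mul1r big1 ?add0r //.
by move=> m _; rewrite ltn_eqF.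
Qed.

Lemma cspan_haar_mean0 (P : pred nat) g : (forall n, P n -> (0 < n)%N) ->
  cspan p (@haarn R) P g -> forall b, (\int[leb]_(t in I01) (cpart b (g t))%:E)%E = 0%E.
Proof.
move=> hP h b; have [Lg hg] := (cspanP p1 _ P g).1 h.
have [mg fg] := (LpP p1 g).1 Lg.
apply: (cpart_mean0_of_approx p1 b mg fg) => e e0.
have [M [a ha]] := hg e e0; exists M, (restr P M a).
apply: le_trans ha; rewrite le_eqVlt; apply/orP; left; apply/eqP.
apply: eq_pint => t _; rewrite (comb_haar_psum a t hP (N := M)) //.
by rewrite ltnW // ltn_expl.
Qed.

Lemma Lp0E : Lp0 p = cspan p (@haarn R) (fun n => (0 < n)%N).
Proof.
apply/seteqP; split=> g hg.
  have [Lg hm] := hg; have h1 := hm.1; have h2 := hm.2.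
  rewrite integral_muI in h1; rewrite integral_muI in h2.
  apply: (cspanP p1 (@haarn R) (fun n => (0 < n)%N) g).2; split; first exact: Lg.
  move=> e e0; have [mg fg] := (LpP p1 g).1 Lg.
  have h b : (\int[leb]_(t in I01) (cpart b (g t))%:E)%E = 0%E by case: b.
  have [N [xi hxi]] := haar_dense p1 mg fg h e0.
  exists (2 ^ N)%N, xi; apply: le_trans hxi.
  rewrite le_eqVlt; apply/orP; left; apply/eqP.
  by apply: eq_pint => t _; rewrite haar_psum_comb.
have h := cspan_haar_mean0 (fun n h => h) hg.
have [Lg _] := hg; split; first exact: Lg.
by split; rewrite integral_muI; [exact: (h true) | exact: (h false)].
Qed.

Variables (c : nat -> R[i]) (f : R -> R[i]).
Hypothesis hf : forall t, 0 < t <= 1 -> exists N, forall M, (N <= M)%N ->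
  f t = \sum_(k < M) c k * haarn (2 ^ k) t.
Hypothesis Lf : Lp p f.

Lemma dil1 (g : R -> R[i]) t : 0 < t <= 1 -> dil g 1 t = g t.
Proof.
by move=> t01; rewrite /dil trunc_log1 expr0 subnn mul0r divr1 t01 mul1r subr0.
Qed.

Lemma Lp_dil1 : Lp p (dil f 1).
Proof.
have [mf ff] := (LpP p1 f).1 Lf.
apply: (LpP p1 _).2; split; first by apply: haar_series_cmfun; exact: (haar_series_dil hf).
apply: le_lt_trans ff; rewrite le_eqVlt; apply/orP; left; apply/eqP.
by apply: eq_pint => t; exact: dil1.
Qed.

(** [P] may be anything between the powers of two and all positive integers, so (i) and (iii) are
    handled together. *)
Lemma symbol_of_equiv_basis (P : pred nat) :
  (forall n, pow2 n -> P n) -> (forall n, P n -> (0 < n)%N) ->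
  equiv_basis p (cspan p (@haarn R) P) (dil f) (@haarn R) P ->
  section_mult p c /\ exists2 b, cprod c b = @delta0 R & section_mult p b.
Proof.
move=> P2 P0 [hspan [A [B [A0 [B0 hAB]]]]].
have P1 : P 1%N by apply: P2; rewrite /pow2 (ones_pow2 0).
(* [f_1] agrees with [f] on [(0,1]], and every element of the closed Haar span has mean zero. *)
have mean0 b : (\int[leb]_(t in I01) (cpart b (f t))%:E)%E = 0%E.
  have h : cspan p (@haarn R) P (dil f 1) by rewrite -hspan; apply: mem_cspan => //; exact: Lp_dil1.
  rewrite -(cspan_haar_mean0 P0 h b); apply: eq_integral => t; rewrite inE => /mem_I01 t01.
  by rewrite dil1.
have bc := bounded_wsum_of_Lp p2 hf Lf mean0.
have hAB2 M a :
    (A%:E * pnorm p (comb (@haarn R) pow2 M a) <= pnorm p (comb (dil f) pow2 M a))%E /\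
    (pnorm p (comb (dil f) pow2 M a) <= B%:E * pnorm p (comb (@haarn R) pow2 M a))%E.
  by rewrite !(comb_restr _ _ _ P2); exact: hAB.
have happ e : 0 < e -> exists M a,
    (pint p (fun t => haarn 1 t - comb (dil f) (fun n => (0 < n)%N) M a t)%R <= e%:E)%E.
  move=> e0; have h : cspan p (dil f) P (haarn 1).
    by rewrite hspan; apply: mem_cspan => //; exact: Lp_haarn.
  have [_ /(_ e e0) [M [a ha]]] := (cspanP p1 (dil f) P (haarn 1)).1 h.
  exists M, (restr P M a).
  by rewrite -(comb_restr (P' := fun n => (0 < n)%N) (dil f) M a P0); exact: ha.
split; first exact: (symbol_section_mult p2 hf bc B0 hAB2).
exact: (symbol_section_mult_inverse p2 hf bc A0 hAB2 happ).
Qed.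

Lemma equiv_basis_ones : section_mult p c ->
  (exists2 b, cprod c b = @delta0 R & section_mult p b) ->
  forall d, (0 < d)%N ->
  equiv_basis p (Hch p d) (dil f) (@haarn R) (fun n => ones n == d).
Proof.
move=> mc [b cb mb] d d0; apply: (equiv_basis_of_symbol p2 hf mc mb cb).
  by move=> n; exact: ones_pred_gt0.
by move=> n k; rewrite ones_mul2X.
Qed.

End Equivalences.

Theorem theorem1 (R : realType) (p : R) (c : nat -> R[i]) (f : R -> R[i]) :
  2 <= p ->
  (* f = sum_k c_k h_{2^k}, the sum being finite at each point of I *)
  (forall t : R, 0 < t <= 1 -> exists N : nat, forall M : nat, (N <= M)%N ->
     f t = \sum_(k < M) c k * haarn (2 ^ k) t) ->
  Lp p f ->
  [<-> (* (i) *)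
       equiv_basis p (Lp0 p) (dil f) (@haarn R) (fun n => 0 < n)%N;
       (* (ii) *)
       (forall d : nat, (0 < d)%N ->
          equiv_basis p (Hch p d) (dil f) (@haarn R) (fun n => ones n == d));
       (* (iii) *)
       equiv_basis p (Hch p 1) (fun k => dil f (2 ^ k)%N)
                     (fun k => @haarn R (2 ^ k)%N) xpredT;
       (* (iv) *)
       (Mp p (2 `^ (- p^-1)) c /\
        exists b : nat -> R[i], Mp p (2 `^ (- p^-1)) b /\
          forall n : nat, cprod c b n = (n == 0%N)%:R)].
Proof.
move=> p2 hf Lf; have p1 : 1 <= p by lra.
rewrite (Lp0E p2); tfae.
(* Restricting the norm equivalence to [N_d] would not identify the closed span of the subsystem, so
   this step passes through the symbol and its inverse. *)
- move=> hi.
  have [|//|mc hb] := symbol_of_equiv_basis p2 hf Lf _ _ hi; first exact: pow2_gt0.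
  exact: (equiv_basis_ones p2 hf mc hb).
- by move=> /(_ 1%N isT) h; apply: (equiv_basis_pow2 _ _ _ _).1.
- move=> hiii; have h := (equiv_basis_pow2 _ _ _ _).2 hiii.
  have [//||mc [b cb mb]] := symbol_of_equiv_basis p2 hf Lf _ _ h; first exact: pow2_gt0.
  split; first exact/(MpP p2).
  by exists b; split; [exact/(MpP p2) | move=> n; rewrite cb].
move=> [mc [b [mb cb]]].
apply: (equiv_basis_of_symbol p2 hf ((MpP p2 c).1 mc) ((MpP p2 b).1 mb)).
- by apply/funext => n; rewrite cb.
- by [].
- by move=> n k n0; rewrite muln_gt0 n0 expn_gt0.
Qed.
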